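(* Let $D\subset\mathbb{R}^n$ be open, $I\subset\mathbb{R}$ an interval, and let $f:D\to\mathbb{R}^n$ and $g:I\times D\to\mathbb{R}^n$ be of class $C^r$, $r\ge2$. Consider $\dot{\mathbf z}=f(\mathbf z)+g(t,\mathbf z)$. Suppose $\dot{\mathbf z}=f(\mathbf z)$ has a non-trivial $T$-periodic orbit $\varphi(t)$, and let $\Psi(t)$ be the principal fundamental matrix solution ($\Psi(0)=I_n$) of the first variational equation $\dot{\mathbf y}=Df(\varphi(t))\mathbf y$. Let $d$ be the A-index of this variational equation and let $q_0$ be the largest $q\in\mathbb{N}=\{0,1,2,\dots\}$ such that $(\Psi(T)-I_n)^q v=\varphi'(0)$ has a solution $v\in\mathbb{R}^n$. Then $q_0\le n-d-1$, and there is a real $C^r$ matrix function $U:\mathbb{R}\to\mathbb{R}^{n\times(n-1)}$ satisfying \[ U(t+T)=U(t)\,\big[I_{n-d-1}\oplus(-I_d)\big]\quad\text{for all } t, \] such that, for $(\mathbf v,\mathbf w)$ in a sufficiently small neighborhood of $0$, the change of variables $\mathbf z\mapsto(s,\mathbf v,\mathbf w)\in\mathbb{R}\times\mathbb{R}^{n-d-1}\times\mathbb{R}^d$, $\mathbf z=\varphi(s)+U(s)\begin{bmatrix}\mathbf v\\ \mathbf w\end{bmatrix}$, transforms the perturbed system into \[ \begin{aligned} \dot s&=1+L\mathbf v+\Lambda_0(s,\mathbf v,\mathbf w)+\tilde\Lambda_0(t,s,\mathbf v,\mathbf w),\\ \dot{\mathbf v}&=H_1\mathbf v+\Lambda_1(s,\mathbf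 v,\mathbf w)+\tilde\Lambda_1(t,s,\mathbf v,\mathbf w),\\ \dot{\mathbf w}&=H_2\mathbf w+\Lambda_2(s,\mathbf v,\mathbf w)+\tilde\Lambda_2(t,s,\mathbf v,\mathbf w), \end{aligned} \] where $H_1\in\mathbb{R}^{(n-d-1)\times(n-d-1)}$, $H_2\in\mathbb{R}^{d\times d}$, $L\in\mathbb{R}^{1\times(n-d-1)}$, and: (i) if $\{\lambda_\ell:\ell=1,\dots,n-1\}$ are the eigenvalues (with multiplicity) of the derivative of the Poincaré map associated to $\varphi$ (equivalently, the eigenvalues of $\Psi(T)$ with one copy of the eigenvalue $1$ corresponding to $\varphi'(0)$ removed), then the real parts of the eigenvalues of $H_1\oplus H_2$ are $\{\tfrac1T\log|\lambda_\ell|:\ell=1,\dots,n-1\}$; (ii) $\Lambda_\ell(s,0,0)=0$ and $\frac{\partial\Lambda_\ell}{\partial(\mathbf v,\mathbf w)}(s,0,0)=0$ for all $s$ and $\ell\in\{0,1,2\}$; (iii) for $\ell\in\{0,1\}$: $\Lambda_\ell(s+T,\mathbf v,\mathbf w)=\Lambda_\ell(s,\mathbf v,-\mathbf w)$ and $\tilde\Lambda_\ell(t,s+T,\mathbf v,\mathbf w)=\tilde\Lambda_\ell(t,s,\mathbf v,-\mathbf w)$; (iv) $\Lambda_2(s+T,\mathbf v,\mathbf w)=-\Lambda_2(s,\mathbf v,-\mathbf w)$ and $\tilde\Lambda_2(t,s+T,\mathbf v,\mathbf w)=-\tilde\Lambda_2(t,s,\mathbf v,-\mathbf w)$; (v)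 there is $C>0$ with $\big\|\tilde\Lambda_\ell(t,s,\mathbf v,\mathbf w)\big\|<C\,\big\|g\big(t,\varphi(s)+U(s)[\mathbf v;\mathbf w]\big)\big\|$ for $\ell\in\{0,1,2\}$; (vi) if $q_0=0$ then $L=0$; if $1\le q_0\le n-d-1$ then $L=[L_1\;L_2\;\cdots\;L_{q_0}\;0\;\cdots\;0]$ with $L_1,\dots,L_{q_0}\in\mathbb{R}$.
   Context: For a linear $T$-periodic system $\dot{\mathbf x}=A(t)\mathbf x$ with fundamental matrix $\Phi$, the monodromy matrix is $\Phi^{-1}(0)\Phi(T)$ (its Jordan form is independent of $\Phi$). The A-index of such a system is the sum, over each distinct Jordan block of the Jordan normal form of a monodromy matrix that is associated to a real negative eigenvalue and occurs an odd number of times, of the dimension of that block (each such distinct block counted only once). $I_m$ is the $m\times m$ identity, $\oplus$ the block-diagonal direct sum.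
   Formalization: In (v) the bound is proved as ‖Λ̃_ℓ‖ ≤ C‖g‖ instead of the strict inequality, which cannot hold at points where g vanishes (e.g. g ≡ 0); where g ≠ 0 the strict bound follows with a larger C. *)

(* Defs.v *)
From HB Require Import structures.
From mathcomp Require Import all_boot all_order all_algebra.
From mathcomp Require Import all_classical all_reals all_analysis.
From mathcomp Require Import complex.
Import Order.TTheory GRing.Theory Num.Theory.
Import numFieldNormedType.Exports.

Set Implicit Arguments.
Unset Strict Implicit.
Unset Printing Implicit Defensive.

Local Open Scope ring_scope.
Local Open Scope classical_set_scope.

Section Defs.
Variable R : realType.

Definition basis_cV m (i : 'I_m) : 'cV[R]_m := delta_mx i 0.

Fixpoint iter_partial m (V : normedModType R) (l : seq 'I_m)
    (F : 'cV[R]_m -> V) : 'cV[R]_m -> V :=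
  match l with
  | [::] => F
  | i :: l' => fun x => 'D_(basis_cV i) (iter_partial l' F) x
  end.

Definition Cr_on m (V : normedModType R) (r : nat) (O : set 'cV[R]_m)
    (F : 'cV[R]_m -> V) : Prop :=
  forall x, O x ->
    (forall l : seq 'I_m, (size l < r)%N -> forall i : 'I_m,
        derivable (iter_partial l F) x (basis_cV i)) /\
    (forall l : seq 'I_m, (size l <= r)%N ->
        {for x, continuous (iter_partial l F)}).

Definition Cr_R (V : normedModType R) (r : nat) (F : R -> V) : Prop :=
  (forall k, (k < r)%N -> forall t, derivable (iter k (@derive1 R V) F) t 1) /\
  (forall k, (k <= r)%N -> continuous (iter k (@derive1 R V) F)).

Definition jacobian_mx m p (F : 'cV[R]_m -> 'cV[R]_p) (x : 'cV[R]_m)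
  : 'M[R]_(p, m) :=
  \matrix_(i < p, j < m) ('D_(basis_cV j) F x) i 0.

Local Notation C := R[i].

Definition mxe n (J : 'M[C]_n) (i j : nat) : C :=
  match insub i, insub j with
  | Some i', Some j' => J i' j'
  | _, _ => 0
  end.

Definition is_jordan_mx n (J : 'M[C]_n) : Prop :=
  forall i j : nat, (i < n)%N -> (j < n)%N -> mxe J i j != 0 ->
    (i == j) || [&& j == i.+1, mxe J i j == 1 & mxe J i i == mxe J j j].

Definition jordan_block_at n (J : 'M[C]_n) (a b : nat) : bool :=
  [&& (a <= b)%N, (b < n)%N,
      (a == 0)%N || (mxe J a.-1 a == 0),
      (b.+1 == n) || (mxe J b b.+1 == 0) &
      all (fun k => mxe J k k.+1 == 1) (iota a (b - a))].

Definition jordan_blocks n (J : 'M[C]_n) : seq (nat * nat) :=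
  [seq p <- [seq (a, b) | a <- iota 0 n, b <- iota 0 n]
     | jordan_block_at J p.1 p.2].

Definition jordan_block_types n (J : 'M[C]_n) : seq (C * nat) :=
  [seq (mxe J p.1 p.1, (p.2 - p.1).+1) | p <- jordan_blocks J].

Definition aindex_of_jordan n (J : 'M[C]_n) : nat :=
  let s := jordan_block_types J in
  \sum_(x <- undup s | ((@complex.Im R x.1 == 0) && (@complex.Re R x.1 < 0)) && odd (count_mem x s))
     x.2.

(* d is the A-index of a (real) monodromy matrix M: computed from a Jordan
   normal form of M (over C); by uniqueness of the Jordan form this does not
   depend on the chosen Jordan form. *)
Definition is_A_index n (M : 'M[R]_n) (d : nat) : Prop :=
  exists (P J : 'M[C]_n),
    [/\ P \in unitmx, is_jordan_mx J,
        invmx P *m map_mx (fun x : R => (x%:C)%C) M *m P = J &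
        d = aindex_of_jordan J].

End Defs.

Section Defs2.
Variable R : realType.

Definition vanish_order2_at0 k (V : normedModType R) (F : 'cV[R]_k -> V) : Prop :=
  [/\ F 0 = 0, differentiable F 0 & forall h, 'd F 0 h = 0].

End Defs2.

(* Main.v *)
(* Let [M = Psi T]. In a complex Jordan basis, equal Jordan blocks with a negative eigenvalue are
   grouped in pairs; a pair carries a real operator [Th] with [Th^2 = -1] commuting with [M], so
   that minus the identity is [exp (pi Th)] there, while the blocks left over span the range of a
   real idempotent [Po] whose rank is the A-index [d]. Since polynomials in the nilpotent part
   and conjugation-symmetric functions of the eigenvalues are real, this gives a real [B]
   commuting with [Po] such that [M = (1 - 2 Po) exp (T B)], and the fixed vectors of [M] lie in
   the kernels of [Po] and [B].

   In a basis [(p, Q)] with [p = phi'(0)] and [Q] adapted to [Po], [B] becomes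
   [[0, (L, 0)], [0, H1 (+) H2]], and [U s = Psi s exp (- s B) Q] satisfies
   [U' = Df(phi) U - phi' (L, 0) - U (H1 (+) H2)] and [U (s + T) = U s (1 (+) - 1)]. Inverting
   [(phi', U)] in [s' (phi' + U' x) + U x' = f + g] yields the normal form. A change of basis of
   the first factor leaves at most one nonzero entry in [L], and if [p] is not in the range of
   [M - 1] a left fixed vector of [M] that is nonzero on [p] can be used to choose [Q] so that
   [L = 0]. The chain [v, (M - 1) v, ..., p] together with the range of [Po] gives
   [q0 + 1 + d <= n]. *)

Require Import Defs.
From HB Require Import structures.
From mathcomp Require Import all_boot all_order all_algebra.
From mathcomp Require Import all_classical all_reals all_analysis.
From mathcomp Require Import complex.
From mathcomp Require Import zify ring lra.
Import Order.TTheory GRing.Theory Num.Theory.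
Import numFieldNormedType.Exports.
Local Open Scope ring_scope.
Local Open Scope classical_set_scope.

Set Implicit Arguments.
Unset Strict Implicit.
Unset Printing Implicit Defensive.

(** * Functional calculus on a Jordan form *)

(** An invertible real matrix has a real logarithm exactly when each Jordan block of a negative
    eigenvalue occurs an even number of times. One block of each odd type is therefore the whole
    obstruction, and [d] is its total size. Instead of doubling the period, the proof keeps the
    obstruction as the involution [1 - 2 Po], which becomes the sign change of the second factor
    over one period. The operator [Th] is not a function of [M], so conjugation symmetry cannot make
    it real. Its reality comes from cutting [M] down to its negative spectrum: there the Jordan
    matrix has real entries, and a complex similarity of real matrices can be replaced by a real
    one. No value [pi] or [- pi] of the argument on the negative axis is symmetric under
    conjugation. The argument is set to 0 there and the missing half-turn is supplied by [Th] at
    speed [pi / T]. Its eigenvalues are imaginary, so the real parts in (i) do not see it. One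
    radius [delta] serves all [s] because the frame, its inverse and its derivative are periodic up
    to an involution, hence bounded. *)

Section JordanShape.
Variable K : fieldType.

(** Weaker than a Jordan form: superdiagonal entries may have any value. What matters is that a
    nonzero entry never joins two different eigenvalues, a property that survives conjugation and
    the cutting off of eigenvalues. *)
Definition jordan_shape n (J : 'M[K]_n) : Prop :=
  forall i j, J i j != 0 -> i = j \/ ((j : nat) = i.+1 /\ J i i = J j j).

Lemma jordan_shape_scalar n (a : K) : jordan_shape (a%:M : 'M[K]_n).
Proof.
move=> i j; rewrite !mxE; case: (eqVneq i j) => [->|]; first by left.
by move=> _ /eqP; rewrite mulr0n.
Qed.

(* The Sylvester equation decouples the (generalized) eigenspaces. *)
Lemma jordan_intertwine0 m n (J : 'M[K]_m) (J' : 'M[K]_n) (X : 'M[K]_(m, n)) :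
  jordan_shape J -> jordan_shape J' -> J *m X = X *m J' ->
  forall i j, J i i != J' j j -> X i j = 0.
Proof.
move=> hJ hJ' JX i j; have [k] := ubnP (m - i + j)%N.
elim: k i j => [|k IHk] i j // le_k nij.
have := congr1 (fun A : 'M[K]_(m, n) => A i j) JX.
rewrite /= !mxE (bigD1 i)//= (bigD1 j)//= [X in _ + X]big1 ?addr0; last first.
  move=> l nli; have [->|/hJ[il|[li Jil]]] := eqVneq (J i l) 0; first by rewrite mul0r.
    by rewrite il eqxx in nli.
  by rewrite IHk ?mulr0 -?Jil//; have := ltn_ord i; lia.
rewrite [X in _ = _ + X]big1 ?addr0; last first.
  move=> l nlj; have [->|/hJ'[il|[li Jil]]] := eqVneq (J' l j) 0; first by rewrite mulr0.
    by rewrite il eqxx in nlj.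
  by rewrite IHk ?mul0r ?Jil//; have := ltn_ord i; lia.
move/eqP; rewrite [X in _ == X]mulrC -subr_eq0 -mulrBl mulf_eq0 subr_eq0 (negbTE nij) /=.
by move/eqP.
Qed.

(** [F] acts on the diagonal alone, which gives functions of the semisimple part. The nilpotent part
    is handled separately by finite power series. *)
Definition diag_fun n (J : 'M[K]_n) (F : K -> K) : 'M[K]_n :=
  diag_mx (\row_i F (J i i)).

(** Entrywise the two sides differ by a multiple of [F (J i i) - F (J' j j)], and [X i j] vanishes
    when these eigenvalues differ. Hence [F] may be arbitrary, even discontinuous. *)
Lemma diag_fun_intertwine m n (J : 'M[K]_m) (J' : 'M[K]_n) (X : 'M[K]_(m, n)) F :
  jordan_shape J -> jordan_shape J' -> J *m X = X *m J' ->
  diag_fun J F *m X = X *m diag_fun J' F.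
Proof.
move=> hJ hJ' JX; apply/matrixP => i j.
rewrite mul_diag_mx mul_mx_diag !mxE.
have [->|nJ] := eqVneq (J i i) (J' j j); first by rewrite mulrC.
by rewrite (jordan_intertwine0 hJ hJ' JX nJ) mul0r mulr0.
Qed.

Lemma diag_funM n (J : 'M[K]_n) F G :
  diag_fun J F *m diag_fun J G = diag_fun J (fun z => F z * G z).
Proof. by rewrite /diag_fun mulmx_diag; congr diag_mx; apply/rowP => i; rewrite !mxE. Qed.

Lemma eq_diag_fun n (J : 'M[K]_n) F G :
  (forall i, F (J i i) = G (J i i)) -> diag_fun J F = diag_fun J G.
Proof. by move=> FG; congr diag_mx; apply/rowP => i; rewrite !mxE. Qed.

Lemma diag_fun_cst n (J : 'M[K]_n) c : diag_fun J (fun=> c) = c%:M.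
Proof. by apply/matrixP => i j; rewrite !mxE. Qed.

Lemma strict_upper_pow n (A : 'M[K]_n) :
  (forall i j : 'I_n, A i j != 0 -> (i < j)%N) ->
  forall k (i j : 'I_n), (A ^+ k) i j != 0 -> (i + k <= j)%N.
Proof.
move=> hA; elim=> [|k IHk] i j.
  by rewrite expr0 mxE; case: (eqVneq i j) => [->|_]; rewrite ?addn0 // mulr0n => /eqP.
rewrite exprS mxE => /negP ne; apply: contrapT => /negP; rewrite -ltnNge => lij.
apply: ne; apply/eqP; apply: big1 => l _.
have [->|/hA il] := eqVneq (A i l) 0; first by rewrite mul0r.
have [->|/IHk lj] := eqVneq ((A ^+ k) l j) 0; first by rewrite mulr0.
by lia.
Qed.

Lemma strict_upper_nilpotent n (A : 'M[K]_n) :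
  (forall i j : 'I_n, A i j != 0 -> (i < j)%N) -> A ^+ n = 0.
Proof.
move=> hA; apply/matrixP => i j; rewrite [RHS]mxE; apply/eqP; apply: contraT.
by move/(strict_upper_pow hA); have := ltn_ord j; lia.
Qed.

End JordanShape.

Section RealCalculus.
Variable R : realType.
Local Notation C := R[i].
Local Notation toC := (real_complex R).
Local Notation "A ^%C" := (map_mx toC A) (at level 2, format "A ^%C").

Lemma real_matrixP m n (A : 'M[C]_(m, n)) :
  map_mx (@conjc R) A = A -> (map_mx (@complex.Re R) A)^%C = A.
Proof.
move=> hA; apply/matrixP => i j.
have := congr1 (fun B : 'M[C]_(m, n) => B i j) hA; rewrite !mxE.
by case: (A i j) => a b /= [] hb; apply/eqP; rewrite eq_complex /= eqxx /=; apply/eqP; lra.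
Qed.

Lemma map_toC_inj m n : injective (fun A : 'M[R]_(m, n) => A^%C).
Proof. by apply: map_mx_inj; exact: complexI. Qed.

Definition conj_sym (F : C -> C) := forall z, F (conjc z) = conjc (F z).

Variables (n : nat) (M : 'M[R]_n) (P J : 'M[C]_n).
Hypotheses (Pu : P \in unitmx) (hJ : jordan_shape J) (MP : M^%C *m P = P *m J).

Definition fcalc F : 'M[C]_n := P *m diag_fun J F *m invmx P.
Definition rcalc F : 'M[R]_n := map_mx (@complex.Re R) (fcalc F).

Lemma fcalcM F G : fcalc F *m fcalc G = fcalc (fun z => F z * G z).
Proof. by rewrite /fcalc !mulmxA mulmxKV // -diag_funM !mulmxA. Qed.

Lemma eq_fcalc F G : (forall i, F (J i i) = G (J i i)) -> fcalc F = fcalc G.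
Proof. by move=> FG; rewrite /fcalc (eq_diag_fun FG). Qed.

Lemma fcalc_cst c : fcalc (fun=> c) = c%:M.
Proof.
by rewrite /fcalc diag_fun_cst mul_mx_scalar -scalemxAl mulmxV // scalemx1.
Qed.

(** Seen through [P], a matrix commuting with [M] intertwines [J] with itself. *)
Lemma fcalc_comm A F : comm_mx A M^%C -> comm_mx A (fcalc F).
Proof.
have [X ->] : exists X, A = P *m X *m invmx P.
  by exists (invmx P *m A *m P); rewrite !mulmxA mulmxV // mul1mx mulmxK.
move=> AM; have JX : J *m X = X *m J.
  have ME : M^%C = P *m J *m invmx P by rewrite -MP mulmxK.
  move: AM; rewrite /comm_mx ME !mulmxA !mulmxKV // => /(can_inj (mulmxK _)).
  by rewrite -!mulmxA unitmx_inv Pu => /(_ isT) /(can_inj (mulKmx Pu)).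
have DX := diag_fun_intertwine F hJ hJ JX.
rewrite /comm_mx /fcalc !mulmxA !mulmxKV //; congr (_ *m invmx P).
by rewrite -!mulmxA DX.
Qed.

(** A fixed vector is a one-column intertwiner between [J] and the scalar 1. *)
Lemma fcalc_fix (v : 'cV[C]_n) F : M^%C *m v = v -> fcalc F *m v = F 1 *: v.
Proof.
move=> Mv; pose X := invmx P *m v.
have JX : J *m X = X *m (1%:M : 'M[C]_1).
  rewrite mulmx1 /X mulmxA -[J](mulKmx Pu) -MP mulmxA.
  by rewrite mulmxK // -mulmxA Mv.
have := diag_fun_intertwine F hJ (@jordan_shape_scalar C 1 1) JX.
have -> : diag_fun (1%:M : 'M[C]_1) F = (F 1)%:M.
  by apply/matrixP => i j; rewrite !mxE !ord1 eqxx.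
rewrite mul_mx_scalar /fcalc -!mulmxA -/X => ->.
by rewrite -scalemxAr /X mulKVmx.
Qed.

Lemma fcalc_lfix (l : 'rV[C]_n) F : l *m M^%C = l -> l *m fcalc F = F 1 *: l.
Proof.
move=> lM; pose X := l *m P.
have JX : (1%:M : 'M[C]_1) *m X = X *m J by rewrite mul1mx /X -mulmxA -MP mulmxA lM.
have := diag_fun_intertwine F (@jordan_shape_scalar C 1 1) hJ JX.
have -> : diag_fun (1%:M : 'M[C]_1) F = (F 1)%:M.
  by apply/matrixP => i j; rewrite !mxE !ord1 eqxx.
rewrite mul_scalar_mx /fcalc !mulmxA -/X => <-.
by rewrite -scalemxAl /X mulmxK.
Qed.

Lemma conj_toC m p (A : 'M[R]_(m, p)) : map_mx (@conjc R) A^%C = A^%C.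
Proof. by apply/matrixP => i j; rewrite !mxE /= oppr0. Qed.

(* [invmx P *m conj P] intertwines [J] with its conjugate. *)
Lemma rcalcE F : conj_sym F -> (rcalc F)^%C = fcalc F.
Proof.
move=> hF; apply: real_matrixP.
pose Pb := map_mx (@conjc R) P; pose Jb := map_mx (@conjc R) J.
have Pbu : Pb \in unitmx by rewrite map_unitmx.
have MPb : M^%C *m Pb = Pb *m Jb by rewrite -[M^%C]conj_toC -!map_mxM MP.
have hJb : jordan_shape Jb.
  move=> i j; rewrite !mxE conjc_eq0 => /hJ[|[e Je]]; first by left.
  by right; split => //; rewrite Je.
pose X := invmx P *m Pb.
have JX : J *m X = X *m Jb.
  rewrite /X -mulmxA -MPb !mulmxA; congr (_ *m _).
  by rewrite -[J](mulKmx Pu) -MP mulmxA mulmxK.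
have DX := diag_fun_intertwine F hJ hJb JX.
have -> : map_mx (@conjc R) (fcalc F) = Pb *m diag_fun Jb F *m invmx Pb.
  rewrite /fcalc !map_mxM map_invmx; congr (_ *m _ *m _).
  apply/matrixP => i j; rewrite !mxE hF.
  exact: (rmorphMn (@conjc R)).
have -> : Pb = P *m X by rewrite /X mulKVmx.
rewrite -(mulmxA P X) -DX /fcalc.
have Xu : X \in unitmx by rewrite unitmx_mul unitmx_inv Pu.
apply: (canLR (mulmxK _)); first by rewrite unitmx_mul Pu.
by rewrite !mulmxA mulmxKV.
Qed.

End RealCalculus.

(** * Pairing equal Jordan blocks *)

(** Greedy matching along the list. [O] holds the elements still waiting for a partner, at most one
    per label; a new element is matched with the waiting one of its label, or else waits. A label is
    left over exactly when its multiplicity is odd, and [eps] orients each pair. *)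
Lemma odd_pairing (T L : eqType) (lab : T -> L) (s : seq T) : uniq s ->
  exists (tau : T -> T) (eps : T -> bool) (O : seq T),
    [/\ uniq (map lab O), {subset O <= s},
        forall x, x \in s -> x \notin O ->
          [/\ tau x \in s, tau x \notin O, tau (tau x) = x,
              lab (tau x) = lab x & eps (tau x) = ~~ eps x] &
        forall a, (a \in map lab O) = odd (count_mem a (map lab s))].
Proof.
elim: s => [_|x s IHs /= /andP[xs us]]; first by exists id, xpredT, [::]; split.
have [tau [eps [ O [uO Os tauP oddP]]]] := IHs us.
have [/mapP[y yO lab_xy]|xNO] := boolP (lab x \in map lab O); last first.
  exists tau, eps, (x :: O); split => //=.
  - by rewrite xNO.
  - by move=> z; rewrite !inE => /predU1P[->|/Os ->]; rewrite ?eqxx ?orbT.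
  - move=> z; rewrite !inE negb_or => /predU1P[->|zs]; first by rewrite eqxx.
    move=> /andP[_ /tauP]/(_ zs)[h1 h2 h3 h4 h5]; split => //.
    + by rewrite ?inE h1 orbT.
    + by rewrite ?inE negb_or h2 andbT; apply: contraNneq xs => <-.
  - move=> a; rewrite inE oddD -oddP; have [->|_] := eqVneq a (lab x).
      by rewrite (negbTE xNO).
    by [].
have ys := Os _ yO; have nxy : x != y by apply: contraNneq xs => ->.
exists (fun z => if z == x then y else if z == y then x else tau z).
exists (fun z => if z == x then false else if z == y then true else eps z).
exists (rem y O); have uO' := map_uniq uO; split => //=.
- by apply: subseq_uniq uO; apply: map_subseq; exact: rem_subseq.
- by move=> z /mem_rem /Os zs; rewrite inE zs orbT.
- move=> z; rewrite inE mem_rem_uniq // inE negb_and negbK.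
  have [-> _ _|nzx /=] := eqVneq z x.
    rewrite [y == x]eq_sym (negbTE nxy) eqxx; split => //.
    by rewrite mem_rem_uniq // inE eqxx.
  have [-> _ _|nzy /= zs zO] := eqVneq z y.
    rewrite !eqxx; split => //.
    by apply: contra xs => /mem_rem /Os.
  have [h1 h2 h3 h4 h5] := tauP _ zs zO.
  have n1 : tau z != x by apply: contraNneq xs => <-.
  have n2 : tau z != y by apply: contraNneq h2 => ->.
  rewrite (negbTE n1) (negbTE n2); split => //.
  by apply: contra h2 => /mem_rem.
- move=> a; rewrite oddD -oddP.
  have perm_O : perm_eq (map lab O) (lab y :: map lab (rem y O)).
    by apply: (perm_map lab (perm_to_rem yO)).
  rewrite (perm_mem perm_O) inE lab_xy.
  move: uO; rewrite (perm_uniq perm_O) /= => /andP[yN _].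
  have [->|_] := eqVneq a (lab y); first by rewrite (negbTE yN).
  by [].
Qed.

Section JordanBlocks.
Variables (R : realType) (n : nat) (J : 'M[R[i]]_n).
Hypothesis hJ : is_jordan_mx J.

Lemma mxe_ord (i j : 'I_n) : mxe J i j = J i j.
Proof. by rewrite /mxe !valK. Qed.

Lemma is_jordan_shape : jordan_shape J.
Proof.
move=> i j; rewrite -mxe_ord => /(hJ (ltn_ord i) (ltn_ord j)) /orP[/eqP/val_inj|]; first by left.
by move=> /and3P[/eqP e _ /eqP]; rewrite !mxe_ord => ->; right.
Qed.

Lemma jordan_super k : (k.+1 < n)%N -> mxe J k k.+1 != 0 ->
  mxe J k k.+1 = 1 /\ mxe J k k = mxe J k.+1 k.+1.
Proof.
move=> kn /(hJ (ltnW kn) kn) /orP[|/and3P[_ /eqP -> /eqP ->] //].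
by rewrite eqn_leq ltnn andbF.
Qed.

Lemma jordan_block_left i : (i < n)%N -> exists a, [/\ (a <= i)%N,
  (a == 0)%N || (mxe J a.-1 a == 0) &
  forall k, (a <= k < i)%N -> mxe J k k.+1 = 1].
Proof.
elim: i => [_|i IHi lin]; first by exists 0%N; split => // k; rewrite ltn0 andbF.
have [z|nz] := eqVneq (mxe J i i.+1) 0.
  by exists i.+1; split; rewrite ?z ?eqxx// => k; lia.
have [a [ai a0 h]] := IHi (ltnW lin); exists a; split => // [|k /andP[ak]].
  exact: leqW.
rewrite ltnS leq_eqVlt => /predU1P[->|ki]; first by have [] := jordan_super lin nz.
by apply: h; rewrite ak.
Qed.

Lemma jordan_block_right i : (i < n)%N -> exists b, [/\ (i <= b < n)%N,
  (b.+1 == n) || (mxe J b b.+1 == 0) &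
  forall k, (i <= k < b)%N -> mxe J k k.+1 = 1].
Proof.
move=> lin; have [m] := ubnP (n - i)%N; elim: m i lin => // m IHm i lin lt_m.
have [ein|nein] := eqVneq i.+1 n.
  by exists i; split; rewrite ?ein ?eqxx ?leqnn //; move=> k; lia.
have lin1 : (i.+1 < n)%N by rewrite ltn_neqAle nein.
have [z|nz] := eqVneq (mxe J i i.+1) 0.
  by exists i; split; rewrite ?leqnn ?z ?eqxx ?orbT //; move=> k; lia.
have [|b [/andP[ib bn] b0 h]] := IHm _ lin1; first by lia.
exists b; split; rewrite ?bn ?andbT ?(ltnW ib) // => k /andP[].
rewrite leq_eqVlt => /predU1P[<- _|ik kb]; first by have [] := jordan_super lin1 nz.
by apply: h; rewrite ik.
Qed.

Lemma mem_jordan_blocks a b : ((a, b) \in jordan_blocks J) = jordan_block_at J a b.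
Proof.
rewrite mem_filter /=; have [/and4P[ab bn _ _]|//] := boolP (jordan_block_at J a b).
by apply/allpairsP; exists (a, b); rewrite !mem_iota /= !add0n bn (leq_ltn_trans ab).
Qed.

Lemma jordan_blocks_uniq : uniq (jordan_blocks J).
Proof. by apply/filter_uniq/allpairs_uniq; rewrite ?iota_uniq // => -[? ?] []. Qed.

Lemma jordan_blockP a b : jordan_block_at J a b ->
  [/\ (a <= b)%N, (b < n)%N, (a == 0)%N || (mxe J a.-1 a == 0),
      (b.+1 == n) || (mxe J b b.+1 == 0) &
      forall k, (a <= k < b)%N -> mxe J k k.+1 = 1].
Proof.
move=> /and5P[ab bn ha hb /allP h]; split => // k kab.
by apply/eqP/h; rewrite mem_iota subnKC.
Qed.

(** Blocks are maximal runs of ones on the superdiagonal. Two blocks that share an index coincide,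
    since an endpoint of one inside the other would meet an entry equal to both 0 and 1. *)
Lemma jordan_block_fun : exists blk : 'I_n -> nat * nat,
  [/\ forall i, blk i \in jordan_blocks J,
      forall i, ((blk i).1 <= i <= (blk i).2)%N &
      forall (i : 'I_n) p, p \in jordan_blocks J -> (p.1 <= i <= p.2)%N -> p = blk i].
Proof.
have ex (i : 'I_n) : exists p, (p \in jordan_blocks J) && (p.1 <= i <= p.2)%N.
  have [a [ai ha h1]] := jordan_block_left (ltn_ord i).
  have [b [/andP[ib bn] hb h2]] := jordan_block_right (ltn_ord i).
  exists (a, b); rewrite /= ai ib mem_jordan_blocks; apply/andP; split=> //; apply/and5P; split => //.
    exact: leq_trans ai ib.
  apply/allP => k; rewrite mem_iota subnKC ?(leq_trans ai ib) // => /andP[ak kb].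
  by apply/eqP; have [ki|ik] := ltnP k i; [apply: h1; rewrite ak|apply: h2; rewrite ik].
exists (fun i => xchoose (ex i)); split => [i|i|i [a b]].
- by have /andP[] := xchooseP (ex i).
- by have /andP[] := xchooseP (ex i).
have /andP[] := xchooseP (ex i); case: (xchoose _) => a' b' /=.
rewrite !mem_jordan_blocks => /jordan_blockP[ab bn ha hb h] /andP[ai ib].
move=> /jordan_blockP[ab' bn' ha' hb' h'] /andP[ai' ib'].
have ea : a = a'.
  apply/eqP; rewrite eqn_leq; apply/andP; split; rewrite leqNgt; apply/negP => lt_a.
  - move: ha'; case: (a) lt_a ai' => // k lt_a ki; rewrite /= h ?oner_eq0 //; lia.
  - move: ha; case: (a') lt_a ai => // k lt_a ki; rewrite /= h' ?oner_eq0 //; lia.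
suff eb : b = b' by rewrite ea eb.
apply/eqP; rewrite eqn_leq; apply/andP; split; rewrite leqNgt; apply/negP => lt_b.
- by move: hb => /orP[/eqP|]; rewrite ?h' ?oner_eq0 //; lia.
- by move: hb' => /orP[/eqP|]; rewrite ?h ?oner_eq0 //; lia.
Qed.

Lemma jordan_block_diag a b : jordan_block_at J a b ->
  forall k, (a <= k <= b)%N -> mxe J k k = mxe J a a.
Proof.
move=> /jordan_blockP[ab bn _ _ h] k /andP[]; elim: k => [|k IHk].
  by rewrite leqn0 => /eqP ->.
rewrite leq_eqVlt => /predU1P[-> //|ak kb].
have [|_ <-] := @jordan_super k (leq_ltn_trans kb bn); last by apply: IHk; lia.
by rewrite h ?oner_eq0 //; lia.
Qed.

(** A closed formula for the entries reduces the comparison of two equal blocks to index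
    arithmetic. *)
Lemma jordan_entry (blk : 'I_n -> nat * nat) :
  (forall i, blk i \in jordan_blocks J) ->
  (forall i, ((blk i).1 <= i <= (blk i).2)%N) ->
  (forall (i : 'I_n) p, p \in jordan_blocks J -> (p.1 <= i <= p.2)%N -> p = blk i) ->
  forall i j, J i j = if blk i == blk j then
    mxe J (blk i).1 (blk i).1 *+ (i == j) + ((j : nat) == i.+1)%:R else 0.
Proof.
move=> blkJ blkI blkU i j.
have := blkJ i; have := blkI i; have bi := blkU i; have bj := blkU j.
case: (blk i) bi => a b bi /= abi; rewrite mem_jordan_blocks => hab.
have [hab1 bn ha hb h] := jordan_blockP hab.
have [<-|nij] := eqVneq i j.
  rewrite (_ : _ == _) ?mulr1n; last by apply/eqP/blkU; rewrite ?mem_jordan_blocks.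
  rewrite [(i : nat) == _]eqn_leq ltnn andbF addr0 -mxe_ord.
  exact: (jordan_block_diag hab).
rewrite mulr0n add0r.
have [Jij|] := eqVneq (J i j) 0.
  rewrite Jij; case: eqP => [eb|//]; case: eqP => [ej|//].
  have : (a <= j <= b)%N by have := blkI j; rewrite -eb.
  rewrite ej => abj; have : mxe J i i.+1 = 1 by apply: h; move: abi abj; lia.
  by rewrite -ej mxe_ord Jij.
rewrite -mxe_ord => Jij; have := hJ (ltn_ord i) (ltn_ord j) Jij.
case/orP => [/eqP/val_inj/eqP|/and3P[/eqP ej /eqP J1 _]]; first by rewrite (negbTE nij).
rewrite J1 ej eqxx (bj (a, b)) ?eqxx ?mem_jordan_blocks //=.
move/andP: abi => [ai ib]; rewrite ej leqW //= ltn_neqAle ib andbT.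
apply/eqP => eib; move: hb; rewrite -eib -ej J1 oner_eq0 orbF => /eqP e.
by have := ltn_ord j; rewrite e ltnn.
Qed.

Lemma card_itv_ord a b : (b < n)%N -> (a <= b)%N ->
  #|[set i : 'I_n | (a <= i <= b)%N]%SET| = (b - a).+1.
Proof.
move=> bn ab; rewrite -sum1_card -subSn // -[RHS]muln1 -sum_nat_const_nat.
rewrite (big_nat_widen _ _ n) // big_geq_mkord; apply: eq_bigl => i.
by rewrite inE /= ltnS andbC.
Qed.

Definition neg_eig (z : R[i]) : bool := (@complex.Im R z == 0) && (@complex.Re R z < 0).

(** The matching of blocks is carried to indices: [tau] keeps the offset inside the block and moves
    to the twin block, and [Od] collects the indices of the unmatched negative blocks, one block for
    each odd type. *)
Lemma jordan_pairing :
  exists (Od : {set 'I_n}) (tau : 'I_n -> 'I_n) (eps : 'I_n -> bool),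
    let Sup i := neg_eig (J i i) && (i \notin Od) in
    [/\ #|Od| = aindex_of_jordan J, forall i, i \in Od -> neg_eig (J i i),
        forall i, Sup i -> [/\ Sup (tau i), tau (tau i) = i & eps (tau i) = ~~ eps i] &
        [/\ forall i j, Sup i -> Sup j -> J (tau i) (tau j) = J i j,
        forall i j, Sup i -> ~~ Sup j -> J i j = 0 /\ J j i = 0 &
        forall i j, Sup i -> Sup j -> J i j != 0 -> eps i = eps j]].
Proof.
have [blk [blkJ blkI blkU]] := jordan_block_fun.
have JE := jordan_entry blkJ blkI blkU.
have [tb [eb [ O [uO Os tbP oddP]]]] := odd_pairing
  (fun p : nat * nat => (mxe J p.1 p.1, (p.2 - p.1).+1)) jordan_blocks_uniq.
rewrite -/(jordan_block_types J) in oddP.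
have Jii i : J i i = mxe J (blk i).1 (blk i).1.
  by rewrite JE !eqxx mulr1n [(i : nat) == _]eqn_leq ltnn andbF addr0.
pose Od := [set i : 'I_n | neg_eig (J i i) && (blk i \in O)]%SET.
(* The default value of [insubd] is never reached on matched blocks, because the twin block has the
   same length. *)
pose tau i := insubd i ((tb (blk i)).1 + (i - (blk i).1))%N.
exists Od, tau, (fun i => eb (blk i)) => Sup.
have SupE i : Sup i = neg_eig (J i i) && (blk i \notin O).
  by rewrite /Sup inE; case: neg_eig.
have tauP i : blk i \notin O ->
    [/\ blk (tau i) = tb (blk i), (tau i : nat) = ((tb (blk i)).1 + (i - (blk i).1))%N
      & tau (tau i) = i].
  move=> iO; have [h1 h2 h3 [h4 h5] h6] := tbP _ (blkJ i) iO.
  have := h1; case E : (tb (blk i)) => [a b]; rewrite mem_jordan_blocks.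
  move=> /jordan_blockP[ab bn _ _ _].
  have tE : (tau i : nat) = (a + (i - (blk i).1))%N.
    by rewrite /tau /insubd E insubT //=; have := blkI i; move: h5; rewrite E /=; lia.
  have bE : blk (tau i) = (a, b).
    apply/esym/blkU; first by rewrite -E.
    by rewrite tE /=; have := blkI i; move: h5; rewrite E /=; lia.
  split; rewrite ?E //; apply: val_inj; rewrite /= {1}/tau bE -E h3 E tE /= /insubd insubT /=.
    by have := blkI i; have := ltn_ord i; lia.
  by move=> ?; have := blkI i; lia.
have SupN i : Sup i -> blk i \notin O by rewrite SupE => /andP[].
split.
- rewrite /aindex_of_jordan big_mkcondl /=.
  set s := jordan_block_types J; rewrite -big_filter.
  (* Both lists are free of duplicates and contain the types of odd multiplicity. Summing block
     sizes over [O] then counts [Od] fibre by fibre along [blk]. *)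
  suff pe : perm_eq [seq x <- undup s | odd (count_mem x s)]
      [seq (mxe J p.1 p.1, (p.2 - p.1).+1) | p <- O].
    rewrite (perm_big _ pe) big_map /= -big_mkcond /=.
    rewrite big_seq_cond (eq_bigr (fun p => \sum_(i : 'I_n | blk i == p) 1)%N); last first.
      move=> p /andP[/Os pJ _]; rewrite sum1_card; have := pJ; case: p pJ => a b pJ.
      rewrite mem_jordan_blocks => /jordan_blockP[ab bn _ _ _].
      rewrite -card_itv_ord //; apply: eq_card => i.
      transitivity (blk i == (a, b)); last by [].
      rewrite inE; apply/idP/eqP; first by move=> /(blkU i _ pJ).
      by move=> e; have := blkI i; rewrite e.
    rewrite -big_seq_cond (exchange_big_dep xpredT) //= -sum1_card big_mkcond /=; apply: eq_bigr => i _.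
    rewrite inE Jii sum1_count; have uO' := map_uniq uO.
    rewrite (eq_count (a2 := fun p =>
      neg_eig (mxe J (blk i).1 (blk i).1) && (p == blk i))); last first.
      move=> p /=; rewrite [blk i == p]eq_sym.
      by have [->|] := eqVneq p (blk i); rewrite ?andbF.
    case: (neg_eig _) => /=; last by rewrite count_pred0.
    by rewrite (count_uniq_mem _ uO'); case: (_ \in _).
  apply: uniq_perm => //; first by rewrite filter_uniq ?undup_uniq.
  move=> x; rewrite mem_filter oddP mem_undup -/s.
  case: (boolP (odd _)) => //= ox; apply: contraT => /count_memPn e.
  by rewrite e in ox.
- by move=> i; rewrite inE => /andP[].
- move=> i Si; have iO := SupN _ Si; have [b1 b2 b3] := tauP _ iO.
  have [h1 h2 h3 [h4 h5] h6] := tbP _ (blkJ i) iO; split => //; last by rewrite b1.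
  by rewrite SupE b1 h2 Jii b1 h4 -Jii andbT; move: Si => /andP[].
split.
- move=> i j /SupN iO /SupN jO; have [b1 b2 b3] := tauP _ iO.
  have [c1 c2 c3] := tauP _ jO; rewrite [LHS]JE [RHS]JE b1 c1.
  have [h1 h2 h3 [h4 h5] h6] := tbP _ (blkJ i) iO.
  have [k1 k2 k3 _ _] := tbP _ (blkJ j) jO.
  have -> : (tb (blk i) == tb (blk j)) = (blk i == blk j).
    by apply/eqP/eqP => [e|-> //]; rewrite -h3 e k3.
  case: eqP => // e; rewrite h4; congr (_ *+ nat_of_bool _ + (nat_of_bool _)%:R).
    by apply/eqP/eqP => [e'|-> //]; rewrite -b3 e' c3.
  by rewrite b2 c2 e; have := blkI i; have := blkI j; rewrite e => *; apply/eqP/eqP; lia.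
- move=> i j Si Sj; suff nb : blk i != blk j.
    by rewrite [J i j]JE [J j i]JE (negbTE nb) [blk j == _]eq_sym (negbTE nb).
  by apply: contraNneq Sj => e; move: Si; rewrite !SupE !Jii e.
- by move=> i j _ _; rewrite JE; case: (blk i =P blk j) => [-> //|]; rewrite eqxx.
Qed.

End JordanBlocks.

Lemma rank_split_idem (K : fieldType) n k (X : 'M[K]_(n, k)) (Y : 'M[K]_(k, n)) :
  Y *m X = 1%:M -> \rank (X *m Y) = k.
Proof.
move=> YX; have rY : \rank Y = k.
  apply/eqP; rewrite eqn_leq rank_leq_row /= -[X in (X <= _)%N](mxrank1 K k) -YX.
  exact: mxrankM_maxl.
apply/eqP; rewrite eqn_leq (leq_trans (mxrankM_maxr _ _)) ?rY //=.
by rewrite -[X in (X <= _)%N]rY -[Y in (\rank Y <= _)%N]mul1mx -YX -mulmxA mxrankM_maxr.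
Qed.

Definition ind_mx (K : pzRingType) n (A : pred 'I_n) : 'M[K]_n :=
  diag_mx (\row_i (A i)%:R).

Lemma rank_ind_mx (K : fieldType) n (A : {set 'I_n}) :
  \rank (ind_mx K (fun i => i \in A)) = #|A|.
Proof.
pose E : 'M[K]_(#|A|, n) := \matrix_(k, j) (enum_val k == j)%:R.
have EE : E *m E^T = 1%:M.
  apply/matrixP => k l; rewrite !mxE (bigD1 (enum_val k)) //= big1 ?addr0.
    by rewrite !mxE eqxx mul1r (inj_eq enum_val_inj) eq_sym.
  by move=> i ni; rewrite !mxE eq_sym (negbTE ni) mul0r.
rewrite -(rank_split_idem EE); congr (\rank _); apply/matrixP => i j; rewrite !mxE.
have [iA|iA] := boolP (i \in A).
  rewrite (bigD1 (enum_rank_in iA i)) //= big1 ?addr0 => [|k nk].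
    by rewrite !mxE enum_rankK_in // eqxx mul1r.
  rewrite !mxE; case: eqP => [e|]; last by rewrite mul0r.
  by move: nk; rewrite -[k](enum_valK_in iA) e eqxx.
rewrite mul0rn big1 // => k _; rewrite !mxE; case: eqP => [e|]; last by rewrite mul0r.
by move: iA; rewrite -e enum_valP.
Qed.

(** * A real complex structure on the paired Jordan blocks *)

Section EvenPart.
Variables (R : realType) (n : nat) (M : 'M[R]_n) (P J : 'M[R[i]]_n).
Hypotheses (Pu : P \in unitmx) (hJ : is_jordan_mx J).
Local Notation toC := (real_complex R).
Local Notation "A ^%C" := (map_mx toC A) (at level 2, format "A ^%C").
Hypothesis MP : M^%C *m P = P *m J.

Definition neg_ind (z : R[i]) : R[i] := (neg_eig z)%:R.

Lemma neg_ind_sym : conj_sym neg_ind.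
Proof.
move=> [a b]; rewrite /neg_ind /neg_eig /= oppr_eq0.
by case: (_ && _); rewrite ?conjc1 ?conjc0.
Qed.

(* Pairing equal Jordan blocks yields a real complex structure [Th] on the paired
   part of the negative spectral subspace; [Po] projects onto the unpaired part. *)
Lemma even_part_structure (Pn := rcalc P J neg_ind) : exists Th Po : 'M[R]_n,
  [/\ comm_mx Th M, Th *m Th *m Th = - Th, Pn *m Th = Th /\ Th *m Pn = Th,
      Po = Pn + Th *m Th & [/\ Po *m Po = Po, Po *m Th = 0, Th *m Po = 0 &
      \rank Po = aindex_of_jordan J]].
Proof.
have sJ := is_jordan_shape hJ.
have [Od [tau [eps [cOd OdN tauP [Jtau J0 Jeps]]]]] := jordan_pairing hJ.
pose Sup i := neg_eig (J i i) && (i \notin Od).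
have {}tauP : forall i, Sup i -> [/\ Sup (tau i), tau (tau i) = i & eps (tau i) = ~~ eps i] := tauP.
have {}Jtau : forall i j, Sup i -> Sup j -> J (tau i) (tau j) = J i j := Jtau.
have {}J0 : forall i j, Sup i -> ~~ Sup j -> J i j = 0 /\ J j i = 0 := J0.
have {}Jeps : forall i j, Sup i -> Sup j -> J i j != 0 -> eps i = eps j := Jeps.
have SupN i : Sup i -> neg_eig (J i i) by move=> /andP[].
have PnE : Pn^%C = fcalc P J neg_ind by apply: (rcalcE Pu sJ MP neg_ind_sym).
pose Dn := diag_fun J neg_ind.
pose dn : 'M[R]_n := ind_mx R (fun i => neg_eig (J i i)).
have DnE : Dn = dn^%C.
  by apply/matrixP => i j; rewrite !mxE rmorphMn /= rmorph_nat.
(* After the cut-off all entries are real: negative numbers on the diagonal, 0 or 1 above it. Thus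
   [M *m Pn] and [Jr] are real and similar over the complex numbers, and [real_similar] provides a
   real change of basis [Q]. *)
pose J' := J *m Dn.
have J'E i j : J' i j = J i j * (neg_eig (J j j))%:R.
  by rewrite /J' /Dn /diag_fun mul_mx_diag !mxE.
have sJ' : jordan_shape J'.
  move=> i j; rewrite !J'E mulf_eq0 negb_or => /andP[/sJ[|[e Je]]]; first by left.
  by right; rewrite Je.
pose Jr : 'M[R]_n := \matrix_(i, j) (complex.Re (J i j) * (neg_eig (J j j))%:R).
have JrE : J' = Jr^%C.
  apply/matrixP => i j; rewrite J'E !mxE rmorphM /= rmorph_nat.
  case: (boolP (neg_eig (J j j))) => [nj|_]; rewrite ?mulr0 // !mulr1.
  have [->|Jij] := eqVneq (J i j) 0; first by [].
  have [e|ne] := eqVneq i j.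
    by move: nj; rewrite -e /neg_eig => /andP[]; case: (J i i) => a b /= /eqP ->.
  have := Jij; rewrite -mxe_ord => /(hJ (ltn_ord i) (ltn_ord j)).
  case/orP => [/eqP/val_inj/eqP|]; first by rewrite (negbTE ne).
  by rewrite !mxe_ord => /and3P[_ /eqP -> _].
pose M' := M *m Pn.
have M'P : M'^%C *m P = P *m J'.
  by rewrite /M' map_mxM /= PnE /fcalc /J' !mulmxA mulmxKV // MP.
clearbody J'.
have realC m p (A : 'M[R]_(m, p)) : A^%C \is a mxOver Num.real.
  by apply/mxOverP => i j; rewrite mxE complex_real.
have sim : exists2 P, P \in unitmx & similar P Jr^%C M'^%C.
  by exists P => //; apply/similarP; rewrite // -JrE M'P.
have [Q0] := real_similar sim (realC _ _ Jr) (realC _ _ M').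
rewrite inE => /andP[Q0r Q0u] /(similarP Q0u).
have [Q QE] : exists Q : 'M[R]_n, Q0 = Q^%C.
  exists (map_mx (@complex.Re R) Q0); apply/matrixP => i j; rewrite !mxE.
  by rewrite RRe_real //; apply: (mxOverP Q0r).
rewrite QE in Q0u *; rewrite -!map_mxM => /map_toC_inj QJ.
have Qu : Q \in unitmx by rewrite map_unitmx in Q0u.
(* Negative eigenvalues are nonzero, so [Dn] is the function [z != 0] of [J']. It therefore commutes
   with [invmx P *m Q], which commutes with [J']. *)
have PnQ : Pn *m Q = Q *m dn.
  apply: map_toC_inj; rewrite !map_mxM /= PnE -DnE.
  pose X := invmx P *m Q^%C.
  have PX : Q^%C = P *m X by rewrite /X mulKVmx.
  clearbody X.
  have JX : J' *m X = X *m J'.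
    apply: (can_inj (mulKmx Pu)); rewrite !mulmxA -M'P -PX -mulmxA -PX JrE -!map_mxM.
    by rewrite QJ.
  have DD : diag_fun J' (fun z => (z != 0)%:R) = Dn.
    congr diag_mx; apply/rowP => i; rewrite !mxE J'E mulf_eq0 negb_or /neg_ind.
    case: (boolP (neg_eig _)) => [/andP[_]|_]; rewrite ?eqxx ?andbF // oner_eq0 andbT.
    by case: eqP => // -> /=; rewrite ltxx.
  have := diag_fun_intertwine (fun z => (z != 0)%:R) sJ' sJ' JX.
  rewrite DD => DX; rewrite PX -(mulmxA P) -DX /fcalc !mulmxA.
  by rewrite mulmxKV.
(* Opposite signs on the two members of a pair turn the swap of twin blocks into a quarter-turn,
   with square minus the identity. *)
pose e i : R := if eps i then 1 else -1.
have ee i : Sup i -> e (tau i) * e i = -1.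
  by move=> /tauP[_ _]; rewrite /e => ->; case: (eps i); rewrite /= ?mulr1 ?mul1r.
pose tJ : 'M[R]_n := \matrix_(j, i) (if Sup i && (j == tau i) then e i else 0).
have tJl (A : 'M[R]_n) j i : (A *m tJ) j i = if Sup i then A j (tau i) * e i else 0.
  rewrite mxE (bigD1 (tau i)) //= big1 => [|k /negbTE nk]; rewrite mxE ?nk ?andbF ?mulr0 //.
  by rewrite eqxx andbT addr0; case: (Sup i); rewrite ?mulr0.
have tJr (A : 'M[R]_n) j i : (tJ *m A) j i = if Sup j then e (tau j) * A (tau j) i else 0.
  rewrite mxE; have [Sj|Sj] := boolP (Sup j); last first.
    rewrite big1 // => k _; rewrite mxE; case: ifP => [/andP[Sk /eqP ej]|]; last by rewrite mul0r.
    by move: Sj; rewrite ej; have [-> _ _] := tauP _ Sk.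
  have [St tt _] := tauP _ Sj.
  rewrite (bigD1 (tau j)) //= big1 => [|k nk]; rewrite mxE.
    by rewrite St tt eqxx addr0.
  case: ifP => [/andP[Sk /eqP ej]|]; last by rewrite mul0r.
  by move: nk; rewrite ej; have [_ -> _] := tauP _ Sk; rewrite eqxx.
have tJJ : tJ *m Jr = Jr *m tJ.
  apply/matrixP => j i; rewrite tJl tJr !mxE.
  have [Si|Si] := boolP (Sup i); have [Sj|Sj] := boolP (Sup j) => //.
  - have [Sti tti _] := tauP _ Si; have [Stj ttj _] := tauP _ Sj.
    rewrite (SupN _ Si) (SupN _ Sti) !mulr1 mulrC.
    have -> : J j (tau i) = J (tau j) i by rewrite -{1}ttj Jtau.
    have [->|nz] := eqVneq (J (tau j) i) 0; first by rewrite /= !mul0r.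
    by rewrite /e (Jeps _ _ Stj Si nz).
  - have [Sti _ _] := tauP _ Si.
    by have [_ ->] := J0 _ _ Sti Sj; rewrite /= !mul0r.
  - have [Stj _ _] := tauP _ Sj.
    by have [-> _] := J0 _ _ Stj Si; rewrite /= mul0r mulr0.
have tJ2 : tJ *m tJ = - ind_mx R Sup.
  apply/matrixP => j i; rewrite tJl !mxE; have [Si|Si] := boolP (Sup i); last first.
    by case: eqP => [->|]; rewrite ?(negbTE Si) ?mul0rn ?mulr0n ?oppr0.
  have [Sti tti _] := tauP _ Si; rewrite Sti tti /=.
  case: (eqVneq j i) => [->|_]; first by rewrite ee // Si mulr1n.
  by rewrite mul0r mulr0n oppr0.
have dtJ : dn *m tJ = tJ.
  apply/matrixP => j i; rewrite /dn /ind_mx mul_diag_mx !mxE.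
  case: ifP => [/andP[Si /eqP ->]|]; last by rewrite mulr0.
  by have [Sti _ _] := tauP _ Si; rewrite (SupN _ Sti) mul1r.
have tJd : tJ *m dn = tJ.
  apply/matrixP => j i; rewrite /dn /ind_mx mul_mx_diag !mxE.
  by case: ifP => [/andP[Si _]|]; rewrite ?mul0r // (SupN _ Si) mulr1.
have dS : dn - ind_mx R Sup = ind_mx R (fun i => i \in Od).
  apply/matrixP => i j; rewrite !mxE -mulrnBl; congr (_ *+ _); rewrite /Sup.
  case: (boolP (i \in Od)) => [/OdN -> | _] /=; first by rewrite subr0.
  by rewrite andbT subrr.
have idem (A B : pred 'I_n) : ind_mx R A *m ind_mx R B = ind_mx R (fun i => A i && B i).
  rewrite /ind_mx mulmx_diag; congr diag_mx; apply/rowP => i; rewrite !mxE.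
  by case: (A i); rewrite ?mul1r ?mul0r.
pose Th := Q *m tJ *m invmx Q.
have ThTh : Th *m Th = - (Q *m ind_mx R Sup *m invmx Q).
  by rewrite /Th !mulmxA mulmxKV // -(mulmxA Q) tJ2 mulmxN mulNmx.
have PnTh : Pn *m Th = Th by rewrite /Th !mulmxA PnQ -(mulmxA Q dn) dtJ.
have PnI : Pn = Q *m dn *m invmx Q by rewrite -PnQ mulmxK.
have ThPn : Th *m Pn = Th by rewrite PnI /Th !mulmxA mulmxKV // -(mulmxA Q tJ) tJd.
have PoE : Pn + Th *m Th = Q *m ind_mx R (fun i => i \in Od) *m invmx Q.
  by rewrite ThTh PnI -mulmxBl -mulmxBr dS.
have ThM' : Th *m M' = M' *m Th.
  have -> : M' = Q *m Jr *m invmx Q by rewrite QJ mulmxK.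
  by rewrite /Th !mulmxA !mulmxKV // -!(mulmxA Q) tJJ.
have PnM : Pn *m M = M *m Pn.
  apply: map_toC_inj; rewrite !map_mxM /= PnE.
  by apply/esym/(fcalc_comm Pu sJ MP).
have St j : Sup j -> j \notin Od by move=> /andP[].
have Odt : ind_mx R (fun i => i \in Od) *m tJ = 0.
  apply/matrixP => j i; rewrite /ind_mx mul_diag_mx !mxE.
  case: ifP => [/andP[Si /eqP ->]|]; last by rewrite mulr0.
  by have [/St/negbTE -> _ _] := tauP _ Si; rewrite mul0r.
have tOd : tJ *m ind_mx R (fun i => i \in Od) = 0.
  apply/matrixP => j i; rewrite /ind_mx mul_mx_diag !mxE.
  by case: ifP => [/andP[/St/negbTE -> _]|]; rewrite ?mulr0 ?mul0r.
exists Th, (Pn + Th *m Th); split => //.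
(* [Th] lives on the range of [Pn], so commuting with [M *m Pn] is enough. *)
- by rewrite /comm_mx -{1}ThPn -mulmxA PnM ThM' /M' -mulmxA PnTh.
- rewrite ThTh mulNmx /Th !mulmxA mulmxKV // -(mulmxA Q (ind_mx _ _)).
  congr (- (_ *m _ *m _)); apply/matrixP => j i; rewrite /ind_mx mul_diag_mx !mxE.
  case: ifP => [/andP[Si /eqP ->]|]; last by rewrite mulr0.
  by have [-> _ _] := tauP _ Si; rewrite mul1r.
- split => //; rewrite PoE.
  + by rewrite !mulmxA mulmxKV // -(mulmxA Q) idem; congr (_ *m ind_mx R _ *m _); apply/funext => i; rewrite andbb.
  + by rewrite /Th !mulmxA mulmxKV // -(mulmxA Q) Odt mulmx0 mul0mx.
  + by rewrite /Th !mulmxA mulmxKV // -(mulmxA Q) tOd mulmx0 mul0mx.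
  + rewrite -cOd -(rank_ind_mx R) mxrankMfree ?row_free_unit ?unitmx_inv // -mxrank_tr trmx_mul.
    by rewrite mxrankMfree ?mxrank_tr // row_free_unit unitmx_tr.
Qed.

End EvenPart.

(** * Real Floquet logarithm *)

Section ExpLog.
Variable F : numFieldType.

(** Taylor polynomial of log (1 + X). The factor ['X] stays visible because the logarithm of [1 + N]
    must be a multiple of [N]. *)
Definition logp m : {poly F} := 'X * \poly_(i < m) ((-1) ^+ i / i.+1%:R).
Definition expp m : {poly F} := \poly_(i < m.+1) (i`!%:R)^-1.

Lemma deriv_expp m : deriv (expp m) = expp m - (m`!%:R)^-1 *: 'X^m.
Proof.
apply/polyP => i; rewrite coef_deriv coefB coefZ coefXn !coef_poly ltnS.
have [->|nim] := eqVneq i m; first by rewrite ltnn leqnn mul0rn mulr1 subrr.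
rewrite mulr0 subr0 (ltnS i m) (leq_eqVlt i m) (negbTE nim) /=; case: ltnP => [_|]; last by rewrite mul0rn.
by rewrite factS natrM invfM -[LHS]mulr_natl mulrA mulfV ?mul1r // pnatr_eq0.
Qed.

Lemma deriv_logp m : (1 + 'X) * deriv (logp m) = 1 - (-1) ^+ m *: 'X^m.
Proof.
have -> : deriv (logp m) = \poly_(i < m) (-1) ^+ i.
  apply/polyP => i; rewrite coef_deriv coefXM /= !coef_poly.
  case: ltnP => _; last by rewrite mul0rn.
  by rewrite -[LHS]mulr_natr -mulrA mulVf ?mulr1 // pnatr_eq0.
apply/polyP => i; rewrite mulrDl mul1r coefD coefXM coefB coefZ coefXn coef1 !coef_poly.
case: i => [|i] /=.
  by case: (m) => [|k]; rewrite ?eqxx ?expr0 ?mulr1 ?subrr ?addr0 //= mulr0 subr0.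
rewrite sub0r; case: (ltngtP i.+1 m) => [h|h|h].
- by rewrite exprS mulN1r addNr mulr0 oppr0.
- by rewrite addr0 mulr0 oppr0.
- by rewrite -h add0r mulr1 exprS mulN1r opprK.
Qed.

(** The composite [h] satisfies (1 + X) h' = h modulo X^m, with constant term 1. On coefficients
    this reads (i + 1) h_(i+1) = (1 - i) h_i, which forces 1 + X up to degree [m]. *)
Lemma coef_exp_log m k : (k <= m)%N ->
  (expp m \Po logp m)`_k = (1 + 'X : {poly F})`_k.
Proof.
set h := expp m \Po logp m; set c := (m`!%:R : F)^-1; pose q : {poly F} := \poly_(i < m) ((-1) ^+ i / i.+1%:R).
have hE : (1 + 'X) * deriv h = h + 'X^m * (- (c *: q ^+ m) - (-1) ^+ m *: h
      + (-1) ^+ m *: (c *: q ^+ m) * 'X^m).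
  rewrite /h deriv_comp mulrCA deriv_logp deriv_expp -/h comp_polyB comp_polyZ.
  rewrite comp_Xn_poly -/h {1}/logp -/q exprMn -!mul_polyC; ring.
have h0 : h`_0 = 1.
  have l0 : (logp m).[0] = 0 by rewrite /logp hornerM hornerX mul0r.
  by rewrite /h -horner_coef0 horner_comp l0 horner_coef0 coef_poly /= fact0 invr1.
have rec i : (i < m)%N -> h`_i.+1 *+ i.+1 = h`_i - h`_i *+ i.
  move=> im; have := congr1 (fun p : {poly F} => p`_i) hE.
  rewrite mulrDl mul1r !coefD coefXM coefXnM im addr0 coef_deriv coef_deriv.
  case: i im => [|i] im /=; first by rewrite addr0 => ->; rewrite mulr0n subr0.
  by move=> e; rewrite -[X in _ = X - _]e addrK.
rewrite coefD coef1 coefX; case: k => [_|]; first by rewrite h0 addr0.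
elim=> [m0|k IHk km].
  by have := rec 0%N m0; rewrite mulr1n mulr0n subr0 h0 => ->; rewrite /= add0r.
have := rec _ km; rewrite (IHk (ltnW km)) /= !add0r.
case: k {IHk km} => [|k] /=; rewrite ?mulr1n ?subrr ?mul0rn ?subr0 => /eqP;
  rewrite mulrn_eq0 /= => /eqP -> //.
Qed.

Lemma horner_mx_nil n (N : 'M[F]_n.+1) m (p : {poly F}) : N ^+ m.+1 = 0 ->
  (forall k, (k <= m)%N -> p`_k = 0) -> horner_mx N p = 0.
Proof.
move=> Nm p0; rewrite -[p]coefK poly_def rmorph_sum /= big1 // => i _.
rewrite linearZ /= rmorphXn /= horner_mx_X; have [im|im] := leqP i m.
  by rewrite p0 // scale0r.
by rewrite -(subnKC im) exprD Nm mul0r scaler0.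
Qed.

Lemma horner_mx_comp n (N : 'M[F]_n.+1) p q :
  horner_mx N (p \Po q) = horner_mx (horner_mx N q) p.
Proof.
elim/poly_ind: p => [|p c IHp]; first by rewrite comp_poly0 !rmorph0.
by rewrite comp_poly_MXaddC !rmorphD !rmorphM /= IHp !horner_mx_X !horner_mx_C.
Qed.

Definition exp_nil n (W : 'M[F]_n.+1) (s : F) : 'M[F]_n.+1 :=
  \sum_(k < n.+1) (s ^+ k / k`!%:R) *: W ^+ k.

Lemma exp_nilE n (W : 'M[F]_n.+1) s : exp_nil W s = horner_mx (s *: W) (expp n).
Proof.
rewrite /expp poly_def rmorph_sum /=; apply: eq_bigr => k _.
by rewrite linearZ /= rmorphXn /= horner_mx_X exprZn scalerA mulrC.
Qed.

(** [W] is the finite logarithm series divided by [T]. The factorization through [N] makes [W]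
    vanish on the kernel of [N] and have zero diagonal where [N] is triangular; [G] being a
    polynomial in [N] preserves commutation. *)
Lemma nilpotent_log n (N : 'M[F]_n.+1) (T : F) : T != 0 -> N ^+ n.+1 = 0 ->
  exists W G : 'M[F]_n.+1, [/\ exp_nil W T = 1 + N, W ^+ n.+1 = 0,
    W = G *m N & exists p, G = horner_mx N p].
Proof.
move=> T0 Nn; pose q : {poly F} := \poly_(i < n) ((-1) ^+ i / i.+1%:R).
pose G := T^-1 *: horner_mx N q.
have GN : G *m N = N *m G.
  by rewrite -scalemxAl -scalemxAr -(comm_mx_horner q (erefl : comm_mx N N)).
exists (G *m N), G; split => //; last by exists (T^-1 *: q); rewrite linearZ.
  have TG : T *: (G *m N) = horner_mx N q *m N.
    by rewrite /G -scalemxAl scalerA mulfV // scale1r.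
  rewrite exp_nilE TG.
  have -> : horner_mx N q *m N = horner_mx N (logp n).
    by rewrite rmorphM /= horner_mx_X -(comm_mx_horner q (erefl : comm_mx N N)).
  rewrite -horner_mx_comp; apply/eqP; rewrite -subr_eq0.
  have -> : 1 + N = horner_mx N (1 + 'X) by rewrite rmorphD rmorph1 /= horner_mx_X.
  rewrite -rmorphB /=; apply/eqP/(horner_mx_nil Nn) => k kn.
  by rewrite coefB coef_exp_log // subrr.
by rewrite -[_ *m _]/(G * N) exprMn_comm // Nn mulr0.
Qed.

Lemma exp_nil0 n (W : 'M[F]_n.+1) : exp_nil W 0 = 1.
Proof.
rewrite /exp_nil big_ord_recl big1 => [|i _]; last first.
  by rewrite /= /bump /= add1n exprS !mul0r scale0r.
by rewrite expr0 expr0 divr1 scale1r addr0.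
Qed.

End ExpLog.

Section MatrixDerive.
Variable R : realType.

Lemma is_derive_mxP m n (F : R -> 'M[R]_(m, n)) (A : 'M[R]_(m, n)) (t : R) :
  is_derive t 1 F A <-> forall i j, is_derive t 1 (fun s => F s i j) (A i j).
Proof.
split=> [[dF eF] i j|h].
  split; first by have /derivable_mxP := dF.
  by rewrite -eF derive_mx // mxE.
have dF : derivable F t 1 by apply/derivable_mxP => i j; have [] := h i j.
split => //; rewrite derive_mx //; apply/matrixP => i j; rewrite mxE.
by have [_ ->] := h i j.
Qed.

Lemma is_derive_mulmx m n p (F : R -> 'M[R]_(m, n)) (G : R -> 'M[R]_(n, p)) A B (t : R) :
  is_derive t 1 F A -> is_derive t 1 G B ->
  is_derive t 1 (fun s => F s *m G s) (A *m G t + F t *m B).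
Proof.
move=> /is_derive_mxP hF /is_derive_mxP hG; apply/is_derive_mxP => i j.
have -> : (fun s => (F s *m G s) i j) = \sum_k (fun s => F s i k * G s k j).
  by apply/funext => s; rewrite mxE fct_sumE.
rewrite !mxE -big_split /=; apply: is_derive_sum => k.
by apply: (is_derive_eq (is_deriveM (hF i k) (hG k j))); rewrite /GRing.scale /=; ring.
Qed.

Lemma is_derive_cstmx m n (A : 'M[R]_(m, n)) (t : R) : is_derive t 1 (fun=> A) (0 : 'M[R]_(m, n)).
Proof. exact: is_derive_cst. Qed.

Lemma is_derive_scale_mx m n (f : R -> R) df (A : 'M[R]_(m, n)) (t : R) :
  is_derive t 1 f df -> is_derive t 1 (fun s => f s *: A) (df *: A).
Proof.
move=> hf; apply/is_derive_mxP => i j; rewrite mxE.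
have -> : (fun s => (f s *: A) i j) = A i j *: f.
  by apply/funext => s; rewrite mxE mulrC.
by apply: (is_derive_eq (is_deriveZ _ hf)); rewrite mulrC.
Qed.

Lemma is_derive_exp_nil n (W : 'M[R]_n.+1) (t : R) : W ^+ n.+1 = 0 ->
  is_derive t 1 (exp_nil W) (W *m exp_nil W t).
Proof.
move=> Wn; have WS k : W *m W ^+ k = W ^+ k.+1 by rewrite exprS.
have -> : W *m exp_nil W t = \sum_(k < n.+1) (k%:R * t ^+ k.-1 / k`!%:R) *: W ^+ k.
  rewrite big_ord_recl /= !mul0r scale0r add0r /exp_nil mulmx_sumr big_ord_recr /=.
  rewrite -scalemxAr WS Wn scaler0 addr0; apply: eq_bigr => k _.
  rewrite -scalemxAr WS /= /bump /= add1n; congr (_ *: _).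
  rewrite factS natrM invfM mulrCA !mulrA; congr (_ * _).
  by rewrite mulVf ?mul1r ?pnatr_eq0.
have -> : exp_nil W = \sum_(k < n.+1) (fun s => (s ^+ k / k`!%:R) *: W ^+ k).
  by apply/funext => s; rewrite fct_sumE.
apply: is_derive_sum => k; apply: is_derive_scale_mx.
have -> : (fun s : R => s ^+ k / k`!%:R) = (k`!%:R)^-1 *: (fun s => s ^+ k).
  by apply/funext => s; rewrite mulrC.
apply: (is_derive_eq (is_deriveZ _ (_ : is_derive t 1 _ (k%:R * t ^+ k.-1)))).
  have := is_deriveX k (is_derive_id t 1); rewrite /GRing.scale /= mulr1 mulr_natl.
  by congr (is_derive _ _ _ _); apply/funext => s; rewrite fctE.
by rewrite /GRing.scale /= mulrC.
Qed.

End MatrixDerive.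

(** * Branches of the logarithm and of its flow on eigenvalues *)

Section Polar.
Variable R : realType.
Implicit Types z : R[i].

Definition modc z : R := complex.Re `|z|.
(* Zero, not [pi], on the negative reals: their sign is carried by [Po] and [Th]. *)
Definition argc z : R := Num.sg (complex.Im z) * acos (complex.Re z / modc z).

Lemma modcE z : modc z = Num.sqrt (complex.Re z ^+ 2 + complex.Im z ^+ 2).
Proof. by rewrite /modc normc_def. Qed.

Lemma modc_gt0 z : z != 0 -> 0 < modc z.
Proof.
case: z => a b; rewrite eq_complex /= negb_and modcE /= sqrtr_gt0 => /orP[] h.
  by rewrite ltr_pwDl ?sqr_ge0 // exprn_even_gt0.
by rewrite ltr_wpDl ?sqr_ge0 // exprn_even_gt0.
Qed.

Lemma sqr_modc z : modc z ^+ 2 = complex.Re z ^+ 2 + complex.Im z ^+ 2.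
Proof. by rewrite modcE sqr_sqrtr // addr_ge0 ?sqr_ge0. Qed.

Lemma neg_eig_polar z : neg_eig z -> modc z = - complex.Re z /\ argc z = 0.
Proof.
case: z => a b; rewrite /neg_eig /argc modcE /= => /andP[/eqP -> a0].
by rewrite expr0n /= addr0 sqrtr_sqr ltr0_norm // sgr0 mul0r.
Qed.

Lemma polarE z : z != 0 -> ~~ neg_eig z ->
  modc z * cos (argc z) = complex.Re z /\ modc z * sin (argc z) = complex.Im z.
Proof.
move=> z0 nz; have m0 := modc_gt0 z0; have m2 := sqr_modc z.
move: nz z0 m0 m2; case: z => a b; rewrite /neg_eig /argc /=; set m := modc _.
have [-> /= nz z0 m0 m2|b0 _ z0 m0 m2] := eqVneq b 0.
  rewrite sgr0 mul0r cos0 sin0 mulr1 mulr0; split => //.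
  have a0 : 0 <= a by rewrite leNgt.
  by have /eqP := m2; rewrite expr0n addr0 eqf_sqr => /orP[/eqP //|/eqP]; lra.
have le1 : -1 <= a / m <= 1.
  rewrite ler_pdivlMr // ler_pdivrMr // mulN1r mul1r -ler_norml.
  rewrite -(ger0_norm (ltW m0)) -ler_sqr ?nnegrE // !real_normK ?num_real // m2.
  by rewrite lerDl sqr_ge0.
have cosE : cos (Num.sg b * acos (a / m)) = a / m.
  have [h|h|h] := sgrP b; rewrite ?mul1r ?mulN1r ?cosN ?acosK ?in_itv //=.
  by rewrite h eqxx in b0.
have sq : m * Num.sqrt (1 - (a / m) ^+ 2) = `|b|.
  rewrite -{1}(gtr0_norm m0) -sqrtr_sqr -sqrtrM ?sqr_ge0 // -sqrtr_sqr; congr Num.sqrt.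
  rewrite mulrBr mulr1 exprMn exprVn mulrCA mulfV ?mulr1 ?expf_neq0 ?gt_eqF // m2.
  by rewrite addrAC subrr add0r.
split; first by rewrite cosE mulrC divfK // gt_eqF.
have [h|h|h] := sgrP b.
- by rewrite h eqxx in b0.
- by rewrite mul1r sin_acos // sq gtr0_norm.
- by rewrite mulN1r sinN sin_acos // mulrN sq ltr0_norm // opprK.
Qed.

Variable T : R.
Hypothesis T0 : 0 < T.

Definition log_eig z : R[i] := Complex (ln (modc z) / T) (argc z / T).
(** This is exp (s * log_eig z) split into real and imaginary parts, so that it can be
    differentiated with real functions only. *)
Definition flow_eig s z : R[i] :=
  Complex (expR (s * (ln (modc z) / T)) * cos (s * (argc z / T)))
          (expR (s * (ln (modc z) / T)) * sin (s * (argc z / T))).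

Lemma modc_conj z : modc (conjc z) = modc z.
Proof. by case: z => a b; rewrite !modcE /= sqrrN. Qed.

Lemma argc_conj z : argc (conjc z) = - argc z.
Proof. by rewrite /argc modc_conj; case: z => a b /=; rewrite sgrN mulNr. Qed.

Lemma log_eig_sym : conj_sym log_eig.
Proof. by move=> z; rewrite /log_eig modc_conj argc_conj mulNr. Qed.

Lemma flow_eig_sym s : conj_sym (flow_eig s).
Proof. by move=> z; rewrite /flow_eig modc_conj argc_conj mulNr mulrN cosN sinN mulrN. Qed.

Lemma flow_eig0 z : flow_eig 0 z = 1.
Proof. by rewrite /flow_eig !mul0r expR0 cos0 sin0 mulr1 mulr0. Qed.

(** On a negative eigenvalue the argument is 0 and the flow ends at |z| = - z. The factor on the
    right records this wrong sign, to be repaired by [Th] on the paired blocks. *)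
Lemma flow_eigT z : z != 0 -> flow_eig T z = z * (1 - 2 * neg_ind z).
Proof.
move=> z0; have m0 := modc_gt0 z0; rewrite /flow_eig.
rewrite !(mulrC T) !divfK ?gt_eqF // lnK ?posrE //.
rewrite /neg_ind; case: (boolP (neg_eig z)) => nz.
  have [-> ->] := neg_eig_polar nz; rewrite cos0 sin0 mulr1 mulr0 mulr1.
  have -> : 1 - 2 = -1 :> R[i] by ring.
  by case: (z) nz => a b /andP[/= /eqP -> _]; rewrite mulrN1; apply/eqP; rewrite eq_complex /= oppr0 !eqxx.
have [-> ->] := polarE z0 nz; rewrite mulr0 subr0 mulr1.
by case: (z).
Qed.

Lemma log_eig1 : log_eig 1 = 0.
Proof.
rewrite /log_eig /argc /= sgr0 !mul0r modcE /= expr1n expr0n addr0 sqrtr1 ln1 mul0r.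
by [].
Qed.

Lemma is_derive_comp_lin (f : R -> R) df (a s : R) :
  is_derive (s * a) 1 f df -> is_derive s 1 (fun t => f (t * a)) (a * df).
Proof.
move=> hf; have hl : is_derive s 1 (fun t : R => t * a) a.
  have -> : (fun t : R => t * a) = a *: id by apply/funext => t; rewrite mulrC.
  by apply: (is_derive_eq (is_deriveZ _ (is_derive_id s 1))); rewrite /GRing.scale /= mulr1.
have := @is_derive1_comp R f (fun t : R => t * a) s _ _ hf hl.
by rewrite [X in is_derive _ _ _ X]mulrC.
Qed.

Lemma is_derive_flow_Re (s : R) z :
  is_derive s 1 (fun t => complex.Re (flow_eig t z)) (complex.Re (log_eig z * flow_eig s z)).
Proof.
have h1 := is_derive_comp_lin (is_derive_expR (s * (ln (modc z) / T))).
have h2 := is_derive_comp_lin (is_derive_cos (s * (argc z / T))).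
by apply: (is_derive_eq (is_deriveM h1 h2)); rewrite /GRing.scale /=; ring.
Qed.

Lemma is_derive_flow_Im (s : R) z :
  is_derive s 1 (fun t => complex.Im (flow_eig t z)) (complex.Im (log_eig z * flow_eig s z)).
Proof.
have h1 := is_derive_comp_lin (is_derive_expR (s * (ln (modc z) / T))).
have h2 := is_derive_comp_lin (is_derive_sin (s * (argc z / T))).
by apply: (is_derive_eq (is_deriveM h1 h2)); rewrite /GRing.scale /=; ring.
Qed.

Lemma rcalc_entry n (P J : 'M[R[i]]_n) F i j : rcalc P J F i j =
  \sum_k (complex.Re (P i k * invmx P k j) * complex.Re (F (J k k))
        - complex.Im (P i k * invmx P k j) * complex.Im (F (J k k))).
Proof.
have ReD (x y : R[i]) : complex.Re (x + y) = complex.Re x + complex.Re y.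
  by case: x; case: y.
rewrite /rcalc /fcalc /diag_fun mxE mul_mx_diag mxE.
rewrite (big_morph (@complex.Re R) ReD (erefl : complex.Re 0 = 0)).
apply: eq_bigr => k _; rewrite !mxE mulrAC.
by case: (P i k * invmx P k j) => a b; case: (F _).
Qed.

Lemma is_derive_rcalc_flow n (P J : 'M[R[i]]_n) (s : R) :
  is_derive s 1 (fun t => rcalc P J (flow_eig t))
    (rcalc P J (fun z => log_eig z * flow_eig s z)).
Proof.
apply/is_derive_mxP => i j; rewrite rcalc_entry.
have -> : (fun t => rcalc P J (flow_eig t) i j) = \sum_k
   (complex.Re (P i k * invmx P k j) *: (fun t => complex.Re (flow_eig t (J k k)))
    - complex.Im (P i k * invmx P k j) *: (fun t => complex.Im (flow_eig t (J k k)))).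
  by apply/funext => t; rewrite rcalc_entry fct_sumE.
apply: is_derive_sum => k; apply: is_deriveB; apply: is_deriveZ.
  exact: is_derive_flow_Re.
exact: is_derive_flow_Im.
Qed.

End Polar.

(** * Interpolation, triangular matrices and characteristic polynomials *)

Section Spectrum.

(** Serves to write the logarithm of the semisimple part as a polynomial in it, so that any basis
    making one triangular does the same for the other. *)
Lemma interpolation (K : fieldType) (s : seq K) (F : K -> K) :
  exists p : {poly K}, forall x, x \in s -> p.[x] = F x.
Proof.
elim: s => [|x s [p hp]]; first by exists 0.
have [xs|xs] := boolP (x \in s).
  by exists p => y; rewrite inE => /predU1P[->|]; [apply: hp|apply: hp].
pose w := \prod_(y <- s) ('X - y%:P).
have w0 : w.[x] != 0 by rewrite -/(root w x) root_prod_XsubC.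
exists (p + ((F x - p.[x]) / w.[x]) *: w) => y; rewrite inE hornerD hornerZ.
have [->|nyx /= ys] := eqVneq y x; first by rewrite divfK // addrCA subrr addr0.
have /eqP -> : w.[y] == 0 by rewrite -/(root w y) root_prod_XsubC.
by rewrite mulr0 addr0 hp.
Qed.

Variable K : fieldType.

Lemma trig_mul n (A B : 'M[K]_n) : is_trig_mx A -> is_trig_mx B ->
  is_trig_mx (A *m B) /\ forall i, (A *m B) i i = A i i * B i i.
Proof.
move=> /is_trig_mxP hA /is_trig_mxP hB; split => [|i].
  apply/is_trig_mxP => i j ij; rewrite mxE big1 // => k _.
  have [ik|ki] := ltnP i k; first by rewrite hA ?mul0r.
  by rewrite hB ?mulr0 // (leq_ltn_trans ki).
rewrite mxE (bigD1 i) //= big1 ?addr0 // => k nki.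
have [ik|ki|/val_inj e] := ltngtP i k; first by rewrite hA ?mul0r.
  by rewrite hB ?mulr0.
by rewrite e eqxx in nki.
Qed.

Lemma trig_add n (A B : 'M[K]_n) : is_trig_mx A -> is_trig_mx B -> is_trig_mx (A + B).
Proof.
move=> /is_trig_mxP hA /is_trig_mxP hB; apply/is_trig_mxP => i j ij.
by rewrite mxE hA ?hB ?addr0.
Qed.

Lemma trig_scale n c (A : 'M[K]_n) : is_trig_mx A -> is_trig_mx (c *: A).
Proof. by move=> /is_trig_mxP hA; apply/is_trig_mxP => i j ij; rewrite mxE hA ?mulr0. Qed.

Lemma trig_horner n (A : 'M[K]_n.+1) p : is_trig_mx A ->
  is_trig_mx (horner_mx A p) /\ forall i, (horner_mx A p) i i = p.[A i i].
Proof.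
move=> hA; elim/poly_ind: p => [|p c [IH1 IH2]].
  by rewrite rmorph0; split => [|i]; rewrite ?mx0_is_trig // mxE horner0.
rewrite rmorphD rmorphM /= horner_mx_X horner_mx_C.
have [h1 h2] := trig_mul IH1 hA; split => [|i].
  by apply: trig_add => //; apply: scalar_mx_is_trig.
by rewrite hornerMXaddC mxE [X in _ + X]mxE eqxx mulr1n -IH2 -h2.
Qed.

Lemma char_poly_conj n (V A : 'M[K]_n) : V \in unitmx ->
  char_poly (V *m A *m invmx V) = char_poly A.
Proof.
move=> Vu; rewrite /char_poly.
have -> : char_poly_mx (V *m A *m invmx V) =
    map_mx polyC V *m char_poly_mx A *m map_mx polyC (invmx V).
  rewrite /char_poly_mx mulmxBr mulmxBl !map_mxM; congr (_ - _).
  by rewrite mul_mx_scalar -scalemxAl -map_mxM mulmxV // map_mx1 scalemx1.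
rewrite !det_mulmx mulrAC -det_mulmx -map_mxM mulmxV // map_mx1 det1 mul1r.
by [].
Qed.

End Spectrum.

(** * The real Floquet exponent of the monodromy matrix *)

Section RealFloquet.
Variables (R : realType) (n : nat) (M : 'M[R]_n.+1) (T : R).
Hypotheses (T0 : 0 < T) (Mu : M \in unitmx).
Variables (P J : 'M[R[i]]_n.+1).
Hypotheses (Pu : P \in unitmx) (hJ : is_jordan_mx J).
Local Notation toC := (real_complex R).
Local Notation "A ^%C" := (map_mx toC A) (at level 2, format "A ^%C").
Hypothesis MP : M^%C *m P = P *m J.
Let sJ : jordan_shape J := is_jordan_shape hJ.
Let rc := rcalc P J.

Lemma comm_mxZ (K : comPzRingType) m (c : K) (X Y : 'M[K]_m) :
  comm_mx X Y -> comm_mx X (c *: Y).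
Proof. by rewrite /comm_mx => XY; rewrite -scalemxAr XY scalemxAl. Qed.

Lemma rcE F : conj_sym F -> (rc F)^%C = fcalc P J F.
Proof. exact: (rcalcE Pu sJ MP). Qed.

Lemma rcM F G : conj_sym F -> conj_sym G -> rc F *m rc G = rc (fun z => F z * G z).
Proof.
move=> hF hG; apply: map_toC_inj; rewrite map_mxM /= !rcE ?fcalcM // => z.
by rewrite hF hG rmorphM.
Qed.

Lemma rc_cst (c : R) F : (forall i, F (J i i) = toC c) -> rc F = c%:M.
Proof.
move=> hF; have -> : rc F = rc (fun=> toC c).
  by rewrite /rc /rcalc (@eq_fcalc _ _ P J F (fun=> toC c)).
apply: map_toC_inj; rewrite rcE ?fcalc_cst ?map_scalar_mx // => z.
by rewrite conjc_real.
Qed.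

Lemma rc_comm X F : conj_sym F -> comm_mx X M -> comm_mx X (rc F).
Proof.
move=> hF XM; apply: map_toC_inj; rewrite !map_mxM /= rcE //.
by apply: (fcalc_comm Pu sJ MP); rewrite /comm_mx -!map_mxM XM.
Qed.

Lemma rc_commM F : conj_sym F -> comm_mx M (rc F).
Proof. by move=> hF; apply: rc_comm. Qed.

Lemma rc_fix F (c : R) (v : 'cV[R]_n.+1) : conj_sym F -> F 1 = toC c ->
  M *m v = v -> rc F *m v = c *: v.
Proof.
move=> hF F1 Mv; apply: map_toC_inj; rewrite map_mxM /= rcE //.
by rewrite (fcalc_fix Pu sJ MP) ?F1 ?map_mxZ // -map_mxM Mv.
Qed.

Lemma rc_lfix F (c : R) (l : 'rV[R]_n.+1) : conj_sym F -> F 1 = toC c ->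
  l *m M = l -> l *m rc F = c *: l.
Proof.
move=> hF F1 lM; apply: map_toC_inj; rewrite map_mxM /= rcE //.
by rewrite (fcalc_lfix Pu sJ MP) ?F1 ?map_mxZ // -map_mxM lM.
Qed.

Lemma jordan_diag_neq0 i : J i i != 0.
Proof.
have Ju : J \in unitmx.
  have -> : J = invmx P *m (M^%C *m P) by rewrite MP mulKmx.
  by rewrite !unitmx_mul unitmx_inv Pu map_unitmx Mu.
have tJ : is_trig_mx J^T.
  apply/is_trig_mxP => k l kl; rewrite mxE; apply/eqP; apply: contraT => /sJ[e|[e _]].
    by rewrite e ltnn in kl.
  by move: kl; rewrite e ltnNge leqnSn.
move: Ju; rewrite unitmxE -det_tr det_trig // unitfE prodf_seq_neq0 => /allP/(_ i).
by rewrite mem_index_enum !mxE /=; apply.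
Qed.

Lemma conj_sym_inv : conj_sym (fun z : R[i] => z^-1).
Proof. by move=> z; rewrite conjc_inv. Qed.

Lemma conj_sym_id : conj_sym (fun z : R[i] => z).
Proof. by []. Qed.

Let N := rc (fun z => z^-1) *m M - 1%:M.

(** Multiplicative Jordan decomposition: the logarithm splits into that of the semisimple factor,
    taken eigenvalue by eigenvalue, and that of the unipotent factor, a finite series. *)
Lemma jordan_chevalley : M = rc (fun z => z) *m (1%:M + N).
Proof.
rewrite /N addrC subrK mulmxA (rcM conj_sym_id conj_sym_inv) (@rc_cst 1) ?mul1mx // => i.
by rewrite mulfV ?jordan_diag_neq0.
Qed.

Lemma unipotent_nil : N ^+ n.+1 = 0.
Proof.
pose Y := diag_fun J (fun z => z^-1) *m J - 1%:M.
have NE : N^%C = P *m Y *m invmx P.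
  rewrite /N /Y map_mxB map_mxM /= rcE; last exact: conj_sym_inv.
  rewrite map_mx1 mulmxBr mulmxBl mulmx1 mulmxV // /fcalc; congr (_ - _).
  have -> : M^%C = P *m J *m invmx P by rewrite -MP mulmxK.
  by rewrite !mulmxA mulmxKV.
have powE k : (P *m Y *m invmx P) ^+ k = P *m Y ^+ k *m invmx P.
  elim: k => [|k IHk]; first by rewrite !expr0 mulmx1 mulmxV.
  by rewrite !exprS IHk -[LHS]/(_ *m _) !mulmxA mulmxKV.
apply: map_toC_inj; rewrite rmorphXn /= NE powE strict_upper_nilpotent.
  by rewrite mulmx0 mul0mx map_mx0.
move=> i j; rewrite /Y /diag_fun mul_diag_mx !mxE.
have [<-|nij] := eqVneq i j; first by rewrite mulVf ?jordan_diag_neq0 // subrr eqxx.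
rewrite subr0 mulf_eq0 negb_or => /andP[_ /sJ[e|[-> _]]] //.
by rewrite e eqxx in nij.
Qed.

Lemma unipotent_comm X : comm_mx X M -> comm_mx X N.
Proof.
move=> XM; rewrite /N; apply: comm_mxD; last by apply: comm_mxN; apply: comm_mx1.
by apply: comm_mxM => //; apply: rc_comm => //; exact: conj_sym_inv.
Qed.

Lemma fcalc_eq0 F : (forall i, F (J i i) = 0) -> fcalc P J F = 0.
Proof.
move=> F0; rewrite (@eq_fcalc _ _ P J F (fun=> 0)) // fcalc_cst //.
by apply/matrixP => i j; rewrite !mxE mul0rn.
Qed.

Lemma fcalcD F G : fcalc P J F + fcalc P J G = fcalc P J (fun z => F z + G z).
Proof.
rewrite /fcalc -mulmxDl -mulmxDr; congr (_ *m _ *m _).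
by apply/matrixP => i j; rewrite !mxE mulrnDl.
Qed.

Lemma fcalc_horner p : horner_mx (fcalc P J id) p = fcalc P J (horner p).
Proof.
elim/poly_ind: p => [|p a IHp].
  by rewrite rmorph0 fcalc_eq0 // => i; rewrite horner0.
have -> : horner_mx (fcalc P J id) (p * 'X + a%:P) =
    horner_mx (fcalc P J id) p *m fcalc P J id + a%:M.
  by rewrite rmorphD rmorphM /= horner_mx_X horner_mx_C.
rewrite IHp fcalcM // -(fcalc_cst J Pu) fcalcD; apply: eq_fcalc => i.
by rewrite hornerMXaddC.
Qed.

(** The semisimple part, [N] and [Th] commute, so one basis makes all three triangular and the
    spectra are read off the diagonals. There [N] and [W] contribute 0 and [Th] contributes roots of
    x^3 = - x, which have real part 0. *)
Lemma floquet_spectrum (W G Th : 'M[R]_n.+1) (p : {poly R}) (c : R) :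
  W = G *m N -> G = horner_mx N p -> comm_mx Th M -> Th *m Th *m Th = - Th ->
  let B := rc (log_eig T) + W + c *: Th in
  exists ms bs : seq R[i],
    [/\ char_poly M^%C = \prod_(m <- ms) ('X - m%:P),
        char_poly B^%C = \prod_(b <- bs) ('X - b%:P) &
        [seq @complex.Re R b | b <- bs] = [seq ln (@complex.Re R `|m|) / T | m <- ms]].
Proof.
move=> WGN GE ThM Th3 B; pose A := rc (log_eig T).
have csL : conj_sym (log_eig T) by exact: log_eig_sym.
pose Ms := fcalc P J (fun z => z).
have MsE : (rc (fun z => z))^%C = Ms by rewrite (rcE conj_sym_id).
have cid X : comm_mx X M -> comm_mx X (rc (fun z => z)) by apply: rc_comm.
have cN := unipotent_comm.
pose As := [:: (rc (fun z => z)) ; N ; Th].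
have cAs : {in [seq X^%C | X <- As] &, forall X Y, comm_mx X Y}.
  have rM : comm_mx (rc (fun z => z)) M by apply/comm_mx_sym/cid.
  have NM : comm_mx N M by apply/comm_mx_sym/cN.
  have h X Y : X \in As -> Y \in As -> comm_mx X Y.
    rewrite !inE => /or3P[] /eqP -> /or3P[] /eqP ->; rewrite /comm_mx //.
    - exact: cN.
    - by apply/esym/cid.
    - by apply/esym/cN.
    - by apply/esym/cN.
    - by apply/cid.
    - by apply/cN.
  move=> X Y /mapP[X' X'A ->] /mapP[Y' Y'A ->].
  by rewrite /comm_mx -!map_mxM (h X' Y').
have [V Vun /allP /= hV] := cotrigonalization cAs.
have Vu := unitarymx_unit Vun.
pose cj X : 'M[R[i]]_n.+1 := V *m X *m invmx V.
have cjM X Y : cj (X *m Y) = cj X *m cj Y by rewrite /cj !mulmxA mulmxKV.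
have cjD X Y : cj (X + Y) = cj X + cj Y by rewrite /cj mulmxDr mulmxDl.
have cjZ a X : cj (a *: X) = a *: cj X by rewrite /cj -scalemxAr -scalemxAl.
have cj1 : cj 1%:M = 1%:M by rewrite /cj mulmx1 mulmxV.
have cjh X p0 : cj (horner_mx X p0) = horner_mx (cj X) p0.
  by rewrite /cj horner_mx_uconj.
have trigA X : X \in As -> is_trig_mx (cj X^%C).
  by move=> XA; have := hV X^%C (map_f _ XA); rewrite /similar_to /= conjumx.
have cj0 : cj 0 = 0 by rewrite /cj mulmx0 mul0mx.
have cjN X : cj (- X) = - cj X by rewrite /cj mulmxN mulNmx.
have cjP X : char_poly (cj X) = char_poly X by apply: char_poly_conj.
clearbody cj.
have tMs : is_trig_mx (cj Ms) by rewrite -MsE; apply: trigA; rewrite !inE eqxx.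
have tN : is_trig_mx (cj N^%C) by apply: trigA; rewrite !inE eqxx orbT.
have tTh : is_trig_mx (cj Th^%C) by apply: trigA; rewrite !inE eqxx !orbT.
have dN i : cj N^%C i i = 0.
  have [_ /(_ i)] := @trig_horner R[i] n _ 'X^(n.+1) tN; rewrite rmorphXn /= horner_mx_X.
  have -> : cj N^%C ^+ n.+1 = 0.
    rewrite -[cj _]horner_mx_X -rmorphXn /= -cjh rmorphXn /= horner_mx_X.
    by rewrite -rmorphXn /= unipotent_nil map_mx0 cj0.
  by rewrite mxE hornerXn => /esym/eqP; rewrite expf_eq0 /= => /eqP.
pose lam := [seq J i i | i : 'I_n.+1].
have [q qE] := interpolation lam (log_eig T).
have AE : A^%C = horner_mx Ms q.
  by rewrite /A rcE // fcalc_horner; apply: eq_fcalc => i; rewrite qE //; apply: codom_f.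
have [tA dA] := trig_horner q tMs; rewrite -cjh -AE in tA dA.
(* [Ms] is annihilated by the product of the ['X - l], so its diagonal in the new basis consists of
   eigenvalues at which [q] interpolates the logarithm. *)
have Mslam i : cj Ms i i \in lam.
  have [_ /(_ i)] := trig_horner (\prod_(l <- lam) ('X - l%:P)) tMs.
  rewrite -cjh fcalc_horner (_ : fcalc _ _ _ = 0).
    rewrite cj0 mxE => /esym/eqP; rewrite -/(root _ _).
    by rewrite root_prod_XsubC.
  by apply: fcalc_eq0 => k; apply/eqP; rewrite -/(root _ _) root_prod_XsubC; exact: codom_f.
have WC : cj W^%C = cj G^%C *m cj N^%C by rewrite WGN map_mxM cjM.
have tG : is_trig_mx (cj G^%C).
  by rewrite GE map_horner_mx cjh; have [] := trig_horner (map_poly toC p) tN.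
have [tW dW] := trig_mul tG tN; rewrite -WC in tW dW.
have dTh i : complex.Re (cj Th^%C i i) = 0.
  have [t2 d2] := trig_mul tTh tTh; have [_ /(_ i)] := trig_mul t2 tTh.
  rewrite d2 -!cjM -!map_mxM Th3 map_mxN cjN mxE.
  case: (cj Th^%C i i) => a b /eqP; rewrite eq_complex /= => /andP[/eqP h1 /eqP h2].
  apply/eqP; apply: contraT => a0.
  have h3 : 3 * (b ^+ 2) = a ^+ 2 + 1.
    by apply: (mulfI a0); lra.
  have h4 : b * (3 * a ^+ 2 - b ^+ 2 + 1) = 0 by lra.
  have b0 : b != 0 by apply: contraTneq isT => b0; move: h3; rewrite b0; nra.
  by move/eqP: h4; rewrite mulf_eq0 (negbTE b0) /= => /eqP; nra.
have mapE (X Y Z : 'M[R]_n.+1) : (X + Y + c *: Z)^%C = X^%C + Y^%C + (toC c) *: Z^%C.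
  by apply/matrixP => k l; rewrite !mxE !rmorphD rmorphM.
have cjB : cj B^%C = cj A^%C + cj W^%C + (toC c) *: cj Th^%C.
  have -> : B^%C = A^%C + W^%C + (toC c) *: Th^%C := mapE _ _ _.
  by rewrite 2!cjD cjZ.
clearbody A B.
have tB : is_trig_mx (cj B^%C).
  rewrite cjB; apply: trig_add; last exact: trig_scale.
  exact: trig_add.
have t1N : is_trig_mx (cj (1%:M + N^%C)).
  by rewrite cjD cj1; apply: trig_add => //; apply: scalar_mx_is_trig.
have [tM dM] := trig_mul tMs t1N.
have MC : M^%C = Ms *m (1%:M + N^%C).
  by rewrite {1}jordan_chevalley map_mxM map_mxD map_mx1 /= MsE.
rewrite -cjM -MC in tM dM.
exists [seq cj M^%C i i | i <- index_enum 'I_n.+1], [seq cj B^%C i i | i <- index_enum 'I_n.+1].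
split.
- by rewrite -cjP char_poly_trig // big_map.
- by rewrite -cjP char_poly_trig // big_map.
rewrite -!map_comp; apply: eq_map => i /=.
rewrite dM cjD cj1 mxE [1%:M i i]mxE eqxx dN addr0 mulr1.
rewrite cjB 3!mxE dW dN mulr0 addr0 dA qE ?Mslam //.
have := dTh i; case: (cj Th^%C i i) => a b /= ->.
by rewrite mulr0 mul0r subr0 addr0.
Qed.

(** [B] is a sum of three commuting terms: [A] for moduli and arguments, [W] for the unipotent
    factor, [c *: Th] for the half-turn of the paired blocks. [E] is the product of their
    exponentials. At the eigenvalue 1 each term vanishes on fixed vectors, on either side. *)
Lemma real_floquet_jordan d : d = aindex_of_jordan J ->
  exists (Po B : 'M[R]_n.+1) (E : R -> 'M[R]_n.+1),
  [/\ [/\ Po *m Po = Po, \rank Po = d, comm_mx Po B & forall s, comm_mx Po (E s)],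
      [/\ E 0 = 1%:M, forall s : R, is_derive s 1 E (B *m E s), (forall s, comm_mx B (E s)) &
          M = (1%:M - 2 *: Po) *m E T],
      forall v : 'cV[R]_n.+1, M *m v = v -> Po *m v = 0 /\ B *m v = 0,
      forall l : 'rV[R]_n.+1, l *m M = l -> l *m Po = 0 /\ l *m B = 0 &
      exists ms bs : seq R[i],
        [/\ char_poly M^%C = \prod_(m <- ms) ('X - m%:P),
            char_poly B^%C = \prod_(b <- bs) ('X - b%:P) &
            [seq @complex.Re R b | b <- bs] = [seq ln (@complex.Re R `|m|) / T | m <- ms]]].
Proof.
move=> ->; have [Th [Po [ThM Th3 [PnTh ThPn] PoE [Po2 PoTh ThPo rPo]]]] :=
  even_part_structure Pu hJ MP.
have [W [G [WT Wn WGN [pG GE]]]] := nilpotent_log (lt0r_neq0 T0) unipotent_nil.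
set Pn := rcalc P J (@neg_ind R) in PnTh ThPn PoE.
have PnM : comm_mx Pn M by apply/comm_mx_sym/rc_commM/neg_ind_sym.
have PoM : comm_mx Po M.
  by rewrite PoE; apply/comm_mx_sym/comm_mxD; [|apply: comm_mxM]; apply/comm_mx_sym.
have cW X : comm_mx X M -> comm_mx X W.
  move=> /unipotent_comm XN; rewrite WGN; apply: comm_mxM => //.
  by rewrite GE; apply: comm_mx_horner.
have cEW X s : comm_mx X M -> comm_mx X (exp_nil W s).
  by move=> /cW XW; rewrite exp_nilE; apply: comm_mx_horner; apply: comm_mxZ.
pose c := pi / T.
(* Closed form of exp (s c Th), since the powers of [Th] repeat by [Th^3 = - Th]. At [s = T] the
   angle is [pi], which gives [1 + 2 Th^2]: minus the identity on the paired blocks. *)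
pose Rot (s : R) := 1%:M + sin (s * c) *: Th + (1 - cos (s * c)) *: (Th *m Th).
pose EF s := rc (flow_eig T s).
pose A := rc (log_eig T).
have cRot X s : comm_mx X Th -> comm_mx X (Rot s).
  move=> XT; rewrite /Rot; apply: comm_mxD; last by apply: comm_mxZ; apply: comm_mxM.
  by apply: comm_mxD; [exact: comm_mx1|apply: comm_mxZ].
have csF s : conj_sym (flow_eig T s) by exact: flow_eig_sym.
have csL : conj_sym (log_eig T) by exact: log_eig_sym.
have cEF X s : comm_mx X M -> comm_mx X (EF s) by apply: rc_comm.
have cA X : comm_mx X M -> comm_mx X A by apply: rc_comm.
have MW : comm_mx W M by apply/comm_mx_sym/cW.
have AM : comm_mx A M by apply/comm_mx_sym/cA.
pose B := A + W + c *: Th.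
pose E s := EF s *m exp_nil W s *m Rot s.
have cE X s : comm_mx X M -> comm_mx X Th -> comm_mx X (E s).
  move=> XM XT; apply: comm_mxM; last exact: cRot.
  by apply: comm_mxM; [exact: cEF|exact: cEW].
have cB X : comm_mx X M -> comm_mx X Th -> comm_mx X B.
  move=> XM XT; apply: comm_mxD; last by apply: comm_mxZ.
  by apply: comm_mxD; [exact: cA|exact: cW].
have PoT : comm_mx Po Th by rewrite /comm_mx PoTh ThPo.
have dE (s : R) : is_derive s 1 E (B *m E s).
  have d1 : is_derive s 1 EF (A *m EF s).
    by rewrite /A /EF rcM //; apply: is_derive_rcalc_flow.
  have d2 := is_derive_exp_nil s Wn.
  have dsin := is_derive_comp_lin (is_derive_sin (s * c)).
  have dcos := is_derive_comp_lin (is_derive_cos (s * c)).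
  have d3 : is_derive s 1 Rot ((c *: Th) *m Rot s).
    have h1 := is_derive_scale_mx Th dsin.
    have h2 : is_derive s 1 (fun t => 1 - cos (t * c)) (c * sin (s * c)).
      by apply: (is_derive_eq (is_deriveB (is_derive_cst (1 : R) s 1) dcos)); rewrite sub0r mulrN opprK.
    have h3 := is_derive_scale_mx (Th *m Th) h2.
    have := is_deriveD (is_deriveD (is_derive_cst (1%:M : 'M[R]_n.+1) s 1) h1) h3.
    move/is_derive_eq; apply; rewrite add0r /Rot !mulmxDr mulmx1 -!scalemxAr -!scalemxAl.
    rewrite mulmxA Th3; move: (Th *m Th) => TT.
    by apply/matrixP => i j; rewrite !mxE; ring.
  have := is_derive_mulmx (is_derive_mulmx d1 d2) d3.
  move/is_derive_eq; apply; rewrite /E /B !mulmxDl !mulmxA; congr (_ + _ + _).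
  - by rewrite -(cEF W s MW) // !mulmxA.
  - have ThEF : (c *: Th) *m (EF s *m exp_nil W s) = (EF s *m exp_nil W s) *m (c *: Th).
      rewrite -scalemxAl -scalemxAr; congr (_ *: _).
      by apply: comm_mxM; [exact: cEF|exact: cEW].
    by rewrite -ThEF !mulmxA.
have E0 : E 0 = 1%:M.
  rewrite /E /EF (@rc_cst 1) => [|i]; last exact: flow_eig0.
  by rewrite exp_nil0 /Rot mul0r sin0 cos0 subrr !scale0r !addr0 !mulmx1.
(* Because [Pn] fixes [Th], [(1 - 2 Pn) (1 + 2 Th^2) = 1 - 2 (Pn + Th^2)]: the two sign changes
   cancel on paired blocks and only [Po] remains. As this factor is an involution, the relation can
   be solved for [M]. *)
have ET : E T = M *m (1%:M - 2 *: Po).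
  rewrite /E WT /Rot /c mulrCA mulfV ?gt_eqF // mulr1 sinpi cospi scale0r addr0 opprK.
  have -> : EF T = rc (fun z => z) *m (1%:M - 2 *: Pn).
    have PnC : Pn^%C = fcalc P J (@neg_ind R) := rcE (@neg_ind_sym R).
    apply: map_toC_inj; rewrite map_mxM map_mxB map_mxZ /= map_mx1.
    rewrite (rcE conj_sym_id) PnC [X in X = _](rcE (csF T)).
    rewrite mulmxBr mulmx1 -scalemxAr fcalcM //.
    rewrite (@eq_fcalc _ _ P J _ (fun z => z * (1 - 2 * neg_ind z))); last first.
      by move=> i; rewrite flow_eigT ?jordan_diag_neq0.
    apply/matrixP => i j; rewrite /fcalc /diag_fun !mul_mx_diag !mxE mulr_sumr -sumrB.
    apply: eq_bigr => k _; rewrite !mxE rmorph_nat; ring.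
  have PnN : comm_mx (1%:M - 2 *: Pn) (1%:M + N).
    apply: comm_mxD; first exact: comm_mx1.
    apply: unipotent_comm; apply/comm_mx_sym/comm_mxD; first exact: comm_mx1.
    by apply/comm_mxN/comm_mxZ/comm_mx_sym.
  rewrite -(mulmxA (rc _)) PnN mulmxA -jordan_chevalley -mulmxA; congr (_ *m _).
  rewrite mulmxDr mulmx1 PoE mulmxBl mul1mx -!scalemxAl -!scalemxAr mulmxA PnTh.
  by apply/matrixP => i j; rewrite !mxE; ring.
have fix_N (v : 'cV[R]_n.+1) : M *m v = v -> N *m v = 0.
  move=> Mv; rewrite /N mulmxBl -mulmxA Mv mul1mx (rc_fix conj_sym_inv (c := 1)) //.
    by rewrite scale1r subrr.
  by rewrite invr1.
exists Po, B, E; split.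
- by split => // [|s]; [apply: cB|apply: cE].
- split => // [s|].
    apply: cE; last by apply/comm_mx_sym/cB => //; apply: comm_mx_refl.
    by apply/comm_mx_sym/cB => //; apply/comm_mx_sym.
  have SM : comm_mx (1%:M - 2 *: Po) M.
    apply/comm_mx_sym/comm_mxD; first exact: comm_mx1.
    by apply/comm_mxN/comm_mxZ/comm_mx_sym.
  have SS : (1%:M - 2 *: Po) *m (1%:M - 2 *: Po) = 1%:M.
    rewrite mulmxBr mulmx1 -scalemxAr mulmxBl mul1mx -scalemxAl Po2.
    by apply/matrixP => i j; rewrite !mxE; ring.
  by rewrite ET mulmxA SM -mulmxA SS mulmx1.
- move=> v Mv; have Pnv : Pn *m v = 0.
    by rewrite (rc_fix (@neg_ind_sym R) (c := 0)) ?scale0r // /neg_ind /neg_eig /= ltr10 andbF.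
  have Thv : Th *m v = 0 by rewrite -ThPn -mulmxA Pnv mulmx0.
  split; first by rewrite PoE mulmxDl Pnv -mulmxA Thv mulmx0 addr0.
  rewrite !mulmxDl -scalemxAl Thv scaler0 addr0 WGN -mulmxA fix_N // mulmx0 addr0.
  by rewrite (rc_fix csL (c := 0)) ?scale0r // log_eig1.
- move=> l lM; have Pnl : l *m Pn = 0.
    by rewrite (rc_lfix (@neg_ind_sym R) (c := 0)) ?scale0r // /neg_ind /neg_eig /= ltr10 andbF.
  have Thl : l *m Th = 0 by rewrite -PnTh mulmxA Pnl mul0mx.
  split; first by rewrite PoE mulmxDr Pnl mulmxA Thl mul0mx addr0.
  rewrite !mulmxDr -scalemxAr Thl scaler0 addr0.
  have lN : l *m N = 0.
    rewrite /N mulmxBr mulmxA mulmx1 (rc_lfix conj_sym_inv (c := 1)) ?scale1r ?lM ?subrr //.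
    by rewrite invr1.
  have NG : G *m N = N *m G by rewrite GE; apply: comm_horner_mx.
  rewrite WGN NG mulmxA lN mul0mx addr0.
  by rewrite (rc_lfix csL (c := 0)) ?scale0r // log_eig1.
exact: (floquet_spectrum c WGN GE ThM Th3).
Qed.

End RealFloquet.

(** * Smooth curves and linear differential equations *)

Section MatrixNorm.
Variable R : realType.

Lemma mx_norm_entry m n (A : 'M[R]_(m, n)) i j : `|A i j| <= `|A|.
Proof.
rewrite [leRHS]/Num.Def.normr /= mx_normrE.
exact: (le_bigmax _ (fun ij : 'I_m * 'I_n => `|A ij.1 ij.2|) (i, j)).
Qed.

Lemma mx_norm_le m n (A : 'M[R]_(m, n)) e : 0 <= e ->
  (forall i j, `|A i j| <= e) -> `|A| <= e.
Proof.
move=> e0 h; rewrite [leLHS]/Num.Def.normr /= mx_normrE.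
by apply: bigmax_le => // -[i j] _ /=.
Qed.

Lemma mulmx_norm m n p (A : 'M[R]_(m, n)) (B : 'M[R]_(n, p)) :
  `|A *m B| <= n%:R * `|A| * `|B|.
Proof.
apply: mx_norm_le => [|i j]; first by rewrite !mulr_ge0.
rewrite mxE (le_trans (ler_norm_sum _ _ _)) //.
apply: (@le_trans _ _ (\sum_(k < n) `|A| * `|B|)).
  by apply: ler_sum => k _; rewrite normrM ler_pM ?mx_norm_entry.
by rewrite sumr_const card_ord -[X in X <= _]mulr_natl mulrA.
Qed.

Lemma mulmx_continuous m n p (A : 'M[R]_(m, n)) :
  continuous (mulmx A : 'M[R]_(n, p) -> 'M[R]_(m, p)).
Proof.
apply: bounded_linear_continuous; apply/linear_boundedP; near=> k => x.
apply: (le_trans (mulmx_norm _ _)); rewrite ler_wpM2r //.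
Unshelve. all: by end_near. Qed.

End MatrixNorm.

Section C1Differentiable.
Variable R : realType.

Lemma differentiable_bound (V W : normedModType R) (F : V -> W) (x : V)
    (L : {linear V -> W}) : continuous L ->
  (forall e, 0 < e -> \forall h \near (0 : V), `|F (h + x) - (F x + L h)| <= e * `|h|) ->
  differentiable F x /\ 'd F x = L :> (V -> W).
Proof.
move=> cL hF.
have E : F \o shift x = cst (F x) + L +o_ (0 : V) id.
  by apply/eqaddoP => e e0; near do rewrite !fctE /=; apply: hF.
have dE := diff_unique cL E.
by split => //; apply/diff_locallyP; rewrite dE.
Unshelve. all: by end_near. Qed.

Lemma is_derive_line m p (G : 'cV[R]_m -> 'cV[R]_p) (y0 e : 'cV[R]_m) (c s : R) i :
  derivable G (y0 + (s * c) *: e) e ->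
  is_derive s 1 (fun t : R => G (y0 + (t * c) *: e) i 0)
    (c * ('D_e G (y0 + (s * c) *: e)) i 0).
Proof.
set y1 := y0 + _ => dG.
have w : is_derive (0 : R) 1 (fun h : R => G (h *: e + y1)) ('D_e G y1).
  split; first by have /derivable1P := dG.
  rewrite /derive; set g1 := fun h => h^-1 *: _; set g2 := fun h => h^-1 *: _.
  suff -> : g1 = g2 by [].
  by rewrite funeqE /g1 /g2 => h /=; rewrite addr0 scale0r add0r [_%:A]mulr1.
have /is_derive_mxP/(_ i 0) wi := w.
have hg : is_derive s 1 (fun t : R => (t - s) * c) c.
  have -> : (fun t : R => (t - s) * c) = c *: (id - cst s).
    by apply/funext => t; rewrite !fctE mulrC.
  apply: (is_derive_eq (is_deriveZ _ (is_deriveB (is_derive_id s 1) (is_derive_cst s s 1)))).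
  by rewrite subr0 /GRing.scale /= mulr1.
have e0 : (s - s) * c = 0 by rewrite subrr mul0r.
rewrite -[X in is_derive X _ _ _]e0 in wi.
have := @is_derive1_comp R (fun h => G (h *: e + y1) i 0) (fun t : R => (t - s) * c) s _ _ wi hg.
rewrite mulrC; congr (is_derive _ _ _ _); apply/funext => t /=.
congr (G _ i 0); rewrite /y1 addrCA -scalerDl; congr (_ + _ *: _); ring.
Qed.

Lemma bounded_derive_increment (u du : R -> R) (M : R) :
  (forall x : R, 0 <= x <= 1 -> is_derive x 1 u (du x)) ->
  (forall x : R, 0 <= x <= 1 -> `|du x| <= M) -> `|u 1 - u 0| <= M.
Proof.
move=> hu hM.
have [||c] := @MVT R u du 0 1 ltr01.
- by move=> x; rewrite in_itv /= => /andP[/ltW x0 /ltW x1]; apply: hu; rewrite x0.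
- apply: derivable_within_continuous => x; rewrite in_itv /= => xI.
  by have [] := hu x xI.
rewrite in_itv /= => /andP[/ltW c0 /ltW c1] ->.
by rewrite subr0 mulr1; apply: hM; rewrite c0.
Qed.

(** The increment is telescoped along the coordinates: [hk k] keeps the first [k] entries of [h]. On
    each axis-parallel segment the mean value theorem is applied after subtracting the linear part
    frozen at [x]. *)
Lemma C1_increment m p (G : 'cV[R]_m -> 'cV[R]_p) (x : 'cV[R]_m) (e d : R) : 0 <= e ->
  (forall y, `|y - x| < d -> forall j, derivable G y (basis_cV R j) /\
     `|'D_(basis_cV R j) G y - 'D_(basis_cV R j) G x| <= e) ->
  forall h, `|h| < d -> `|G (h + x) - (G x + jacobian_mx G x *m h)| <= m%:R * e * `|h|.
Proof.
move=> e0 hG h hd; apply: mx_norm_le => [|i i0]; first by rewrite !mulr_ge0.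
rewrite (ord1 i0) => {i0}.
pose hk k : 'cV[R]_m := \col_j (if (j < k)%N then h j 0 else 0).
have hkS (k : 'I_m) : hk k.+1 = hk k + (1 * h k 0) *: basis_cV R k.
  apply/colP => j; rewrite !mxE eqxx andbT mul1r ltnS leq_eqVlt.
  have [<-|nkj] := eqVneq k j; first by rewrite eqxx ltnn mulr1 add0r.
  by rewrite -val_eqE eq_sym in nkj; rewrite (negbTE nkj) mulr0 addr0.
have step (k : 'I_m) : `|G (x + hk k.+1) i 0 - G (x + hk k) i 0
    - h k 0 * ('D_(basis_cV R k) G x) i 0| <= e * `|h|.
  pose c := h k 0; pose y t := x + hk k + (t * c) *: basis_cV R k.
  have yx t : 0 <= t <= 1 -> `|y t - x| < d.
    move=> /andP[t0 t1]; apply: le_lt_trans hd; apply: mx_norm_le => // j j0.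
    rewrite (ord1 j0) /y -(addrA x) [x + _]addrC addrK !mxE eqxx andbT.
    have [ejk|nkj] := eqVneq j k.
      rewrite ejk ltnn add0r mulr1 normrM ger0_norm // (le_trans _ (mx_norm_entry h k 0)) //.
      by rewrite ler_piMl.
    by rewrite mulr0 addr0; case: ifP => _; rewrite ?mx_norm_entry // normr0.
  pose a := ('D_(basis_cV R k) G x) i 0.
  have hder (t : R) : 0 <= t <= 1 -> is_derive t 1 (fun t => G (y t) i 0 - t * c * a)
     (c * (('D_(basis_cV R k) G (y t)) i 0 - a)).
    move=> t01; have [dG _] := hG _ (yx _ t01) k.
    have h1 := is_derive_line i dG.
    have h2 : is_derive t 1 (fun t : R => t * c * a) (c * a).
      have -> : (fun t : R => t * c * a) = (c * a) *: id.
        by apply/funext => t'; rewrite !fctE -mulrA mulrC.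
      by apply: (is_derive_eq (is_deriveZ _ (is_derive_id t 1))); rewrite /GRing.scale /= mulr1.
    by apply: (is_derive_eq (is_deriveB h1 h2)); rewrite mulrBr.
  have := bounded_derive_increment (M := e * `|h|) hder _.
  rewrite /y mul1r mul0r scale0r addr0 mul0r subr0 hkS mul1r addrA -/c => H.
  rewrite (addrAC (G _ i 0)).
  apply: H => t t01; have [_ hb] := hG _ (yx _ t01) k.
  rewrite normrM mulrC ler_pM ?mx_norm_entry //.
  by apply: le_trans hb; rewrite (le_trans _ (mx_norm_entry _ i 0)) // !mxE.
have -> : (G (h + x) - (G x + jacobian_mx G x *m h)) i 0 =
    \sum_(k < m) (G (x + hk k.+1) i 0 - G (x + hk k) i 0
    - h k 0 * ('D_(basis_cV R k) G x) i 0).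
  rewrite sumrB -(big_mkord xpredT (fun k => G (x + hk k.+1) i 0 - G (x + hk k) i 0)).
  rewrite telescope_sumr // !mxE.
  have -> : hk m = h by apply/colP => j; rewrite !mxE ltn_ord.
  have -> : hk 0%N = 0 by apply/colP => j; rewrite !mxE ltn0.
  rewrite addr0 [h + x]addrC opprD addrA; congr (_ - _ - _).
  by apply: eq_bigr => k _; rewrite !mxE mulrC.
rewrite (le_trans (ler_norm_sum _ _ _)) // (le_trans (ler_sum _ (fun k _ => step k))) //.
by rewrite sumr_const card_ord -[X in X <= _]mulr_natl mulrA.
Qed.

Lemma C1_differentiable m p (O : set 'cV[R]_m) (G : 'cV[R]_m -> 'cV[R]_p) x :
  open O -> Cr_on 1 O G -> O x ->
  differentiable G x /\ forall h, 'd G x h = jacobian_mx G x *m h.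
Proof.
move=> oO hG Ox.
suff [dG dE] : differentiable G x /\ 'd G x = mulmx (jacobian_mx G x) :> ('cV[R]_m -> _).
  by split => // h; rewrite dE.
apply: differentiable_bound; first exact: mulmx_continuous.
(* Each of the [m] coordinates costs [e']; the added 1 keeps the division valid when [m = 0]. *)
move=> e e0; pose e' := e / (m%:R + 1).
have m0 : 0 < m%:R + 1 :> R by rewrite ltr_wpDl.
have e'0 : 0 < e' by rewrite divr_gt0.
have hn : \forall y \near x, O y /\ forall j : 'I_m,
    `|'D_(basis_cV R j) G y - 'D_(basis_cV R j) G x| <= e'.
  apply: filterI; first exact: open_nbhs_nbhs.
  apply: (@filter_forall _ _ (fun (j : 'I_m) (y : 'cV[R]_m) =>
    `|'D_(basis_cV R j) G y - 'D_(basis_cV R j) G x| <= e') _ (@nbhs_filter 'cV[R]_m x)) => j.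
  have [_ /(_ [:: j] isT) cj] := hG _ Ox.
  by move/cvgrPdistC_le : cj => /(_ _ e'0).
have /nbhs_ballP[d /= d0 hd] := hn.
apply/nbhs_ballP; exists d => // h; rewrite -ball_normE /= sub0r normrN => hd'.
apply: (@le_trans _ _ (m%:R * e' * `|h|)).
  apply: (@C1_increment _ _ G x e' d (ltW e'0)).
    move=> y yx j; have [|Oy Dy] := hd y; first by rewrite -ball_normE /= distrC.
    by split => //; have [/(_ [::] isT)] := hG _ Oy.
  by [].
rewrite ler_wpM2r // /e' mulrCA ler_piMr ?(ltW e0) // ler_pdivrMr // mul1r.
by rewrite lerDl.
Qed.

Lemma is_derive_curve m p (G : 'cV[R]_m -> 'cV[R]_p) (A : 'M[R]_(p, m))
    (phi : R -> 'cV[R]_m) (v : 'cV[R]_m) (t : R) :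
  differentiable G (phi t) -> (forall h, 'd G (phi t) h = A *m h) ->
  is_derive t 1 phi v -> is_derive t 1 (fun s => G (phi s)) (A *m v).
Proof.
move=> dG dE [dphi ephi]; have /derivable1_diffP dp := dphi.
have dc : differentiable (G \o phi) t by apply: differentiable_comp.
split; first exact/derivable1_diffP.
rewrite deriveE // (diff_comp dp dG) /= dE; congr (_ *m _).
by rewrite -ephi deriveE.
Qed.

End C1Differentiable.

Section Smooth.
Variable R : realType.

(** A recursive scalar form of [Cr_R], suited to induction through products and compositions;
    [Ckmx_Cr_R] translates back. *)
Fixpoint Ck (k : nat) (u : R -> R) : Prop :=
  if k is k'.+1 then (forall t, derivable u t 1) /\ Ck k' (derive1 u) else continuous u.

Lemma derivable_continuous (V : normedModType R) (u : R -> V) :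
  (forall t, derivable u t 1) -> continuous u.
Proof. by move=> du t; apply/differentiable_continuous/derivable1_diffP. Qed.

Lemma Ck_derive k (u v : R -> R) : (forall t : R, is_derive t 1 u (v t)) ->
  Ck k v -> Ck k.+1 u.
Proof.
move=> hu hv; split; first by move=> t; have [] := hu t.
have -> // : derive1 u = v.
by apply/funext => t; rewrite derive1E; have [_ ->] := hu t.
Qed.

Lemma Ck_is_derive k (u : R -> R) : Ck k.+1 u -> forall t : R, is_derive t 1 u (derive1 u t).
Proof. by move=> [du _] t; split => //; rewrite derive1E. Qed.

Lemma CkW k u : Ck k.+1 u -> Ck k u.
Proof.
elim: k u => [|k IHk] u [du hu]; first exact: derivable_continuous.
by split => //; apply: IHk.
Qed.

Lemma Ck_continuous k u : Ck k u -> continuous u.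
Proof. by case: k => [//|k] [du _]; exact: derivable_continuous. Qed.

Lemma Ck_cst k (c : R) : Ck k (fun=> c).
Proof.
elim: k c => [|k IHk] c; first by move=> t; exact: cvg_cst.
by apply: (@Ck_derive _ _ (fun=> 0)) => // t; exact: is_derive_cst.
Qed.

Lemma CkD k u v : Ck k u -> Ck k v -> Ck k (fun t => u t + v t).
Proof.
elim: k u v => [|k IHk] u v hu hv; first by move=> t; apply: cvgD; [exact: hu|exact: hv].
apply: (@Ck_derive _ _ (fun t => derive1 u t + derive1 v t)).
  by move=> t; apply: is_deriveD; exact: (@Ck_is_derive k).
by apply: IHk; [case: hu|case: hv].
Qed.

Lemma CkM k u v : Ck k u -> Ck k v -> Ck k (fun t => u t * v t).
Proof.
elim: k u v => [|k IHk] u v hu hv; first by move=> t; apply: cvgM; [exact: hu|exact: hv].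
apply: (@Ck_derive _ _ (fun t => u t * derive1 v t + v t * derive1 u t)).
  by move=> t; apply: is_deriveM; exact: (@Ck_is_derive k).
by apply: CkD; apply: IHk; [exact: CkW|case: hv|exact: CkW|case: hu].
Qed.

Lemma Ck_sum k n (u : 'I_n -> R -> R) : (forall i, Ck k (u i)) ->
  Ck k (fun t => \sum_(i < n) u i t).
Proof.
elim: n u => [|n IHn] u hu.
  have -> : (fun t => \sum_(i < 0) u i t) = fun=> 0 by apply/funext => t; rewrite big_ord0.
  exact: Ck_cst.
have -> : (fun t => \sum_(i < n.+1) u i t) =
    fun t => u ord0 t + \sum_(i < n) u (lift ord0 i) t.
  by apply/funext => t; rewrite big_ord_recl.
by apply: CkD => //; apply: IHn.
Qed.

Definition Ckmx k m n (F : R -> 'M[R]_(m, n)) := forall i j, Ck k (fun t => F t i j).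

Lemma Ckmx_mul k m n p (F : R -> 'M[R]_(m, n)) (G : R -> 'M[R]_(n, p)) :
  Ckmx k F -> Ckmx k G -> Ckmx k (fun t => F t *m G t).
Proof.
move=> hF hG i j.
have -> : (fun t => (F t *m G t) i j) = fun t => \sum_l F t i l * G t l j.
  by apply/funext => t; rewrite mxE.
by apply: Ck_sum => l; apply: CkM.
Qed.

Lemma Ckmx_cst k m n (A : 'M[R]_(m, n)) : Ckmx k (fun=> A).
Proof. by move=> i j; exact: Ck_cst. Qed.

Lemma Ckmx_derive k m n (F F' : R -> 'M[R]_(m, n)) :
  (forall t : R, is_derive t 1 F (F' t)) -> Ckmx k F' -> Ckmx k.+1 F.
Proof.
move=> hF hF' i j; apply: (@Ck_derive _ _ (fun t => F' t i j)) => // t.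
by have /is_derive_mxP := hF t.
Qed.

(** Bootstrapping: [A t *m F t] is as smooth as the worse factor, so [F] gains one derivative per
    pass and ends one order above [A]. This makes [Psi] of class C^r although its coefficients are
    only C^(r-1). *)
Lemma Ckmx_linear_ode k m n (A : R -> 'M[R]_m) (F : R -> 'M[R]_(m, n)) :
  (forall t : R, is_derive t 1 F (A t *m F t)) -> Ckmx k A -> Ckmx k.+1 F.
Proof.
move=> hF; elim: k => [|k IHk] hA; apply: (Ckmx_derive hF); apply: Ckmx_mul => //.
  move=> i j; apply: derivable_continuous => t.
  by have /is_derive_mxP/(_ i j)[] := hF t.
by apply: IHk => i j; apply: CkW.
Qed.

Lemma continuous_mx m n (F : R -> 'M[R]_(m, n)) :
  (forall i j, continuous (fun t => F t i j)) -> continuous F.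
Proof.
move=> hF t; apply/cvgrPdist_le => e e0.
have H : \forall s \near t, forall ij : 'I_m * 'I_n, `|F t ij.1 ij.2 - F s ij.1 ij.2| <= e.
  apply: (@filter_forall _ _ (fun (ij : 'I_m * 'I_n) s =>
    `|F t ij.1 ij.2 - F s ij.1 ij.2| <= e) _ (@nbhs_filter R t)) => ij.
  by move/cvgrPdist_le : (hF ij.1 ij.2 t) => /(_ _ e0).
apply: filterS H => s H; apply: mx_norm_le (ltW e0) _ => i j; rewrite !mxE.
exact: (H (i, j)).
Qed.

Lemma Ckmx_Cr_R r m n (F : R -> 'M[R]_(m, n)) : Ckmx r F -> Cr_R r F.
Proof.
elim: r F => [|r IHr] F hF.
  by split => // -[|//] _; apply: continuous_mx => i j; exact: hF.
have dF t : derivable F t 1 by apply/derivable_mxP => i j; case: (hF i j) => /(_ t).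
have [h1 h2] : Cr_R r (derive1 F).
  apply: IHr => i j; have [_] := hF i j.
  congr (Ck _ _); apply/funext => t; rewrite !derive1E derive_mx // mxE //.
split=> -[|k] kr.
- exact: dF.
- by move=> t; rewrite iterSr; apply: h1.
- exact: derivable_continuous.
- by rewrite iterSr; apply: h2.
Qed.

(** The head of the list is the outermost derivative, so appending an index differentiates [F]
    itself first. *)
Lemma iter_partial_rcons m (V : normedModType R) l (j : 'I_m) (F : 'cV[R]_m -> V) :
  iter_partial (rcons l j) F = iter_partial l ('D_(basis_cV R j) F).
Proof. by elim: l => [|i l IHl] //=; rewrite IHl. Qed.

Lemma Cr_on_partial r m (V : normedModType R) (O : set 'cV[R]_m) (F : 'cV[R]_m -> V) j :
  Cr_on r.+1 O F -> Cr_on r O ('D_(basis_cV R j) F).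
Proof.
move=> hF x Ox; have [h1 h2] := hF x Ox; split=> l lr.
  by move=> i; rewrite -iter_partial_rcons; apply: h1; rewrite size_rcons.
by rewrite -iter_partial_rcons; apply: h2; rewrite size_rcons.
Qed.

Lemma Cr_on_le r r' m (V : normedModType R) (O : set 'cV[R]_m) (F : 'cV[R]_m -> V) :
  (r' <= r)%N -> Cr_on r O F -> Cr_on r' O F.
Proof.
move=> rr hF x Ox; have [h1 h2] := hF x Ox; split=> l lr.
  by apply: h1; apply: leq_trans rr.
by apply: h2; apply: leq_trans rr.
Qed.

(** Chain rule by induction on [k] for all [G] at once: the columns of the Jacobian along the curve
    are again compositions, of maps one order less smooth. *)
Lemma Ckmx_curve k m p (O : set 'cV[R]_m) (G : 'cV[R]_m -> 'cV[R]_p)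
    (phi phi' : R -> 'cV[R]_m) :
  open O -> (forall t, O (phi t)) -> (forall t : R, is_derive t 1 phi (phi' t)) ->
  Cr_on k O G -> Ckmx k phi -> Ckmx k (fun t => G (phi t)).
Proof.
move=> oO Ophi dphi; elim: k G => [|k IHk] G hG hphi.
  move=> i j; have cG t : {for phi t, continuous G}.
    by have [_ /(_ [::] isT)] := hG _ (Ophi t).
  have cphi : continuous phi by apply: derivable_continuous => t; have [] := dphi t.
  have cc : continuous (G \o phi) by move=> t; apply: continuous_comp; [exact: cphi|exact: cG].
  by move=> t; apply: (@continuous_comp _ _ _ (G \o phi) (fun A => A i j)); [exact: cc|exact: coord_continuous].
apply: (@Ckmx_derive _ _ _ _ (fun t => jacobian_mx G (phi t) *m phi' t)).
  move=> t; have [dG dE] := C1_differentiable oO (Cr_on_le (ltn0Sn k) hG) (Ophi t).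
  exact: is_derive_curve.
apply: Ckmx_mul => i j.
  have := IHk _ (Cr_on_partial j hG) _ i 0.
  have -> : (fun t => jacobian_mx G (phi t) i j) = fun t => ('D_(basis_cV R j) G (phi t)) i 0.
    by apply/funext => t; rewrite mxE.
  by apply => a b; apply: CkW; exact: hphi.
have [_] := hphi i j; congr (Ck _ _); apply/funext => t.
by rewrite derive1E; have /is_derive_mxP/(_ i j)[_ ->] := dphi t.
Qed.

End Smooth.

(** * Gronwall estimates and bounds uniform along the orbit *)

Section Gronwall.
Variable R : realType.

Lemma nonincreasing_derive (w dw : R -> R) : (forall t : R, is_derive t 1 w (dw t)) ->
  (forall t, dw t <= 0) -> forall x y, x <= y -> w y <= w x.
Proof.
move=> hw dw0 x y xy.
have [|c _ e] := @MVT_segment R w dw x y xy (fun t _ => hw t).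
  by apply: derivable_within_continuous => t _; have [] := hw t.
by rewrite -subr_le0 e mulr_le0_ge0 ?subr_ge0.
Qed.

(** [u] times exp (- C t) decreases and [u] times exp (C t) increases. Both directions are needed,
    since inverses of [Psi] are estimated backwards in time. *)
Lemma gronwall (u du : R -> R) C : (forall t : R, is_derive t 1 u (du t)) ->
  (forall t, `|du t| <= C * u t) -> forall s t, u s <= u t * expR (C * `|s - t|).
Proof.
move=> hu hd s t.
have hw (a r : R) : is_derive r 1 (fun x => u x * expR (x * a)) ((du r + a * u r) * expR (r * a)).
  have he := is_derive_comp_lin (is_derive_expR (r * a)).
  by apply: (is_derive_eq (is_deriveM (hu r) he)); rewrite /GRing.scale /=; ring.
have [ts|/ltW st] := leP t s.
  have := nonincreasing_derive (hw (- C)) _ ts.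
  rewrite ger0_norm ?subr_ge0 // => h.
  have {h} : u s * expR (s * - C) <= u t * expR (t * - C).
    apply: h => r; rewrite mulr_le0_ge0 ?expR_ge0 // mulNr subr_le0.
    exact: le_trans (ler_norm _) (hd r).
  rewrite -(ler_pM2r (expR_gt0 (s * C))) -!mulrA -!expRD mulrN addNr expR0 mulr1.
  by congr (_ <= _ * expR _); ring.
have := @nonincreasing_derive (fun x => - (u x * expR (x * C))) _ _ _ _ _ st.
move=> /(_ (fun r => - ((du r + C * u r) * expR (r * C)))) h.
have {h} : - (u t * expR (t * C)) <= - (u s * expR (s * C)).
  apply: (h (fun r => is_deriveN (hw C r))) => r.
  rewrite oppr_le0 mulr_ge0 ?expR_ge0 // -lerBlDr sub0r.
  by have := hd r; rewrite ler_norml => /andP[].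
rewrite lerN2 -(ler_pM2r (expR_gt0 (s * - C))) -!mulrA -!expRD mulrN subrr expR0 mulr1.
rewrite ler0_norm ?subr_le0 //.
by congr (_ <= _ * expR _); ring.
Qed.

(** Squared Frobenius norm: polynomial in the entries, hence differentiable along curves, unlike the
    sup norm of matrices. *)
Definition sqn m n (X : 'M[R]_(m, n)) : R := \sum_i \sum_j X i j ^+ 2.

Lemma sqn_ge_entry m n (X : 'M[R]_(m, n)) i j : X i j ^+ 2 <= sqn X.
Proof.
rewrite /sqn (bigD1 i) //= (bigD1 j) //= -addrA lerDl addr_ge0 //.
  by apply: sumr_ge0 => k _; rewrite sqr_ge0.
by apply: sumr_ge0 => k _; apply: sumr_ge0 => l _; rewrite sqr_ge0.
Qed.

Lemma sqn0 m n : sqn (0 : 'M[R]_(m, n)) = 0.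
Proof. by rewrite /sqn big1 // => i _; rewrite big1 // => j _; rewrite mxE expr0n. Qed.

Lemma linear_ode_gronwall m n (A : R -> 'M[R]_m) (Y : R -> 'M[R]_(m, n)) (K : R) :
  (forall t i j, `|A t i j| <= K) -> (forall t : R, is_derive t 1 Y (A t *m Y t)) ->
  forall s t, sqn (Y s) <= sqn (Y t) * expR (2 * m%:R * K * `|s - t|).
Proof.
move=> hA hY.
pose du t := \sum_i \sum_j 2 * (Y t i j * (A t *m Y t) i j).
apply: (@gronwall (fun t => sqn (Y t)) du).
  move=> t; have -> : (fun t => sqn (Y t)) = \sum_i (\sum_j (fun s => Y s i j * Y s i j)).
    apply/funext => s; rewrite fct_sumE; apply: eq_bigr => i _.
    by rewrite fct_sumE; apply: eq_bigr => j _; rewrite expr2.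
  apply: is_derive_sum => i; apply: is_derive_sum => j.
  have /is_derive_mxP/(_ i j) h := hY t.
  by apply: (is_derive_eq (is_deriveM h h)); rewrite /GRing.scale /=; ring.
move=> t; set X := Y t.
have -> : du t = \sum_i \sum_j \sum_k 2 * (X i j * (A t i k * X k j)).
  apply: eq_bigr => i _; apply: eq_bigr => j _; rewrite mxE mulr_sumr mulr_sumr.
  by apply: eq_bigr => k _.
(* By 2ab <= a^2 + b^2 a summand is at most [K * (X i j ^+ 2 + X k j ^+ 2)]. Each of the two triple
   sums counts [sqn X] exactly [m] times, whence the rate [2 * m * K]. *)
apply: (@le_trans _ _ (\sum_i \sum_j \sum_k K * (X i j ^+ 2 + X k j ^+ 2))).
  do 3!(rewrite (le_trans (ler_norm_sum _ _ _)) //; apply: ler_sum => ? _).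
  set a := X _ _; set b := X _ _; set c := A _ _ _.
  have hc : `|c| <= K := hA _ _ _.
  rewrite !normrM (ger0_norm (ler0n _ 2)).
  have ab : 2 * (`|a| * `|b|) <= a ^+ 2 + b ^+ 2.
    have := sqr_ge0 (`|a| - `|b|); rewrite sqrrB !real_normK ?num_real //; lra.
  have c0 : 0 <= `|c| by [].
  apply: (@le_trans _ _ (`|c| * (a ^+ 2 + b ^+ 2))).
    rewrite (_ : 2 * _ = `|c| * (2 * (`|a| * `|b|))); last by ring.
    exact: ler_wpM2l.
  by rewrite ler_wpM2r // addr_ge0 ?sqr_ge0.
rewrite (_ : \sum_i _ = 2 * m%:R * K * sqn X) //.
have e1 : \sum_(i < m) \sum_(j < n) \sum_(k < m) X i j ^+ 2 = m%:R * sqn X.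
  rewrite /sqn mulr_sumr; apply: eq_bigr => i _; rewrite mulr_sumr; apply: eq_bigr => j _.
  by rewrite sumr_const card_ord mulr_natl.
have e2 : \sum_(i < m) \sum_(j < n) \sum_(k < m) X k j ^+ 2 = m%:R * sqn X.
  by rewrite sumr_const card_ord mulr_natl /sqn exchange_big.
transitivity (K * (\sum_(i < m) \sum_(j < n) \sum_(k < m) X i j ^+ 2
   + \sum_(i < m) \sum_(j < n) \sum_(k < m) X k j ^+ 2)); last by rewrite e1 e2; ring.
rewrite -big_split mulr_sumr; apply: eq_bigr => i _.
rewrite -big_split mulr_sumr; apply: eq_bigr => j _.
by rewrite -big_split mulr_sumr; apply: eq_bigr => k _.
Qed.

Lemma linear_ode_unique m n (A : R -> 'M[R]_m) (Y : R -> 'M[R]_(m, n)) (K t0 : R) :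
  (forall t i j, `|A t i j| <= K) -> (forall t : R, is_derive t 1 Y (A t *m Y t)) ->
  Y t0 = 0 -> forall s, Y s = 0.
Proof.
move=> hA hY Y0 s; have := linear_ode_gronwall hA hY s t0.
rewrite Y0 sqn0 mul0r => h; apply/matrixP => i j; rewrite mxE; apply/eqP.
by rewrite -sqrf_eq0 eq_le sqr_ge0 andbT (le_trans (sqn_ge_entry _ _ _)).
Qed.

Lemma periodic_bound (h : R -> R) (T K : R) : 0 < T -> (forall t, h (t + T) = h t) ->
  (forall t, 0 <= t <= T -> h t <= K) -> forall t, h t <= K.
Proof.
move=> T0 hT hK t.
have hn (k : nat) s : h (s + k%:R * T) = h s.
  elim: k s => [|k IHk] s; first by rewrite mul0r addr0.
  by rewrite -natr1 mulrDl mul1r addrA hT.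
have := Num.Theory.floor_itv (t / T).
case: (Num.floor _) => k.
  rewrite ler_pdivlMr // ltr_pdivrMr // => /andP[h1 h2].
  rewrite -(subrK (k%:R * T) t) hn; apply: hK; rewrite subr_ge0 h1 /=.
  by move: h2; rewrite intrD mulrDl mul1r => /ltW; rewrite lerBlDl.
rewrite ler_pdivlMr // ltr_pdivrMr // => /andP[h1 h2].
rewrite -(hn k.+1); apply: hK.
move: h1 h2; rewrite NegzE !intrD mulrNz -[k.+1%:~R]/(k.+1%:R : R) mulrDl mulNr mul1r.
by move=> h1 /ltW h2; apply/andP; split; lra.
Qed.

Lemma continuous_bounded_itv (f : R -> R) (T : R) : 0 <= T -> continuous f ->
  exists2 K, 0 <= K & forall t, 0 <= t <= T -> `|f t| <= K.
Proof.
move=> T0 cf.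
have cn : {within `[0, T], continuous (fun t => `|f t|)}.
  apply: continuous_subspaceT => t.
  exact: (continuous_comp (cf t) (@norm_continuous _ _ _)).
have [c cT hc] := EVT_max T0 cn.
by exists `|f c| => // t tT; apply: hc; rewrite in_itv.
Qed.

Lemma continuous_bounded_mx m n (F : R -> 'M[R]_(m, n)) (T : R) : 0 <= T ->
  (forall i j, continuous (fun t => F t i j)) ->
  exists2 K, 0 <= K & forall t i j, 0 <= t <= T -> `|F t i j| <= K.
Proof.
move=> T0 cF.
have /choice[K hK] : forall ij : 'I_m * 'I_n, exists K, 0 <= K /\
    forall t, 0 <= t <= T -> `|F t ij.1 ij.2| <= K.
  by move=> ij; have [K K0 h] := continuous_bounded_itv T0 (cF ij.1 ij.2); exists K.
exists (\sum_ij K ij) => [|t i j tT]; first by apply: sumr_ge0 => ij _; case: (hK ij).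
have [_ /(_ t tT) /= h] := hK (i, j); apply: (le_trans h).
by rewrite (bigD1 (i, j)) //= lerDl; apply: sumr_ge0 => ij _; case: (hK ij).
Qed.

(** Compactness of one period yields a uniform radius, and periodicity spreads it to all times. *)
Lemma orbit_neighborhood n (D : set 'cV[R]_n) (phi : R -> 'cV[R]_n) (T : R) :
  open D -> 0 < T -> continuous phi -> (forall t, D (phi t)) ->
  (forall t, phi (t + T) = phi t) ->
  exists2 e, 0 < e & forall t y, `|y - phi t| < e -> D y.
Proof.
move=> oD T0 cphi Dphi phiT.
have /compact_near_coveringP/(_ R (0 : R)^'+ (fun e t => forall y, `|y - phi t| < e -> D y)) :=
  @segment_compact R 0 T.
move=> h; have {h} : \forall e \near (0 : R)^'+,
    `[0, T]%classic `<=` (fun t => forall y, `|y - phi t| < e -> D y).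
  apply: h => t _.
  have /nbhs_ballP[e /= e0 he] : nbhs (phi t) D by apply: open_nbhs_nbhs.
  have e20 : 0 < e / 2 by rewrite divr_gt0.
  exists ([set t' | `|phi t - phi t'| < e / 2], [set r | r < e / 2]) => /=.
    split; first by move/cvgrPdist_lt : (cphi t) => /(_ _ e20).
    exact: nbhs_right_lt.
  move=> [t' r] /= [ht hr] y hy; apply: he; rewrite -ball_normE /= -(subrKA (phi t')).
  rewrite (le_lt_trans (ler_normD _ _)) // (splitr e) ltrD // distrC.
  exact: lt_trans hy hr.
move=> h; near (0 : R)^'+ => e.
have e0 : 0 < e by near: e; exact: nbhs_right_gt.
have he : `[0, T]%classic `<=` (fun t => forall y, `|y - phi t| < e -> D y) by near: e.
exists e => // t; apply: contrapT => /existsNP[y /not_implyP[hy Dy]].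
(* For a fixed bad point [y], the indicator of closeness to the orbit is periodic and zero on one
   period, hence zero at [t] as well, a contradiction. *)
pose hf (s : R) : R := if `|y - phi s| < e then 1 else 0.
have hfT s : hf (s + T) = hf s by rewrite /hf phiT.
have := @periodic_bound hf T 0 T0 hfT _ t; rewrite {2}/hf hy ler10 => hc.
suff : false by []; apply: hc => s s0T; rewrite /hf; case: ltP => // hs.
by case: Dy; apply: (he s) => //=; rewrite in_itv.
Unshelve. all: by end_near. Qed.

End Gronwall.

(** * Adapted basis *)

Section Basis.
Variable K : fieldType.

Lemma idem_split N r (E : 'M[K]_N) : E *m E = E -> \rank E = r ->
  exists (X : 'M[K]_(N, r)) (Y : 'M[K]_(r, N)), E = X *m Y /\ Y *m X = 1%:M.
Proof.
move=> EE rE; subst r; exists (col_base E), (row_base E).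
rewrite mulmx_base; split => //; apply: (row_free_inj (row_base_free E)).
apply: (row_full_inj (col_base_full E)).
by rewrite mul1mx -mulmxA mulmx_base mulmxA mulmx_base.
Qed.

Lemma rank_idem_compl N (E : 'M[K]_N) : E *m E = E -> \rank (1%:M - E) = (N - \rank E)%N.
Proof.
move=> EE; rewrite -mxrank_ker; apply/eqP; rewrite eqn_leq !mxrankS //.
  apply/row_subP => i; rewrite rowE; set u := delta_mx _ _.
  have -> : u *m kermx E = u *m kermx E *m (1%:M - E).
    by rewrite mulmxBr mulmx1 -mulmxA mulmx_ker mulmx0 subr0.
  exact: submxMl.
by apply/sub_kermxP; rewrite mulmxBl mul1mx EE subrr.
Qed.

Lemma mulmx1C_eq m n (A : 'M[K]_(m, n)) (B : 'M[K]_(n, m)) : m = n ->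
  A *m B = 1%:M -> B *m A = 1%:M.
Proof. by move=> e; subst n; exact: mulmx1C. Qed.

Lemma rank_drop N m (A : 'M[K]_N) (X : 'M[K]_(N, m)) (w : 'cV[K]_m) :
  X *m w != 0 -> A *m (X *m w) = 0 -> (\rank (A *m X) < \rank X)%N.
Proof.
move=> Xw AXw; rewrite -[X in (_ < X)%N]mxrank_tr -(mxrank_mul_ker X^T A^T).
rewrite -trmx_mul mxrank_tr -[X in (X < _)%N]addn0 ltn_add2l lt0n mxrank_eq0.
apply: contraNneq Xw => e.
have : ((X *m w)^T <= (X^T :&: kermx A^T))%MS.
  rewrite sub_capmx trmx_mul submxMl /=; apply/sub_kermxP.
  by rewrite -!trmx_mul AXw trmx0.
by rewrite e submx0 trmx_eq0.
Qed.

(** The rank of [A^i (1 - E)] drops at each of the first [q + 1] steps: its range contains [p], as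
    the image of [A^(q-i) v], and [A] kills [p]. It starts at [N - d]. *)
Lemma chain_length N d q (A E : 'M[K]_N) (v p : 'cV[K]_N) :
  E *m E = E -> \rank E = d -> comm_mx E A -> E *m p = 0 -> p != 0 ->
  A *m p = 0 -> A ^+ q *m v = p -> (q.+1 <= N - d)%N.
Proof.
move=> EE rE EA Ep p0 Ap Aqv.
have cA : comm_mx (1%:M - E) A.
  by apply/comm_mx_sym/comm_mxD; [exact: comm_mx1|apply/comm_mxN/comm_mx_sym].
have cAi i : comm_mx (1%:M - E) (A ^+ i).
  elim: i => [|i IHi]; first by rewrite expr0; exact: comm_mx1.
  by rewrite exprS; apply: comm_mxM.
have h i : (i <= q.+1)%N -> (\rank (A ^+ i *m (1%:M - E)) + i <= N - d)%N.
  elim: i => [_|i IHi iq]; first by rewrite expr0 mul1mx addn0 rank_idem_compl // rE.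
  apply: leq_trans (IHi (ltnW iq)); rewrite addnS ltn_add2r exprS -[_ * _]/(A *m _) -mulmxA.
  have pE : A ^+ i *m (1%:M - E) *m (A ^+ (q - i) *m v) = p.
    rewrite -cAi -mulmxA (mulmxA (A ^+ i)) -[_ *m A ^+ (q - i)]/(_ * _) -exprD subnKC //.
    by rewrite Aqv mulmxBl mul1mx Ep subr0.
  by apply: (rank_drop (w := A ^+ (q - i) *m v)); rewrite pE.
by apply: leq_trans (h _ (leqnn _)); rewrite leq_addl.
Qed.

Lemma dual_vector N (p : 'cV[K]_N) : p != 0 -> exists l : 'rV[K]_N, l *m p = 1%:M.
Proof.
move=> p0; have [i pi] : exists i, p i 0 != 0.
  apply: contrapT => h; move/eqP: p0; apply; apply/colP => i; rewrite mxE; apply/eqP.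
  by apply: contraT => pi; case: h; exists i.
exists ((p i 0)^-1 *: delta_mx 0 i); rewrite -scalemxAl -rowE.
by apply/matrixP => a b; rewrite !mxE !ord1 eqxx mulVf.
Qed.

(** Fredholm alternative: a vector outside the range is detected by a functional on the cokernel. *)
Lemma dual_vector_ann N m (A : 'M[K]_(N, m)) (p : 'cV[K]_N) :
  ~ (exists w, A *m w = p) -> exists l : 'rV[K]_N, l *m p = 1%:M /\ l *m A = 0.
Proof.
move=> h; have : ~~ (p^T <= A^T)%MS.
  apply/negP => /submxP[w e]; apply: h; exists w^T.
  by apply: trmx_inj; rewrite trmx_mul trmxK -e.
rewrite submxE => nz.
have /dual_vector[r hr] : (p^T *m cokermx A^T)^T != 0 by rewrite trmx_eq0.
exists (r *m (cokermx A^T)^T); split.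
  by move: hr; rewrite trmx_mul trmxK mulmxA.
have h0 : (cokermx A^T)^T *m A = 0.
  by apply: trmx_inj; rewrite trmx_mul trmxK mulmx_coker trmx0.
by rewrite -mulmxA h0 mulmx0.
Qed.

(** Column operations bring a single row to its rank normal form, leaving at most one nonzero entry,
    in first position. *)
Lemma row_normal_form k (l : 'rV[K]_k) : exists G : 'M[K]_k,
  G \in unitmx /\ forall j : 'I_k, (0 < j)%N -> (l *m G) 0 j = 0.
Proof.
exists (invmx (row_ebase l)); rewrite unitmx_inv row_ebase_unit; split => // j j0.
rewrite -{1}(mulmx_ebase l) mulmxK ?row_ebase_unit // mxE big_ord1 !mxE.
by rewrite (_ : (ord0 : 'I_1) == j :> nat = false) ?mulr0 //; case: (nat_of_ord j) j0.
Qed.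

(** The idempotents [p *m l], [P1] and [Po] split the space, and [Q] joins bases of the ranges of
    the last two. Since [B] commutes with [Po] and [l] kills its range, all couplings with that
    range vanish; as [B] kills [p], the only coupling left is the row [l *m B *m Q1], which becomes
    [L]. *)
Lemma floquet_basis N d k (Po B : 'M[K]_N) (p : 'cV[K]_N) (l : 'rV[K]_N) :
  N = (1 + (k + d))%N -> Po *m Po = Po -> \rank Po = d -> comm_mx Po B ->
  Po *m p = 0 -> B *m p = 0 -> l *m p = 1%:M -> l *m Po = 0 ->
  exists (Q : 'M[K]_(N, k + d)) (Ki : 'M[K]_(1 + (k + d), N))
    (H1 : 'M[K]_k) (H2 : 'M[K]_d) (L : 'rV[K]_k),
  [/\ row_mx p Q *m Ki = 1%:M, Ki *m row_mx p Q = 1%:M,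
      B *m Q = p *m row_mx L 0 + Q *m block_mx H1 0 0 H2,
      Po *m Q = Q *m block_mx 0 0 0 1%:M &
      (l *m B = 0 -> L = 0) /\ forall j : 'I_k, (0 < j)%N -> L 0 j = 0].
Proof.
move=> eN Po2 rPo PoB Pop Bp lp lPo.
have [X2 [Y2 [PoE YX2]]] := idem_split Po2 rPo.
pose P1 := 1%:M - (Po + p *m l).
have E2 : (Po + p *m l) *m (Po + p *m l) = Po + p *m l.
  rewrite mulmxDl !mulmxDr Po2 mulmxA Pop mul0mx addr0 -mulmxA lPo mulmx0 add0r.
  by rewrite -!mulmxA (mulmxA l) lp mul1mx.
have rE : \rank (Po + p *m l)%R = (d + 1)%N.
  have -> : Po + p *m l = row_mx X2 p *m col_mx Y2 l by rewrite mul_row_col PoE.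
  apply: rank_split_idem; rewrite mul_col_row YX2 lp.
  have Y2E : Y2 = Y2 *m Po by rewrite PoE mulmxA YX2 mul1mx.
  have X2E : X2 = Po *m X2 by rewrite PoE -mulmxA YX2 mulmx1.
  by rewrite {1}Y2E {1}X2E -mulmxA Pop mulmx0 mulmxA lPo mul0mx -scalar_mx_block.
have P12 : P1 *m P1 = P1.
  by rewrite /P1 mulmxBr mulmx1 mulmxBl mul1mx E2 subrr subr0.
have rP1 : \rank P1 = k by rewrite /P1 rank_idem_compl // rE eN; lia.
have PoP1 : Po *m P1 = 0.
  by rewrite /P1 mulmxBr mulmx1 mulmxDr Po2 mulmxA Pop mul0mx addr0 subrr.
have P1Po : P1 *m Po = 0.
  by rewrite /P1 mulmxBl mul1mx mulmxDl Po2 -mulmxA lPo mulmx0 addr0 subrr.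
have [X1 [Y1 [P1E YX1]]] := idem_split P12 rP1.
(* [G] changes the basis only inside the range of [P1], so the splitting is kept while the row is
   normalized. *)
have [G [Gu LG]] := row_normal_form (l *m B *m X1).
pose Q1 := X1 *m G; pose Z1 := invmx G *m Y1.
have QZ : Q1 *m Z1 = P1 by rewrite /Q1 /Z1 mulmxA mulmxK.
pose Q := row_mx Q1 X2; pose Ki := col_mx l (col_mx Z1 Y2).
have KK : row_mx p Q *m Ki = 1%:M.
  rewrite /Q /Ki !mul_row_col QZ -PoE /P1; rewrite addrC -addrA [Po + _]addrC subrK //.
have KKi := mulmx1C_eq eN KK.
have X2E : X2 = Po *m X2 by rewrite PoE -mulmxA YX2 mulmx1.
have Q1E : Q1 = P1 *m Q1 by rewrite /Q1 P1E mulmxA -(mulmxA X1) YX1 mulmx1.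
have PoQ1 : Po *m Q1 = 0 by rewrite Q1E mulmxA PoP1 mul0mx.
exists Q, Ki, (Z1 *m B *m Q1), (Y2 *m B *m X2), (l *m B *m Q1); split => //.
- have -> : B *m Q = row_mx p Q *m (Ki *m (B *m Q)) by rewrite mulmxA KK mul1mx.
  have -> : Ki *m (B *m Q) = col_mx (row_mx (l *m B *m Q1) 0) (block_mx (Z1 *m B *m Q1) 0 0 (Y2 *m B *m X2)).
    have lBX2 : l *m (B *m X2) = 0 by rewrite X2E (mulmxA B) -PoB -mulmxA mulmxA lPo mul0mx.
    have Y1Po : Y1 *m Po = 0 by rewrite -[Y1]mul1mx -YX1 -(mulmxA Y1) -P1E -mulmxA P1Po mulmx0.
    have Z1Po : Z1 *m Po = 0 by rewrite /Z1 -mulmxA Y1Po mulmx0.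
    have Z1BX2 : Z1 *m (B *m X2) = 0.
      by rewrite X2E (mulmxA B) -PoB -(mulmxA Po) (mulmxA Z1) Z1Po mul0mx.
    have Y2BQ1 : Y2 *m (B *m Q1) = 0.
      have -> : Y2 = Y2 *m Po by rewrite PoE mulmxA YX2 mul1mx.
      by rewrite -mulmxA (mulmxA Po) PoB -mulmxA PoQ1 !mulmx0.
    by rewrite /Ki /Q mul_mx_row mul_col_mx !mul_col_mx !mul_mx_row lBX2 Z1BX2 Y2BQ1 /block_mx !mulmxA.
  by rewrite mul_row_col.
- rewrite /Q mul_mx_row PoQ1 -X2E mul_row_block !mulmx0 !addr0 add0r mulmx1.
  by [].
split=> [lB|j j0]; first by rewrite lB mul0mx.
by rewrite /Q1 mulmxA LG.
Qed.

(** Stated for two sizes with a proof of equality, because [n.+1] and [1 + (k + d)] are not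
    convertible. *)
Lemma char_poly_similar_eq m n (A : 'M[K]_m) (A' : 'M[K]_n) (V : 'M[K]_(m, n))
    (W : 'M[K]_(n, m)) : m = n -> V *m W = 1%:M -> A *m V = V *m A' ->
  char_poly A = char_poly A'.
Proof.
move=> e; subst n => VW AV; have [Vu _] := mulmx1_unit VW.
have WE : W = invmx V by rewrite -[W](mulKmx Vu) VW mulmx1.
by rewrite -(char_poly_conj A' Vu) -AV mulmxK.
Qed.

Lemma char_poly_ublock m n (A : 'M[K]_m) (C : 'M[K]_(m, n)) (B : 'M[K]_n) :
  char_poly (block_mx A C 0 B) = char_poly A * char_poly B.
Proof.
rewrite /char_poly -(det_ublock _ (- map_mx polyC C)); congr (\det _).
by rewrite /char_poly_mx map_block_mx map_mx0 scalar_mx_block opp_block_mx add_block_mx oppr0 addr0 add0r.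
Qed.

Lemma char_poly_mx0 : char_poly (0 : 'M[K]_1) = 'X.
Proof. by rewrite /char_poly /char_poly_mx map_mx0 subr0 det_scalar1. Qed.

Lemma root_char_poly_fix N (A : 'M[K]_N) (p : 'cV[K]_N) a :
  A *m p = a *: p -> p != 0 -> root (char_poly A) a.
Proof.
move=> Ap p0; have -> : char_poly A = char_poly A^T.
  rewrite /char_poly -det_tr; congr (\det _); apply/matrixP => i j.
  by rewrite !mxE eq_sym.
rewrite -eigenvalue_root_char; apply/eigenvalueP; exists p^T; last by rewrite trmx_eq0.
by rewrite -trmx_mul Ap linearZ.
Qed.

End Basis.

(** * Normal form near the orbit *)

Section LittleO.
Variable R : realType.

Definition small_o m (W : normedModType R) (F : 'cV[R]_m -> W) :=
  forall e : R, 0 < e -> exists2 d : R, 0 < d & forall x, `|x| < d -> `|F x| <= e * `|x|.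

Lemma small_o_vanish m (W : normedModType R) (F : 'cV[R]_m -> W) :
  small_o F -> vanish_order2_at0 F.
Proof.
move=> hF; have F0 : F 0 = 0.
  have [d d0 h] := hF 1 ltr01.
  by apply/eqP; rewrite -normr_le0 (le_trans (h 0 _)) ?normr0 ?mulr0.
have [||dF dE] := @differentiable_bound R _ _ F 0 \0.
- exact: (@cst_continuous _ _ (0 : W)).
- move=> e e0; have [d d0 h] := hF e e0; apply/nbhs_ballP; exists d => // x.
  by rewrite -ball_normE /= sub0r normrN => xd; rewrite addr0 F0 add0r subr0; apply: h.
by split => // h; rewrite dE.
Qed.

Lemma small_o_le m (V W : normedModType R) (F : 'cV[R]_m -> V) (G : 'cV[R]_m -> W) (C r : R) :
  0 < r -> small_o F -> (forall x, `|x| < r -> `|G x| <= C * `|F x|) -> small_o G.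
Proof.
move=> r0 hF hG e e0; have C1 : 0 < `|C| + 1 by rewrite ltr_wpDl.
have [d d0 h] := hF (e / (`|C| + 1)) (divr_gt0 e0 C1).
exists (Num.min d r) => [|x]; first by rewrite lt_min d0.
rewrite lt_min => /andP[xd xr]; apply: (le_trans (hG x xr)).
apply: (@le_trans _ _ ((`|C| + 1) * `|F x|)).
  by rewrite ler_wpM2r // (le_trans (ler_norm C)) // lerDl.
by rewrite mulrC -ler_pdivlMr // mulrAC h.
Qed.

Lemma small_oD m (W : normedModType R) (F G : 'cV[R]_m -> W) :
  small_o F -> small_o G -> small_o (fun x => F x + G x).
Proof.
move=> hF hG e e0; have e20 : 0 < e / 2 by rewrite divr_gt0.
have [d d0 h] := hF _ e20; have [d' d'0 h'] := hG _ e20.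
exists (Num.min d d') => [|x]; first by rewrite lt_min d0.
rewrite lt_min => /andP[/h xd /h' xd']; rewrite (le_trans (ler_normD _ _)) //.
by rewrite (splitr e) mulrDl lerD.
Qed.

Lemma small_o_quadratic m (W : normedModType R) (F : 'cV[R]_m -> W) (C r : R) : 0 < r ->
  (forall x, `|x| < r -> `|F x| <= C * `|x| ^+ 2) -> small_o F.
Proof.
move=> r0 hF e e0; have C1 : 0 < `|C| + 1 by rewrite ltr_wpDl.
exists (Num.min r (e / (`|C| + 1))) => [|x]; first by rewrite lt_min r0 divr_gt0.
rewrite lt_min => /andP[xr xe]; apply: (le_trans (hF x xr)).
rewrite expr2 mulrA ler_wpM2r //.
apply: (@le_trans _ _ ((`|C| + 1) * `|x|)).
  by rewrite ler_wpM2r // (le_trans (ler_norm C)) // lerDl.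
by rewrite mulrC -ler_pdivlMr // ltW.
Qed.

Lemma differentiable_small_o m p (G : 'cV[R]_m -> 'cV[R]_p) (A : 'M[R]_(p, m)) z :
  differentiable G z -> (forall h, 'd G z h = A *m h) ->
  small_o (fun h => G (z + h) - (G z + A *m h)).
Proof.
move=> dG dE e e0.
have /eqaddoP/(_ e e0) := diff_locally dG.
move=> /nbhs_ballP[d /= d0 h]; exists d => // x xd.
have := h x; rewrite -ball_normE /= sub0r normrN => /(_ xd).
by rewrite !fctE /= dE [x + z]addrC.
Qed.

Lemma usubmx_norm m p (z : 'cV[R]_(m + p)) : `|usubmx z| <= `|z|.
Proof. by apply: mx_norm_le => // i j; rewrite mxE mx_norm_entry. Qed.

Lemma dsubmx_norm m p (z : 'cV[R]_(m + p)) : `|dsubmx z| <= `|z|.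
Proof. by apply: mx_norm_le => // i j; rewrite mxE mx_norm_entry. Qed.

End LittleO.

(** * Solving for the new velocities in a moving frame *)

Section NormalForm.
Variables (R : realType) (N m : nat).
Variables (a : 'cV[R]_N) (U U1 : 'M[R]_(N, m)) (Ki : 'M[R]_(1 + m, N)).

(* With [Ki] the inverse of [row_mx a U], these solve [s' *: (a + U1 *m x) + U *m x' = v]
   for [s'] and [x'] as long as [1 + (cpart x) 0 0] does not vanish. *)
Definition cpart (x : 'cV[R]_m) : 'cV[R]_(1 + m) := Ki *m (U1 *m x).
Definition sdot (x : 'cV[R]_m) (v : 'cV[R]_N) : R :=
  (usubmx (Ki *m v)) 0 0 / (1 + (usubmx (cpart x)) 0 0).
Definition xdot (x : 'cV[R]_m) (v : 'cV[R]_N) : 'cV[R]_m :=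
  dsubmx (Ki *m v) - sdot x v *: dsubmx (cpart x).

Lemma sdotD x v w : sdot x (v + w) = sdot x v + sdot x w.
Proof. by rewrite /sdot mulmxDr [usubmx _]linearD /= mxE mulrDl. Qed.

Lemma xdotD x v w : xdot x (v + w) = xdot x v + xdot x w.
Proof.
by rewrite /xdot sdotD mulmxDr linearD /= scalerDl opprD addrACA.
Qed.

Hypothesis KKi : row_mx a U *m Ki = 1%:M.
Hypothesis KiK : Ki *m row_mx a U = 1%:M.

Lemma frame_decomp (v : 'cV[R]_N) :
  v = (usubmx (Ki *m v)) 0 0 *: a + U *m dsubmx (Ki *m v).
Proof.
rewrite -{1}[v]mul1mx -KKi -mulmxA -{1}[Ki *m v]vsubmxK mul_row_col; congr (_ + _).
by rewrite [usubmx _]mx11_scalar mul_mx_scalar !mxE.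
Qed.

Lemma sdot_xdot_solve x v : 1 + (usubmx (cpart x)) 0 0 != 0 ->
  sdot x v *: (a + U1 *m x) + U *m xdot x v = v.
Proof.
move=> nz; rewrite [RHS]frame_decomp {1}(frame_decomp (U1 *m x)) -/(cpart x).
rewrite /xdot mulmxBr -scalemxAr addrA scalerDr scalerDr scalerA.
rewrite addrA -scalerDl -[X in (X + _) *: _]mulr1 -mulrDr {1}/sdot divfK //.
by rewrite addrAC addrK.
Qed.

Lemma cpart_norm x : `|cpart x| <= N%:R * `|Ki| * (m%:R * `|U1| * `|x|).
Proof. by apply: (le_trans (mulmx_norm _ _)); rewrite ler_wpM2l ?mulr_ge0 ?mulmx_norm. Qed.

(** The denominator of [sdot] is at least 1/2, which gives the factor 2. For [xdot] the bound is
    [kap] plus half of [2 * kap]. *)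
Lemma sdot_xdot_bound x v (kap : R) : N%:R * `|Ki| <= kap -> `|cpart x| <= 2^-1 ->
  `|sdot x v| <= 2 * kap * `|v| /\ `|xdot x v| <= 2 * kap * `|v|.
Proof.
move=> hk hc.
have hy : `|Ki *m v| <= kap * `|v|.
  by apply: (le_trans (mulmx_norm _ _)); rewrite ler_wpM2r.
have hc0 : `|(usubmx (cpart x)) 0 0| <= 2^-1.
  by apply: le_trans (mx_norm_entry _ _ _) _; apply: le_trans (usubmx_norm _) hc.
have hden : 2^-1 <= `|1 + (usubmx (cpart x)) 0 0|.
  have := lerB_dist 1 (- (usubmx (cpart x)) 0 0); rewrite opprK normrN normr1; lra.
have h1 : `|sdot x v| <= 2 * kap * `|v|.
  rewrite /sdot normrM normfV ler_pdivrMr; last by apply: lt_le_trans hden.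
  have : `|(usubmx (Ki *m v)) 0 0| <= kap * `|v|.
    by apply: le_trans (mx_norm_entry _ _ _) _; apply: le_trans (usubmx_norm _) hy.
  move=> yk; have k0 : 0 <= kap * `|v| by apply: le_trans hy.
  apply: (le_trans yk); rewrite -(mulrA 2 kap) mulrAC [leRHS]mulrC ler_peMr //; lra.
split => //; rewrite /xdot (le_trans (ler_normB _ _)) // normrZ.
have h2 : `|dsubmx (cpart x)| <= 2^-1 by apply: le_trans (dsubmx_norm _) hc.
have h3 : `|dsubmx (Ki *m v)| <= kap * `|v| by apply: le_trans (dsubmx_norm _) hy.
have := ler_pM (normr_ge0 _) (normr_ge0 _) h1 h2; move: h3; lra.
Qed.

Variables (A : 'M[R]_N) (Lr : 'rV[R]_m) (H : 'M[R]_m).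
Hypothesis U1E : U1 = A *m U - a *m Lr - U *m H.
Variables (f : 'cV[R]_N -> 'cV[R]_N) (z : 'cV[R]_N).
Hypotheses (fz : f z = a) (df : differentiable f z) (dfE : forall h, 'd f z h = A *m h).

Let rho x := Ki *m (f (z + U *m x) - (a + A *m (U *m x))).

Lemma KiaU (s : R) (u : 'cV[R]_m) : Ki *m (s *: a + U *m u) = col_mx s%:M u.
Proof.
have -> : s *: a + U *m u = row_mx a U *m col_mx s%:M u.
  by rewrite mul_row_col mul_mx_scalar.
by rewrite mulmxA KiK mul1mx.
Qed.

Lemma rho_small_o : small_o rho.
Proof.
have h := differentiable_small_o df dfE.
have C0 : 0 <= m%:R * `|U| :> R by rewrite mulr_ge0.
have C1 : 0 < m%:R * `|U| + 1 :> R by rewrite ltr_wpDl.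
have Ux (x : 'cV[R]_m) : `|U *m x| <= (m%:R * `|U| + 1) * `|x|.
  by apply: (le_trans (mulmx_norm _ _)); rewrite ler_wpM2r // lerDl.
pose G x := f (z + U *m x) - (a + A *m (U *m x)).
have hG : small_o G.
  move=> e e0; have [d d0 hd] := h (e / (m%:R * `|U| + 1)) (divr_gt0 e0 C1).
  exists (d / (m%:R * `|U| + 1)) => [|x]; first exact: divr_gt0.
  rewrite ltr_pdivlMr // mulrC => xd.
  have := hd _ (le_lt_trans (Ux x) xd); rewrite fz => /le_trans; apply.
  by rewrite mulrAC ler_pdivrMr // -mulrA ler_wpM2l ?(ltW e0) // mulrC.
by apply: (small_o_le (C := N%:R * `|Ki|) ltr01 hG) => x _; exact: mulmx_norm.
Qed.

Lemma cpartE x : cpart x = Ki *m (A *m (U *m x)) - col_mx (Lr *m x) (H *m x).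
Proof.
have e : (Lr *m x) 0 0 *: a + U *m (H *m x) = a *m (Lr *m x) + U *m (H *m x).
  by rewrite {2}[Lr *m x]mx11_scalar mul_mx_scalar.
rewrite /cpart U1E !mulmxBl -!mulmxA -addrA -opprD -e mulmxBr KiaU; congr (_ - col_mx _ _).
by rewrite -mx11_scalar.
Qed.

(** [rho] is the Taylor remainder in frame coordinates. Eliminating [A] through the equation for
    [U1] shows that, apart from [Lr] and [H], the linear part of the field is exactly [cpart], the
    part that the moving frame absorbs. *)
Lemma Ki_f x : Ki *m f (z + U *m x) =
  rho x + col_mx 1%:M 0 + cpart x + col_mx (Lr *m x) (H *m x).
Proof.
have Kia : Ki *m a = col_mx 1%:M 0.
  by have := KiaU 1 0; rewrite scale1r mulmx0 addr0.
rewrite cpartE /rho mulmxBr mulmxDr Kia -addrA subrK.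
by rewrite -addrA subrK.
Qed.

(** With [c = cpart x], substitution gives sdot - 1 - L x = (rho_0 - c_0 L x) / (1 + c_0) and xdot -
    H x = rho_1 - (sdot - 1) c_1. Each term is a Taylor remainder or a product of two quantities of
    first order. *)
Lemma normal_form_small_o :
  small_o (fun x => sdot x (f (z + U *m x)) - 1 - (Lr *m x) 0 0 : R) /\
  small_o (fun x => xdot x (f (z + U *m x)) - H *m x).
Proof.
pose C := N%:R * `|Ki| * (m%:R * `|U1|) : R.
have C0 : 0 <= C by rewrite !mulr_ge0.
have hc x : `|cpart x| <= C * `|x| by rewrite -mulrA; apply: cpart_norm.
pose CL := m%:R * `|Lr| : R; have CL0 : 0 <= CL by rewrite mulr_ge0.
have hL x : `|(Lr *m x) 0 0| <= CL * `|x|.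
  by apply: le_trans (mx_norm_entry _ _ _) _; exact: mulmx_norm.
(* This radius ensures |c_0| <= 1/2; the added 1 keeps it meaningful when [C = 0]. *)
pose r : R := (2 * (C + 1))^-1.
have r0 : 0 < r by rewrite invr_gt0 mulr_gt0 // ltr_wpDl.
have hc0 x : `|(usubmx (cpart x)) 0 0| <= C * `|x|.
  by apply: le_trans (mx_norm_entry _ _ _) _; apply: le_trans (usubmx_norm _) (hc x).
have hden x : `|x| < r -> 2^-1 <= `|1 + (usubmx (cpart x)) 0 0|.
  rewrite /r -[(_ * _)^-1]mul1r ltr_pdivlMr; last by rewrite mulr_gt0 // ltr_wpDl.
  move=> xr; have := lerB_dist 1 (- (usubmx (cpart x)) 0 0); rewrite opprK normrN normr1.
  have := hc0 x; have : 0 <= `|x| by []; nra.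
have y0 x : (usubmx (Ki *m f (z + U *m x))) 0 0 =
    (usubmx (rho x)) 0 0 + 1 + (usubmx (cpart x)) 0 0 + (Lr *m x) 0 0.
  by rewrite Ki_f !linearD /= !col_mxKu !mxE eqxx.
have y1 x : dsubmx (Ki *m f (z + U *m x)) = dsubmx (rho x) + dsubmx (cpart x) + H *m x.
  by rewrite Ki_f !linearD /= !col_mxKd addr0.
have s0E x : 1 + (usubmx (cpart x)) 0 0 != 0 ->
    sdot x (f (z + U *m x)) - 1 - (Lr *m x) 0 0 =
    ((usubmx (rho x)) 0 0 - (usubmx (cpart x)) 0 0 * (Lr *m x) 0 0)
      / (1 + (usubmx (cpart x)) 0 0).
  move=> nz; rewrite /sdot y0; apply: (mulIf nz); rewrite !mulrBl !divfK //; ring.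
have nz x : `|x| < r -> 1 + (usubmx (cpart x)) 0 0 != 0.
  by move=> /hden h; rewrite -normr_gt0; apply: lt_le_trans h.
have o_rho0 : small_o (fun x => (usubmx (rho x)) 0 0 : R).
  apply: (small_o_le (C := 1) ltr01 rho_small_o) => x _; rewrite mul1r.
  by apply: le_trans (mx_norm_entry _ _ _) _; apply: usubmx_norm.
have o_quad : small_o (fun x => - ((usubmx (cpart x)) 0 0 * (Lr *m x) 0 0) : R).
  apply: (small_o_quadratic (C := C * CL) ltr01) => x _.
  by rewrite normrN normrM expr2 mulrACA ler_pM.
have o1 : small_o (fun x => sdot x (f (z + U *m x)) - 1 - (Lr *m x) 0 0 : R).
  apply: (small_o_le (C := 2) r0 (small_oD o_rho0 o_quad)) => x xr.
  rewrite s0E ?nz // normrM normfV ler_pdivrMr; last by apply: lt_le_trans (hden x xr).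
  have := hden x xr; have : 0 <= `|(usubmx (rho x)) 0 0 - (usubmx (cpart x)) 0 0 * (Lr *m x) 0 0| by [].
  by move: (`|_ - _|) (`|1 + _|) => u v u0 v0; nra.
split => //.
have x1E x : xdot x (f (z + U *m x)) - H *m x = dsubmx (rho x) +
    - ((sdot x (f (z + U *m x)) - 1) *: dsubmx (cpart x)).
  rewrite /xdot y1 scalerBl scale1r opprB addrAC addrK.
  by rewrite -!addrA; congr (_ + _); rewrite addrC addrA.
have o_rho1 : small_o (fun x => dsubmx (rho x)).
  by apply: (small_o_le (C := 1) ltr01 rho_small_o) => x _; rewrite mul1r dsubmx_norm.
have [d1 d10 hd1] := o1 1 ltr01.
have o_q : small_o (fun x => - ((sdot x (f (z + U *m x)) - 1) *: dsubmx (cpart x))).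
  apply: (small_o_quadratic (C := (1 + CL) * C) d10) => x xd.
  rewrite normrN normrZ expr2 mulrACA ler_pM //; last by apply: le_trans (dsubmx_norm _) (hc x).
  rewrite -[X in `|X|](subrK ((Lr *m x) 0 0)) (le_trans (ler_normD _ _)) //.
  by rewrite mulrDl lerD ?hd1.
have := small_oD o_rho1 o_q; congr (small_o _).
by apply/funext => x; rewrite x1E.
Qed.

End NormalForm.

Section Twist.
Variables (R : realType) (N m : nat) (S : 'M[R]_m).
Variables (U1 : 'M[R]_(N, m)) (Ki : 'M[R]_(1 + m, N)).

Let Sh : 'M[R]_(1 + m) := block_mx 1%:M 0 0 S.

Lemma usubmx_twist (w : 'cV[R]_(1 + m)) : usubmx (Sh *m w) = usubmx w.
Proof. by rewrite -{1}[w]vsubmxK mul_block_col !mul0mx addr0 mul1mx col_mxKu. Qed.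

Lemma dsubmx_twist (w : 'cV[R]_(1 + m)) : dsubmx (Sh *m w) = S *m dsubmx w.
Proof. by rewrite -{1}[w]vsubmxK mul_block_col !mul0mx add0r col_mxKd. Qed.

Lemma cpart_twist x : cpart (U1 *m S) (Sh *m Ki) x = Sh *m cpart U1 Ki (S *m x).
Proof. by rewrite /cpart !mulmxA. Qed.

(** Over one period the frame derivative becomes [U1 *m S] and the coframe [Sh *m Ki]. As [Sh] fixes
    the first coordinate and acts by [S] on the others, [x] is merely replaced by [S *m x]: the
    source of (iii) and (iv). *)
Lemma sdot_twist x v : sdot (U1 *m S) (Sh *m Ki) x v = sdot U1 Ki (S *m x) v.
Proof. by rewrite /sdot cpart_twist -mulmxA !usubmx_twist. Qed.

Lemma xdot_twist x v : xdot (U1 *m S) (Sh *m Ki) x v = S *m xdot U1 Ki (S *m x) v.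
Proof.
by rewrite /xdot sdot_twist cpart_twist -mulmxA !dsubmx_twist mulmxBr -scalemxAr.
Qed.

End Twist.

(** * The variational equation along the orbit *)

Section Variational.
Variables (R : realType) (n r : nat) (D : set 'cV[R]_n) (f : 'cV[R]_n -> 'cV[R]_n).
Variables (T : R) (phi : R -> 'cV[R]_n) (Psi : R -> 'M[R]_n).
Hypotheses (oD : open D) (r2 : (2 <= r)%N) (hf : Cr_on r D f) (T0 : 0 < T).
Hypotheses (Dphi : forall t, D (phi t)) (phiT : forall t, phi (t + T) = phi t).
Hypothesis hphi : forall t, derivable phi t 1 /\ derive1 phi t = f (phi t).
Hypothesis hPsi : forall t,
  derivable Psi t 1 /\ derive1 Psi t = jacobian_mx f (phi t) *m Psi t.
Hypothesis Psi0 : Psi 0 = 1%:M.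

Let A t := jacobian_mx f (phi t).

Lemma phi_is_derive (t : R) : is_derive t 1 phi (f (phi t)).
Proof. by have [dp ep] := hphi t; split => //; rewrite -derive1E. Qed.

Lemma Psi_is_derive (t : R) : is_derive t 1 Psi (A t *m Psi t).
Proof. by have [dp ep] := hPsi t; split => //; rewrite -derive1E. Qed.

Lemma f_differentiable t :
  differentiable f (phi t) /\ forall h, 'd f (phi t) h = A t *m h.
Proof. by apply: (C1_differentiable oD) => //; apply: Cr_on_le hf; apply: leq_trans r2. Qed.

Lemma f_phi_is_derive (t : R) : is_derive t 1 (fun s => f (phi s)) (A t *m f (phi t)).
Proof.
by have [dG dE] := f_differentiable t; apply: is_derive_curve => //; exact: phi_is_derive.
Qed.

Lemma phi_Ck k : (k <= r.+1)%N -> Ckmx k phi.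
Proof.
elim: k => [_|k IHk kr].
  move=> i j; apply: derivable_continuous => t.
  by have /is_derive_mxP/(_ i j)[] := phi_is_derive t.
apply: (Ckmx_derive phi_is_derive); apply: (Ckmx_curve oD Dphi phi_is_derive).
  exact: Cr_on_le hf.
by apply: IHk; apply: ltnW.
Qed.

Lemma A_Ck : Ckmx r.-1 A.
Proof.
have hfr : Cr_on r.-1.+1 D f by rewrite prednK // (leq_trans _ r2).
move=> i j; have -> : (fun t => A t i j) = fun t => ('D_(basis_cV R j) f (phi t)) i 0.
  by apply/funext => t; rewrite mxE.
apply: (Ckmx_curve oD Dphi phi_is_derive (Cr_on_partial j hfr)).
by apply: phi_Ck; lia.
Qed.

Lemma Psi_Ck : Ckmx r Psi.
Proof.
have := Ckmx_linear_ode Psi_is_derive A_Ck; rewrite prednK //.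
exact: leq_trans r2.
Qed.

Lemma A_bounded : exists K : R, forall t i j, `|A t i j| <= K.
Proof.
have cA i j : continuous (fun t => A t i j) by apply: Ck_continuous; exact: A_Ck.
have [K K0 hK] := continuous_bounded_mx (ltW T0) cA; exists K => t i j.
apply: (@periodic_bound _ (fun s => `|A s i j|) T K T0) => [s|s sT]; last exact: hK.
by rewrite /A phiT.
Qed.

Lemma is_derive_shift_mx m p (F F' : R -> 'M[R]_(m, p)) (a : R) :
  (forall t : R, is_derive t 1 F (F' t)) ->
  forall t : R, is_derive t 1 (fun s => F (s + a)) (F' (t + a)).
Proof.
move=> hF t; apply/is_derive_mxP => i j; have /is_derive_mxP/(_ i j) h := hF (t + a).
have hs : is_derive t 1 (fun s : R => s + a) (1 : R).
  by apply: (is_derive_eq (is_deriveD (is_derive_id t 1) (is_derive_cst a t 1))); rewrite addr0.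
have := @is_derive1_comp R (fun s => F s i j) (fun s : R => s + a) t _ _ h hs.
by rewrite mulr1.
Qed.

Lemma variational_unique p (Y : R -> 'M[R]_(n, p)) (t0 : R) :
  (forall t : R, is_derive t 1 Y (A t *m Y t)) -> Y t0 = 0 -> forall s, Y s = 0.
Proof. by have [K hK] := A_bounded; exact: (linear_ode_unique hK). Qed.

Lemma Psi_mul_is_derive p (X : 'M[R]_(n, p)) (t : R) :
  is_derive t 1 (fun s => Psi s *m X) (A t *m (Psi t *m X)).
Proof.
apply: (is_derive_eq (is_derive_mulmx (Psi_is_derive t) (is_derive_cstmx X t))).
by rewrite mulmx0 addr0 mulmxA.
Qed.

(** The velocity solves the variational equation, so uniqueness identifies it with the transported
    initial velocity. *)
Lemma f_phiE t : f (phi t) = Psi t *m f (phi 0).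
Proof.
apply/eqP; rewrite -subr_eq0; apply/eqP.
apply: (@variational_unique _ (fun s => f (phi s) - Psi s *m f (phi 0)) 0).
  move=> s; apply: (is_derive_eq (is_deriveB (f_phi_is_derive s) (Psi_mul_is_derive _ s))).
  by rewrite mulmxBr.
by rewrite Psi0 mul1mx subrr.
Qed.

Lemma Psi_shift t : Psi (t + T) = Psi t *m Psi T.
Proof.
apply/eqP; rewrite -subr_eq0; apply/eqP.
apply: (@variational_unique _ (fun s => Psi (s + T) - Psi s *m Psi T) 0).
  move=> s; have h := is_derive_shift_mx T Psi_is_derive s.
  apply: (is_derive_eq (is_deriveB h (Psi_mul_is_derive _ s))).
  by rewrite mulmxBr /A phiT.
by rewrite add0r Psi0 mul1mx subrr.
Qed.

Lemma Psi_unit t : Psi t \in unitmx.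
Proof.
rewrite unitmxE unitfE -det_tr; apply/det0P => -[v v0 vP].
have Pv : Psi t *m v^T = 0 by apply: trmx_inj; rewrite trmx_mul trmxK trmx0.
have := variational_unique (@Psi_mul_is_derive _ v^T) Pv 0; rewrite Psi0 mul1mx.
by move=> /eqP; rewrite trmx_eq0 (negbTE v0).
Qed.

(** [Psi t *m invmx (Psi s)], as a function of [t], is a solution equal to 1 at [t = s]; Gronwall
    run back to [t = 0] bounds [invmx (Psi s)]. *)
Lemma Psi_inv_bounded : exists2 C : R, 0 <= C & forall s, 0 <= s <= T -> `|invmx (Psi s)| <= C.
Proof.
have [K hK] := A_bounded; pose c := 2 * n%:R * `|K| : R.
have hK' t i j : `|A t i j| <= `|K| by apply: le_trans (ler_norm K).
(* The added 1 comes from |x| <= x^2 + 1, which passes from squares of entries to the entries. *)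
pose C := sqn (1%:M : 'M[R]_n) * expR (c * T) + 1.
have s0 : 0 <= sqn (1%:M : 'M[R]_n).
  by apply: sumr_ge0 => i _; apply: sumr_ge0 => j _; rewrite sqr_ge0.
have C0 : 0 <= C by rewrite addr_ge0 // mulr_ge0 ?expR_ge0.
exists C => // s /andP[hs0 sT]; apply: mx_norm_le => // i j.
have := linear_ode_gronwall hK' (@Psi_mul_is_derive _ (invmx (Psi s))) 0 s.
rewrite Psi0 mul1mx mulmxV ?Psi_unit // sub0r normrN (ger0_norm hs0) => h.
have h2 : sqn (1%:M : 'M[R]_n) * expR (c * s) <= C - 1.
  by rewrite /C addrK ler_wpM2l // ler_expR ler_wpM2l // !mulr_ge0.
have := sqn_ge_entry (invmx (Psi s)) i j.
have := sqr_ge0 (`|invmx (Psi s) i j| - 1).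
rewrite sqrrB real_normK ?num_real // expr1n mulr1 => h3 h4.
have h5 := le_trans h4 (le_trans h h2); have : 0 <= `|invmx (Psi s) i j| by [].
have : 0 <= (invmx (Psi s) i j) ^+ 2 by rewrite sqr_ge0.
by move: h3 h5; rewrite -mulr_natl; lra.
Qed.

Lemma monodromy_fix : Psi T *m f (phi 0) = f (phi 0).
Proof. by rewrite -f_phiE -[T in LHS]add0r phiT. Qed.

(** A velocity vanishing at time 0 stays zero under transport by [Psi], so the orbit would be
    constant. *)
Lemma orbit_velocity_neq0 : (exists t, phi t != phi 0) -> f (phi 0) != 0.
Proof.
move=> [t nt]; apply: contra_neq nt => p0; apply/eqP; rewrite -subr_eq0; apply/eqP.
have hA (s : R) (i j : 'I_n) : `|(0 : 'M[R]_n) i j| <= 0 by rewrite mxE normr0.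
apply: (@linear_ode_unique _ _ _ (fun=> 0) (fun s => phi s - phi 0) 0 0 hA).
  move=> s; apply: (is_derive_eq (is_deriveB (phi_is_derive s) (is_derive_cstmx (phi 0) s))).
  by rewrite f_phiE p0 mulmx0 mul0mx subr0.
by rewrite subrr.
Qed.

End Variational.

(** * Group laws of exp (s B) from its differential equation *)

Section Flow.
Variables (R : realType) (n : nat) (B : 'M[R]_n) (E : R -> 'M[R]_n).
Hypotheses (E0 : E 0 = 1%:M) (dE : forall s : R, is_derive s 1 E (B *m E s)).
Hypothesis BE : forall s, comm_mx B (E s).

Lemma const_ode_unique p (C : 'M[R]_n) (Y : R -> 'M[R]_(n, p)) :
  (forall t : R, is_derive t 1 Y (C *m Y t)) -> Y 0 = 0 -> forall s, Y s = 0.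
Proof.
move=> hY Y0; apply: (@linear_ode_unique _ _ _ (fun=> C) Y `|C| 0) => // t i j.
exact: mx_norm_entry.
Qed.

Lemma flow_opp_is_derive (s : R) : is_derive s 1 (fun t => E (- t)) (- B *m E (- s)).
Proof.
apply/is_derive_mxP => i j; have /is_derive_mxP/(_ i j) h := dE (- s).
have := @is_derive1_comp R (fun t => E t i j) (fun t : R => - t) s _ _ h (is_deriveNid s 1).
by rewrite mulNmx [in X in _ -> X]mxE mulrN1.
Qed.

Lemma flow_inv s : E s *m E (- s) = 1%:M.
Proof.
apply/eqP; rewrite -subr_eq0; apply/eqP.
apply: (@const_ode_unique _ 0 (fun s => E s *m E (- s) - 1%:M)).
  move=> t; have h := is_derive_mulmx (dE t) (flow_opp_is_derive t).
  apply: (is_derive_eq (is_deriveB h (is_derive_cstmx 1%:M t))).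
  by rewrite mulNmx mulmxN mulmxA -(BE t) subrr subr0 mul0mx.
by rewrite oppr0 E0 mulmx1 subrr.
Qed.

Lemma flow_opp_add (a s : R) : E (- (s + a)) = E (- s) *m E (- a).
Proof.
apply/eqP; rewrite -subr_eq0; apply/eqP.
apply: (@const_ode_unique _ (- B) (fun s => E (- (s + a)) - E (- s) *m E (- a))).
  move=> t; have h1 := is_derive_shift_mx a flow_opp_is_derive t.
  have h2 := is_derive_mulmx (flow_opp_is_derive t) (is_derive_cstmx (E (- a)) t).
  apply: (is_derive_eq (is_deriveB h1 h2)).
  by rewrite mulmx0 addr0 mulmxBr mulmxA.
by rewrite add0r oppr0 E0 mul1mx subrr.
Qed.

Lemma flow_opp_fix (p : 'cV[R]_n) s : B *m p = 0 -> E (- s) *m p = p.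
Proof.
move=> Bp; apply/eqP; rewrite -subr_eq0; apply/eqP.
apply: (@const_ode_unique _ (- B) (fun s => E (- s) *m p - p)).
  move=> t; have h := is_derive_mulmx (flow_opp_is_derive t) (is_derive_cstmx p t).
  apply: (is_derive_eq (is_deriveB h (is_derive_cstmx p t))).
  by rewrite mulmx0 addr0 subr0 mulmxBr [- B *m p]mulNmx Bp oppr0 subr0 mulmxA.
by rewrite oppr0 E0 mul1mx subrr.
Qed.

Lemma norm_bounded_itv m p (F : R -> 'M[R]_(m, p)) (T : R) : 0 <= T ->
  (forall i j, continuous (fun t => F t i j)) ->
  exists2 K, 0 <= K & forall t, 0 <= t <= T -> `|F t| <= K.
Proof.
move=> T0 /(continuous_bounded_mx T0)[K K0 hK]; exists K => // t tT.
by apply: mx_norm_le => // i j; apply: hK.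
Qed.

End Flow.

(** The root 1 of [q] has exponent ln 1 / T = 0, the real part of the root 0 that the factor ['X]
    adds. The two may sit at different positions, so removing both matches the lists only up to
    permutation. *)
Lemma spectrum_remove (R : realType) (T : R) (ms bs : seq R[i]) (q h : {poly R[i]}) :
  root q 1 -> q = \prod_(m <- ms) ('X - m%:P) ->
  'X * h = \prod_(b <- bs) ('X - b%:P) ->
  [seq @complex.Re R b | b <- bs] = [seq ln (@complex.Re R `|m|) / T | m <- ms] ->
  exists lam mu : seq R[i],
    [/\ q = ('X - 1%:P) * \prod_(l <- lam) ('X - l%:P),
        h = \prod_(m <- mu) ('X - m%:P) &
        perm_eq [seq @complex.Re R m | m <- mu] [seq ln (@complex.Re R `|l|) / T | l <- lam]].
Proof.
move=> q1 qE hE e.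
have m1 : 1 \in ms by move: q1; rewrite qE root_prod_XsubC.
have b0 : 0 \in bs by rewrite -root_prod_XsubC -hE rootM rootX eqxx.
have pm := perm_to_rem m1; have pb := perm_to_rem b0.
exists (rem 1 ms), (rem 0 bs); split.
- by rewrite qE (perm_big _ pm) big_cons.
- have X0 : ('X : {poly R[i]}) != 0 by rewrite polyX_eq0.
  by apply: (mulfI X0); rewrite hE (perm_big _ pb) big_cons polyC0 subr0.
rewrite -(perm_cons 0).
have f1 : ln (@complex.Re R `|1 : R[i]|) / T = 0 by rewrite normr1 /= ln1 mul0r.
have p1 := perm_map (@complex.Re R) pb.
have p2 := perm_map (fun m => ln (@complex.Re R `|m|) / T) pm.
have {}p2 : perm_eq [seq ln (@complex.Re R `|m|) / T | m <- ms]
    (0 :: [seq ln (@complex.Re R `|m|) / T | m <- rem 1 ms]) by rewrite -f1.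
by move: p1; rewrite e perm_sym => /perm_trans/(_ p2).
Qed.

(** * The Floquet frame and the transformed system *)

Section FrameNormalForm.
Variables (R : realType) (n r : nat) (D : set 'cV[R]_n.+1).
Variables (f : 'cV[R]_n.+1 -> 'cV[R]_n.+1) (g : R -> 'cV[R]_n.+1 -> 'cV[R]_n.+1).
Variables (T : R) (phi : R -> 'cV[R]_n.+1) (Psi : R -> 'M[R]_n.+1).
Hypotheses (oD : open D) (r2 : (2 <= r)%N) (hf : Cr_on r D f) (T0 : 0 < T).
Hypotheses (Dphi : forall t, D (phi t)) (phiT : forall t, phi (t + T) = phi t).
Hypothesis hphi : forall t, derivable phi t 1 /\ derive1 phi t = f (phi t).
Hypothesis hPsi : forall t,
  derivable Psi t 1 /\ derive1 Psi t = jacobian_mx f (phi t) *m Psi t.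
Hypothesis Psi0 : Psi 0 = 1%:M.
Variables (k d : nat) (Po B : 'M[R]_n.+1) (E : R -> 'M[R]_n.+1).
Hypothesis PoE : forall s, comm_mx Po (E s).
Hypotheses (E0 : E 0 = 1%:M) (dE : forall s : R, is_derive s 1 E (B *m E s)).
Hypotheses (BE : forall s, comm_mx B (E s)) (ME : Psi T = (1%:M - 2 *: Po) *m E T).
Hypotheses (Bp : B *m f (phi 0) = 0).
Variables (Q : 'M[R]_(n.+1, k + d)) (Ki : 'M[R]_(1 + (k + d), n.+1)).
Variables (H1 : 'M[R]_k) (H2 : 'M[R]_d) (L : 'rV[R]_k).
Hypotheses (KKi : row_mx (f (phi 0)) Q *m Ki = 1%:M).
Hypotheses (KiK : Ki *m row_mx (f (phi 0)) Q = 1%:M).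
Hypotheses (BQ : B *m Q = f (phi 0) *m row_mx L 0 + Q *m block_mx H1 0 0 H2).
Hypotheses (PoQ : Po *m Q = Q *m block_mx 0 0 0 1%:M).

Let A t := jacobian_mx f (phi t).
Let S2 : 'M[R]_(k + d) := block_mx 1%:M 0 0 (- 1%:M).
Let Lr : 'rV[R]_(k + d) := row_mx L 0.
Let Hm : 'M[R]_(k + d) := block_mx H1 0 0 H2.

(* Floquet normal form [Psi s = U s *m exp (s B)] restricted to the complement of the
   velocity; [dframe] is its derivative, computed from [B *m Q = f (phi 0) *m Lr + Q *m Hm]. *)
Definition frame s := Psi s *m E (- s) *m Q.
Definition dframe s := A s *m frame s - f (phi s) *m Lr - frame s *m Hm.
Definition coframe s := Ki *m E s *m invmx (Psi s).

Let Psi_der := Psi_is_derive hPsi.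
Let Psiu := Psi_unit oD r2 hf T0 Dphi phiT hphi hPsi Psi0.
Let fphi := f_phiE oD r2 hf T0 Dphi phiT hphi hPsi Psi0.
Let Eopp := flow_opp_is_derive dE.
Let EN s : E s *m E (- s) = 1%:M := flow_inv E0 dE BE s.

Lemma flow_inv_l s : E (- s) *m E s = 1%:M.
Proof. exact: mulmx1C (EN s). Qed.

Lemma velocityE s : Psi s *m E (- s) *m f (phi 0) = f (phi s).
Proof. by rewrite -mulmxA (flow_opp_fix E0 dE) // -fphi. Qed.

Lemma frame_is_derive (s : R) : is_derive s 1 frame (dframe s).
Proof.
have h := is_derive_mulmx (is_derive_mulmx (Psi_der s) (Eopp s)) (is_derive_cstmx Q s).
apply: (is_derive_eq h); rewrite mulmx0 addr0 mulmxDl mulNmx BE.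
have -> : Psi s *m - (E (- s) *m B) *m Q = - (Psi s *m E (- s) *m (B *m Q)).
  by rewrite mulmxN mulNmx !mulmxA.
have -> : Psi s *m E (- s) *m (B *m Q) = f (phi s) *m Lr + frame s *m Hm.
  by rewrite BQ mulmxDr !mulmxA velocityE.
by rewrite opprD addrA /dframe /frame /A !mulmxA.
Qed.

Lemma frame_Ck : Ckmx r frame.
Proof.
apply: Ckmx_mul; last exact: Ckmx_cst.
apply: Ckmx_mul; first exact: (Psi_Ck oD r2 hf T0 Dphi hphi hPsi).
have h : Ckmx r.-1.+1 (fun s => E (- s)).
  by apply: (Ckmx_linear_ode Eopp); exact: Ckmx_cst.
by rewrite prednK // in h; apply: leq_trans r2.
Qed.

Lemma S2K : S2 *m S2 = 1%:M.
Proof.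
by rewrite /S2 mulmx_block !mulmx0 !mul0mx !addr0 add0r mulmx1 mulNmx mulmxN mulmx1 opprK -scalar_mx_block.
Qed.

Lemma S2Hm : S2 *m Hm = Hm *m S2.
Proof.
by rewrite /S2 /Hm !mulmx_block !mulmx0 !mul0mx !addr0 !add0r mulmx1 mul1mx mulNmx mulmxN mulmx1 mul1mx.
Qed.

Lemma LrS2 : Lr *m S2 = Lr.
Proof. by rewrite /Lr /S2 mul_row_block !mul0mx !mulmx0 !addr0 mulmx1. Qed.

(** [E (- T)] cancels the factor [E T] of the monodromy matrix; the remaining [1 - 2 Po] commutes
    past [E (- s)] and acts on [Q] as [S2]. *)
Lemma frame_twist s : frame (s + T) = frame s *m S2.
Proof.
rewrite /frame (Psi_shift oD r2 hf T0 Dphi phiT hphi hPsi Psi0) addrC.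
rewrite (flow_opp_add E0 dE) ME.
have -> : Psi s *m ((1%:M - 2 *: Po) *m E T) *m (E (- T) *m E (- s)) *m Q =
    Psi s *m (1%:M - 2 *: Po) *m (E T *m E (- T)) *m E (- s) *m Q by rewrite !mulmxA.
rewrite EN mulmx1.
have cS : (1%:M - 2 *: Po) *m E (- s) = E (- s) *m (1%:M - 2 *: Po).
  by rewrite mulmxBl mulmxBr mul1mx mulmx1 -scalemxAl -scalemxAr PoE.
have SQ : (1%:M - 2 *: Po) *m Q = Q *m S2.
  rewrite mulmxBl mul1mx -scalemxAl PoQ -[Q in Q - _]mulmx1 scalemxAr -mulmxBr.
  congr (_ *m _); rewrite /S2 scalar_mx_block scale_block_mx opp_block_mx add_block_mx.
  rewrite !scaler0 !subr0; congr block_mx.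
  by apply/matrixP => i j; rewrite !mxE; ring.
by rewrite -(mulmxA (Psi s)) cS -!mulmxA SQ.
Qed.

Lemma frame_row s : row_mx (f (phi s)) (frame s) = Psi s *m E (- s) *m row_mx (f (phi 0)) Q.
Proof. by rewrite mul_mx_row velocityE. Qed.

Lemma frame_coframe s : row_mx (f (phi s)) (frame s) *m coframe s = 1%:M.
Proof.
rewrite frame_row /coframe.
have -> : Psi s *m E (- s) *m row_mx (f (phi 0)) Q *m (Ki *m E s *m invmx (Psi s)) =
   Psi s *m (E (- s) *m (row_mx (f (phi 0)) Q *m Ki) *m E s) *m invmx (Psi s).
  by rewrite !mulmxA.
by rewrite KKi mulmx1 flow_inv_l mulmx1 mulmxV // Psiu.
Qed.

Lemma coframe_frame s : coframe s *m row_mx (f (phi s)) (frame s) = 1%:M.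
Proof.
rewrite frame_row /coframe.
have -> : Ki *m E s *m invmx (Psi s) *m (Psi s *m E (- s) *m row_mx (f (phi 0)) Q) =
   Ki *m (E s *m (invmx (Psi s) *m Psi s) *m E (- s)) *m row_mx (f (phi 0)) Q.
  by rewrite !mulmxA.
by rewrite mulVmx ?Psiu // mulmx1 EN mulmx1 KiK.
Qed.

Let Sh : 'M[R]_(1 + (k + d)) := block_mx 1%:M 0 0 S2.

Lemma ShK : Sh *m Sh = 1%:M.
Proof. by rewrite /Sh mulmx_block !mulmx0 !mul0mx !addr0 !add0r mulmx1 S2K -scalar_mx_block. Qed.

Lemma frame_row_twist s :
  row_mx (f (phi (s + T))) (frame (s + T)) = row_mx (f (phi s)) (frame s) *m Sh.
Proof. by rewrite /Sh mul_row_block !mulmx0 addr0 add0r mulmx1 phiT frame_twist. Qed.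

Lemma coframe_twist s : coframe (s + T) = Sh *m coframe s.
Proof.
have h := coframe_frame (s + T); rewrite frame_row_twist in h.
have h2 : coframe (s + T) *m row_mx (f (phi s)) (frame s) = Sh.
  by rewrite -[LHS]mulmx1 -ShK mulmxA -[X in X *m Sh]mulmxA h mul1mx.
by rewrite -h2 -mulmxA frame_coframe mulmx1.
Qed.

Lemma dframe_twist s : dframe (s + T) = dframe s *m S2.
Proof.
rewrite /dframe /A phiT frame_twist !mulmxBl -(mulmxA _ S2 Hm) S2Hm -(mulmxA _ Lr) LrS2.
by rewrite !mulmxA.
Qed.

(** The coframe is periodic only up to the involution [Sh], but [|coframe s| + |Sh *m coframe s|] is
    truly periodic, so a bound over one period suffices. *)
Lemma coframe_bounded : exists2 C : R, 0 <= C & forall s, `|coframe s| <= C.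
Proof.
have cE i j : continuous (fun t => E t i j).
  by apply: derivable_continuous => t; have /is_derive_mxP/(_ i j)[] := dE t.
have [CE CE0 hCE] := norm_bounded_itv (ltW T0) cE.
have [CP CP0 hCP] := Psi_inv_bounded oD r2 hf T0 Dphi phiT hphi hPsi Psi0.
pose C := n.+1%:R * (n.+1%:R * `|Ki| * CE) * CP.
have C0 : 0 <= C by rewrite !mulr_ge0.
have hC s : 0 <= s <= T -> `|coframe s| <= C.
  move=> sT; apply: (le_trans (mulmx_norm _ _)).
  rewrite /C ler_pM ?mulr_ge0 ?hCP // ler_wpM2l //.
  by apply: (le_trans (mulmx_norm _ _)); rewrite ler_wpM2l ?mulr_ge0 ?hCE.
pose C' := C + (1 + (k + d))%:R * `|Sh| * C.
exists C' => [|s]; first by rewrite addr_ge0 ?mulr_ge0.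
apply: (@le_trans _ _ (`|coframe s| + `|Sh *m coframe s|)); first by rewrite lerDl.
apply: (@periodic_bound _ (fun s => `|coframe s| + `|Sh *m coframe s|) T C' T0) => [t|t tT].
  by rewrite coframe_twist mulmxA ShK mul1mx addrC.
rewrite lerD ?hC // (le_trans (mulmx_norm _ _)) //.
by rewrite ler_wpM2l ?mulr_ge0 ?hC.
Qed.

Lemma twist_bounded (F : R -> 'M[R]_(n.+1, k + d)) :
  (forall i j, continuous (fun t => F t i j)) -> (forall s, F (s + T) = F s *m S2) ->
  exists2 C : R, 0 <= C & forall s, `|F s| <= C.
Proof.
move=> cF FT; have [C C0 hC] := norm_bounded_itv (ltW T0) cF.
pose C' := C + (k + d)%:R * C * `|S2|.
exists C' => [|s]; first by rewrite addr_ge0 ?mulr_ge0.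
apply: (@le_trans _ _ (`|F s| + `|F s *m S2|)); first by rewrite lerDl.
apply: (@periodic_bound _ (fun s => `|F s| + `|F s *m S2|) T C' T0) => [t|t tT].
  by rewrite FT -mulmxA S2K mulmx1 addrC.
rewrite lerD ?hC // (le_trans (mulmx_norm _ _)) //.
by rewrite ler_wpM2r // ler_wpM2l ?hC.
Qed.

Lemma frame_bounded : exists2 C : R, 0 <= C & forall s, `|frame s| <= C.
Proof. by apply: twist_bounded frame_twist => i j; exact: Ck_continuous (frame_Ck i j). Qed.

Lemma dframe_bounded : exists2 C : R, 0 <= C & forall s, `|dframe s| <= C.
Proof.
apply: twist_bounded dframe_twist => i j.
have := frame_Ck i j; rewrite -(prednK (ltnW r2)) => -[_ h].
have -> : (fun t => dframe t i j) = derive1 (fun t => frame t i j).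
  apply/funext => t; rewrite derive1E.
  by have /is_derive_mxP/(_ i j)[_ ->] := frame_is_derive t.
exact: Ck_continuous h.
Qed.

Lemma small_tube : exists kap delta : R,
  [/\ 0 < delta, 0 < kap, forall s, n.+1%:R * `|coframe s| <= kap &
      forall s x, `|x| < delta ->
        D (phi s + frame s *m x) /\ `|cpart (dframe s) (coframe s) x| <= 2^-1].
Proof.
have cphi : continuous phi by apply: derivable_continuous => t; have [] := hphi t.
have [e e0 he] := orbit_neighborhood oD T0 cphi Dphi phiT.
have [CK CK0 hCK] := coframe_bounded.
have [CU CU0 hCU] := frame_bounded.
have [CD CD0 hCD] := dframe_bounded.
(* [a] controls how far [frame s *m x] leaves the orbit, and [b] forces [cpart] below 1/2. The added
   ones keep all three constants positive when the bounds vanish. *)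
pose kap := n.+1%:R * CK + 1; pose a := (k + d)%:R * CU + 1.
pose b := 2 * (kap * ((k + d)%:R * CD) + 1).
have kap0 : 0 < kap by rewrite ltr_wpDl ?mulr_ge0.
have a0 : 0 < a by rewrite ltr_wpDl ?mulr_ge0.
have b0 : 0 < b by rewrite mulr_gt0 // ltr_wpDl ?mulr_ge0 // ltW.
have hk s : n.+1%:R * `|coframe s| <= kap.
  by rewrite /kap (le_trans (ler_wpM2l _ (hCK s))) // lerDl.
exists kap, (Num.min (e / a) (b^-1)); split => //.
  by rewrite lt_min divr_gt0 // invr_gt0.
move=> s x; rewrite lt_min => /andP[xe xb]; split.
  apply: (he s); rewrite addrC addKr (le_lt_trans (mulmx_norm _ _)) //.
  apply: (@le_lt_trans _ _ (a * `|x|)).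
    rewrite ler_wpM2r // /a (le_trans (ler_wpM2l _ (hCU s))) // lerDl //.
  by rewrite mulrC -ltr_pdivlMr.
apply: (le_trans (cpart_norm _ _ _)).
have h1 : (k + d)%:R * `|dframe s| * `|x| <= (k + d)%:R * CD * `|x|.
  by rewrite ler_wpM2r // ler_wpM2l.
apply: (@le_trans _ _ (kap * ((k + d)%:R * CD * `|x|))).
  by rewrite ler_pM ?mulr_ge0.
move: xb; rewrite -[b^-1]mul1r ltr_pdivlMr // /b mulrA => xb.
by have : 0 <= `|x| by []; nra.
Qed.

Let SD s x v := sdot (dframe s) (coframe s) x v.
Let XD s x v := xdot (dframe s) (coframe s) x v.
Let Z s x := phi s + frame s *m x.

Definition Lam0 s (v : 'cV[R]_k) (w : 'cV[R]_d) : R :=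
  SD s (col_mx v w) (f (Z s (col_mx v w))) - 1 - (L *m v) 0 0.
Definition Lam1 s (v : 'cV[R]_k) (w : 'cV[R]_d) : 'cV[R]_k :=
  usubmx (XD s (col_mx v w) (f (Z s (col_mx v w)))) - H1 *m v.
Definition Lam2 s (v : 'cV[R]_k) (w : 'cV[R]_d) : 'cV[R]_d :=
  dsubmx (XD s (col_mx v w) (f (Z s (col_mx v w)))) - H2 *m w.
Definition tLam0 t s (v : 'cV[R]_k) (w : 'cV[R]_d) : R :=
  SD s (col_mx v w) (g t (Z s (col_mx v w))).
Definition tLam1 t s (v : 'cV[R]_k) (w : 'cV[R]_d) : 'cV[R]_k :=
  usubmx (XD s (col_mx v w) (g t (Z s (col_mx v w)))).
Definition tLam2 t s (v : 'cV[R]_k) (w : 'cV[R]_d) : 'cV[R]_d :=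
  dsubmx (XD s (col_mx v w) (g t (Z s (col_mx v w)))).

Lemma Lam_vanish s :
  vanish_order2_at0 (fun x : 'cV[R]_(k + d) => Lam0 s (usubmx x) (dsubmx x)) /\
  vanish_order2_at0 (fun x : 'cV[R]_(k + d) => Lam1 s (usubmx x) (dsubmx x)) /\
  vanish_order2_at0 (fun x : 'cV[R]_(k + d) => Lam2 s (usubmx x) (dsubmx x)).
Proof.
have [dfs dfE] := f_differentiable oD r2 hf Dphi s.
have [h0 h1] := normal_form_small_o (coframe_frame s)
  (erefl : dframe s = A s *m frame s - f (phi s) *m Lr - frame s *m Hm) (erefl (f (phi s))) dfs dfE.
have LE x : Lr *m x = L *m usubmx x.
  by rewrite -{1}[x]vsubmxK mul_row_col mul0mx addr0.
have HE x : Hm *m x = col_mx (H1 *m usubmx x) (H2 *m dsubmx x).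
  by rewrite -{1}[x]vsubmxK mul_block_col !mul0mx addr0 add0r.
split; last split; apply: small_o_vanish.
- move: h0; congr (small_o _); apply/funext => x.
  by rewrite /Lam0 /SD /Z vsubmxK LE.
- apply: (small_o_le (C := 1) ltr01 h1) => x _; rewrite mul1r /Lam1 /XD /Z vsubmxK.
  have -> : H1 *m usubmx x = usubmx (Hm *m x) by rewrite HE col_mxKu.
  by rewrite -linearB usubmx_norm.
- apply: (small_o_le (C := 1) ltr01 h1) => x _; rewrite mul1r /Lam2 /XD /Z vsubmxK.
  have -> : H2 *m dsubmx x = dsubmx (Hm *m x) by rewrite HE col_mxKd.
  by rewrite -linearB dsubmx_norm.
Qed.

Lemma S2_col (v : 'cV[R]_k) (w : 'cV[R]_d) : S2 *m col_mx v w = col_mx v (- w).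
Proof. by rewrite /S2 mul_block_col !mul0mx addr0 add0r mul1mx mulNmx mul1mx. Qed.

Lemma Z_twist s v w : Z (s + T) (col_mx v w) = Z s (col_mx v (- w)).
Proof. by rewrite /Z phiT frame_twist -mulmxA S2_col. Qed.

Lemma SD_twist s v w y : SD (s + T) (col_mx v w) y = SD s (col_mx v (- w)) y.
Proof. by rewrite /SD dframe_twist coframe_twist sdot_twist S2_col. Qed.

Lemma XD_twist s v w y : XD (s + T) (col_mx v w) y =
  col_mx (usubmx (XD s (col_mx v (- w)) y)) (- dsubmx (XD s (col_mx v (- w)) y)).
Proof.
by rewrite /XD dframe_twist coframe_twist xdot_twist S2_col -{1}[xdot _ _ _ _]vsubmxK S2_col.
Qed.

Lemma Lam_twist t s v w :
  [/\ Lam0 (s + T) v w = Lam0 s v (- w), tLam0 t (s + T) v w = tLam0 t s v (- w),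
      Lam1 (s + T) v w = Lam1 s v (- w) & tLam1 t (s + T) v w = tLam1 t s v (- w)] /\
  Lam2 (s + T) v w = - Lam2 s v (- w) /\ tLam2 t (s + T) v w = - tLam2 t s v (- w).
Proof.
rewrite /Lam0 /tLam0 /Lam1 /tLam1 /Lam2 /tLam2 Z_twist !SD_twist !XD_twist !col_mxKu !col_mxKd.
by split => //; split => //; rewrite mulmxN opprD opprK.
Qed.

Lemma normal_form_equation t s v w :
  1 + (usubmx (cpart (dframe s) (coframe s) (col_mx v w))) 0 0 != 0 ->
  let x := col_mx v w in
  (1 + (L *m v) 0 0 + Lam0 s v w + tLam0 t s v w) *: (f (phi s) + dframe s *m x)
    + frame s *m col_mx (H1 *m v + Lam1 s v w + tLam1 t s v w)
                        (H2 *m w + Lam2 s v w + tLam2 t s v w)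
  = f (Z s x) + g t (Z s x).
Proof.
move=> nz x; rewrite -[RHS](sdot_xdot_solve (frame_coframe s) _ nz) sdotD xdotD.
have -> : 1 + (L *m v) 0 0 + Lam0 s v w + tLam0 t s v w =
    sdot (dframe s) (coframe s) x (f (Z s x)) + sdot (dframe s) (coframe s) x (g t (Z s x)).
  by rewrite /Lam0 /tLam0 /SD -/x; ring.
suff -> : col_mx (H1 *m v + Lam1 s v w + tLam1 t s v w) (H2 *m w + Lam2 s v w + tLam2 t s v w) =
    xdot (dframe s) (coframe s) x (f (Z s x)) + xdot (dframe s) (coframe s) x (g t (Z s x)) by [].
rewrite /Lam1 /Lam2 /tLam1 /tLam2 /XD -/x !subrKC.
by rewrite -[RHS]vsubmxK !linearD.
Qed.

Lemma tLam_bounded (kap : R) t s v w :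
  n.+1%:R * `|coframe s| <= kap -> `|cpart (dframe s) (coframe s) (col_mx v w)| <= 2^-1 ->
  [/\ `|tLam0 t s v w| <= 2 * kap * `|g t (Z s (col_mx v w))|,
      `|tLam1 t s v w| <= 2 * kap * `|g t (Z s (col_mx v w))| &
      `|tLam2 t s v w| <= 2 * kap * `|g t (Z s (col_mx v w))|].
Proof.
move=> hk hc; have [h1 h2] := sdot_xdot_bound (g t (Z s (col_mx v w))) hk hc.
split => //; apply: le_trans h2; first exact: usubmx_norm.
exact: dsubmx_norm.
Qed.

End FrameNormalForm.

(** In the basis [(p, Q)] the matrix [B] is block upper triangular, and the direction [p], which it
    kills, contributes the factor ['X]. *)
Lemma char_poly_floquet_block (R : realType) n k d (B : 'M[R]_n.+1) (p : 'cV[R]_n.+1)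
    (Q : 'M[R]_(n.+1, k + d)) (Ki : 'M[R]_(1 + (k + d), n.+1)) (Lr : 'rV[R]_(k + d))
    (H : 'M[R]_(k + d)) :
  n.+1 = (1 + (k + d))%N -> row_mx p Q *m Ki = 1%:M -> B *m p = 0 ->
  B *m Q = p *m Lr + Q *m H ->
  'X * char_poly (map_mx (real_complex R) H) = char_poly (map_mx (real_complex R) B).
Proof.
move=> eN KKi Bp BQ; pose c := real_complex R.
have VW : row_mx (map_mx c p) (map_mx c Q) *m map_mx c Ki = 1%:M.
  by rewrite -map_row_mx -map_mxM KKi map_mx1.
have -> : char_poly (map_mx c B) = char_poly (block_mx 0 (map_mx c Lr) 0 (map_mx c H)).
  apply: (char_poly_similar_eq eN VW).
  rewrite mul_row_block !mulmx0 addr0 mul_mx_row -!map_mxM Bp BQ map_mx0.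
  by rewrite map_mxD !map_mxM.
by rewrite char_poly_ublock char_poly_mx0.
Qed.

Unset Implicit Arguments.

Theorem theoremC (R : realType) (n r : nat) (D : set 'cV[R]_n) (I : set R)
  (f : 'cV[R]_n -> 'cV[R]_n) (g : R -> 'cV[R]_n -> 'cV[R]_n)
  (T : R) (phi : R -> 'cV[R]_n) (Psi : R -> 'M[R]_n) (d q0 : nat) :
  open D -> is_interval I -> (2 <= r)%N ->
  Cr_on r D f ->
  (* g is C^r on I x D (i.e. extends to a C^r map on an open set containing
     I x D), g viewed as a function of (t, z) in R^(1+n) *)
  (exists O : set 'cV[R]_(1 + n),
      [/\ open O, (forall y, I (usubmx y 0 0) -> D (dsubmx y) -> O y) &
          Cr_on r O (fun y => g (usubmx y 0 0) (dsubmx y))]) ->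
  (* phi is a non-trivial T-periodic orbit of z' = f(z) *)
  0 < T ->
  (forall t, D (phi t)) ->
  (forall t, derivable phi t 1 /\ derive1 phi t = f (phi t)) ->
  (forall t, phi (t + T) = phi t) ->
  (exists t, phi t != phi 0) ->
  (* Psi is the principal fundamental matrix of y' = Df(phi(t)) y *)
  (forall t, derivable Psi t 1 /\ derive1 Psi t = jacobian_mx f (phi t) *m Psi t) ->
  Psi 0 = 1%:M ->
  (* d is the A-index of the variational equation *)
  is_A_index (Psi T) d ->
  (* q0 is the largest q with (Psi(T) - I)^q v = phi'(0) solvable *)
  (exists v : 'cV[R]_n, (Psi T - 1%:M) ^+ q0 *m v = derive1 phi 0) ->
  (forall q : nat, (exists v : 'cV[R]_n, (Psi T - 1%:M) ^+ q *m v = derive1 phi 0) ->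
      (q <= q0)%N) ->
  (q0 <= n - d - 1)%N /\
  exists (U : R -> 'M[R]_(n, n - d - 1 + d))
         (H1 : 'M[R]_(n - d - 1)) (H2 : 'M[R]_d) (L : 'rV[R]_(n - d - 1))
         (Lam0 : R -> 'cV[R]_(n - d - 1) -> 'cV[R]_d -> R)
         (Lam1 : R -> 'cV[R]_(n - d - 1) -> 'cV[R]_d -> 'cV[R]_(n - d - 1))
         (Lam2 : R -> 'cV[R]_(n - d - 1) -> 'cV[R]_d -> 'cV[R]_d)
         (tLam0 : R -> R -> 'cV[R]_(n - d - 1) -> 'cV[R]_d -> R)
         (tLam1 : R -> R -> 'cV[R]_(n - d - 1) -> 'cV[R]_d -> 'cV[R]_(n - d - 1))
         (tLam2 : R -> R -> 'cV[R]_(n - d - 1) -> 'cV[R]_d -> 'cV[R]_d)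
         (delta : R),
  (
   (* U is C^r with the twisted periodicity *)
   Cr_R r U /\
   (forall t, U (t + T) = U t *m block_mx 1%:M 0 0 (- 1%:M)) /\
   (* z = phi(s) + U(s)[v;w] is a change of variables near the orbit, and it
      transforms the perturbed system into the stated form *)
   0 < delta /\
   (forall s, \rank (row_mx (derive1 phi s) (U s)) = n) /\
   (forall (t s : R) (v : 'cV[R]_(n - d - 1)) (w : 'cV[R]_d),
      I t -> `|col_mx v w| < delta ->
      let x := col_mx v w in
      let Z := phi s + U s *m x in
      let sdot := 1 + (L *m v) 0 0 + Lam0 s v w + tLam0 t s v w in
      let vdot := H1 *m v + Lam1 s v w + tLam1 t s v w in
      let wdot := H2 *m w + Lam2 s v w + tLam2 t s v w in
      D Z /\
      sdot *: (derive1 phi s + derive1 U s *m x) + U s *m col_mx vdot wdot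
        = f Z + g t Z) /\
   (* (i) real parts of eigenvalues of H1 (+) H2 are (1/T) log |lambda_l|,
      lambda_l the eigenvalues of Psi(T) with one copy of 1 removed *)
   (exists lam mu : seq R[i],
     [/\ char_poly (map_mx (fun x : R => (x%:C)%C) (Psi T))
           = ('X - 1%:P) * \prod_(l <- lam) ('X - l%:P),
         char_poly (map_mx (fun x : R => (x%:C)%C) (block_mx H1 0 0 H2))
           = \prod_(m <- mu) ('X - m%:P) &
         perm_eq [seq @complex.Re R m | m <- mu] [seq ln (@complex.Re R `|l|) / T | l <- lam]]) /\
   (* (ii) *)
   (forall s, vanish_order2_at0
                (fun x : 'cV[R]_(n - d - 1 + d) => Lam0 s (usubmx x) (dsubmx x)) /\
              vanish_order2_at0
                (fun x : 'cV[R]_(n - d - 1 + d) => Lam1 s (usubmx x) (dsubmx x)) /\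
              vanish_order2_at0
                (fun x : 'cV[R]_(n - d - 1 + d) => Lam2 s (usubmx x) (dsubmx x))) /\
   (* (iii), (iv) *)
   (forall (t s : R) (v : 'cV[R]_(n - d - 1)) (w : 'cV[R]_d),
      I t -> `|col_mx v w| < delta ->
      [/\ Lam0 (s + T) v w = Lam0 s v (- w),
          tLam0 t (s + T) v w = tLam0 t s v (- w),
          Lam1 (s + T) v w = Lam1 s v (- w) &
          tLam1 t (s + T) v w = tLam1 t s v (- w)] /\
      Lam2 (s + T) v w = - Lam2 s v (- w) /\
      tLam2 t (s + T) v w = - tLam2 t s v (- w)) /\
   (* (v) *)
   (exists C : R, 0 < C /\
      forall (t s : R) (v : 'cV[R]_(n - d - 1)) (w : 'cV[R]_d),
        I t -> `|col_mx v w| < delta ->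
        let Z := phi s + U s *m col_mx v w in
        [/\ `|tLam0 t s v w| <= C * `|g t Z|,
            `|tLam1 t s v w| <= C * `|g t Z| &
            `|tLam2 t s v w| <= C * `|g t Z|]) /\
   (* (vi) *)
   (q0 = 0%N -> L = 0) /\
   ((1 <= q0 <= n - d - 1)%N ->
      forall j : 'I_(n - d - 1), (q0 <= j)%N -> L 0 j = 0)).
Proof.
case: n D f g phi Psi => [|m] D f g phi Psi.
  (* In dimension 0 all points coincide, so no orbit is non-trivial. *)
  move=> _ _ _ _ _ _ _ _ _ [t /negP[]].
  by apply/eqP/matrixP => -[].
move=> oD _ r2 hf _ T0 Dphi hphi phiT nontriv hPsi Psi0 [P [J [Pu hJ PJ hd]]] [v0 hv0] hq.
have p'E : derive1 phi 0 = f (phi 0) by have [] := hphi 0.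
rewrite p'E in hv0 hq.
pose p := f (phi 0); pose M := Psi T.
have Mu : M \in unitmx by exact: (Psi_unit oD r2 hf T0 Dphi phiT hphi hPsi Psi0).
have Mp : M *m p = p := monodromy_fix oD r2 hf T0 Dphi phiT hphi hPsi Psi0.
have p0 : p != 0 := orbit_velocity_neq0 oD r2 hf T0 Dphi phiT hphi hPsi Psi0 nontriv.
have MP : map_mx (real_complex R) M *m P = P *m J by rewrite -PJ !mulmxA mulmxV // mul1mx.
have [Po [B [E [[Po2 rPo PoB PoE] [E0 dE BE ME] fixP lfixP [ms [bs [msE bsE msbs]]]]]]] :=
  real_floquet_jordan T0 Mu Pu hJ MP hd.
have [Pop Bp] := fixP p Mp.
have PoM : comm_mx Po (M - 1%:M).
  have cS : Po *m (1%:M - 2 *: Po) = (1%:M - 2 *: Po) *m Po.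
    by rewrite mulmxBr mulmxBl mulmx1 mul1mx -scalemxAr -scalemxAl.
  rewrite /comm_mx mulmxBr mulmxBl mulmx1 mul1mx; congr (_ - _).
  by rewrite ME mulmxA cS -!mulmxA PoE.
have Ap : (M - 1%:M) *m p = 0 by rewrite mulmxBl Mp mul1mx subrr.
have q0d := chain_length Po2 rPo PoM Pop p0 Ap hv0.
have q0k : (q0 <= m.+1 - d - 1)%N by rewrite subn1; move: q0d; case: (m.+1 - d)%N.
split=> //.
(* [q0d] forces [d <= m], so the truncated subtractions in the matrix sizes are exact. *)
have eN : m.+1 = (1 + (m.+1 - d - 1 + d))%N by lia.
have [l [lp lPo lB]] : exists l : 'rV[R]_m.+1, [/\ l *m p = 1%:M, l *m Po = 0 & q0 = 0%N -> l *m B = 0].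
  have [q00|q0n] := eqVneq q0 0%N.
    (* Solvability at exponent 1 would contradict the maximality of [q0 = 0]. *)
    have nA : ~ exists w : 'cV[R]_m.+1, (M - 1%:M) *m w = p.
      by move=> hw; have := hq 1%N hw; rewrite q00.
    have [l [lp lA]] := dual_vector_ann nA; exists l.
    have lM : l *m M = l by move/eqP: lA; rewrite mulmxBr mulmx1 subr_eq0 => /eqP.
    by have [lPo lB] := lfixP l lM.
  (* Composing with [1 - Po] makes the dual vector vanish on the range of [Po] and keeps its value
     on [p], which [Po] kills. *)
  have [l lp] := dual_vector p0; exists (l *m (1%:M - Po)); split.
  - by rewrite -mulmxA mulmxBl mul1mx Pop subr0.
  - by rewrite -mulmxA mulmxBl mul1mx Po2 subrr mulmx0.
  - by move=> q00; rewrite q00 in q0n.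
have [Q [Ki [H1 [H2 [L [KKi KiK BQ PoQ [L0 Lj]]]]]]] :=
  floquet_basis eN Po2 rPo PoB Pop Bp lp lPo.
have [kap [delta [delta0 kap0 hkap tube]]] := small_tube oD r2 hf T0 Dphi phiT hphi hPsi Psi0
  PoE E0 dE BE ME Bp KKi KiK BQ PoQ.
exists (frame Psi E Q), H1, H2, L, (Lam0 f phi Psi E Q Ki H1 H2 L),
  (Lam1 f phi Psi E Q Ki H1 H2 L), (Lam2 f phi Psi E Q Ki H1 H2 L),
  (tLam0 f g phi Psi E Q Ki H1 H2 L), (tLam1 f g phi Psi E Q Ki H1 H2 L),
  (tLam2 f g phi Psi E Q Ki H1 H2 L), delta.
split; first exact: Ckmx_Cr_R (frame_Ck oD r2 hf T0 Dphi hphi hPsi dE Q).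
split; first exact: (frame_twist oD r2 hf T0 Dphi phiT hphi hPsi Psi0 PoE E0 dE BE ME PoQ).
split; first exact: delta0.
split.
  move=> s; have [_ ->] := hphi s.
  have h := frame_coframe oD r2 hf T0 Dphi phiT hphi hPsi Psi0 E0 dE BE Bp KKi s.
  apply/eqP; rewrite eqn_leq rank_leq_row /=.
  by have := mxrankM_maxl (row_mx (f (phi s)) (frame Psi E Q s)) (coframe Psi E Ki s);
     rewrite h mxrank1.
split.
  move=> t s v w It xd x Z sdot vdot wdot.
  have [DZ hc] := tube s _ xd; split=> //.
  have nz : 1 + usubmx (cpart (dframe f phi Psi E Q H1 H2 L s) (coframe Psi E Ki s) (col_mx v w)) 0 0 != 0.
    apply/negP => /eqP c0; have := le_trans (mx_norm_entry _ 0 0) (le_trans (usubmx_norm _) hc).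
    move/eqP: c0; rewrite addrC addr_eq0 => /eqP ->; rewrite normrN normr1; lra.
  have [_ ->] := hphi s.
  have -> : derive1 (frame Psi E Q) s = dframe f phi Psi E Q H1 H2 L s.
    rewrite derive1E.
    by have [_ ->] := frame_is_derive oD r2 hf T0 Dphi phiT hphi hPsi Psi0 E0 dE BE Bp BQ s.
  exact: (normal_form_equation g oD r2 hf T0 Dphi phiT hphi hPsi Psi0 E0 dE BE Bp KKi t nz).
split.
  apply: (spectrum_remove _ msE _ msbs).
    apply: (@root_char_poly_fix _ _ _ (map_mx (real_complex R) p)).
      by rewrite scale1r -map_mxM Mp.
    by rewrite map_mx_eq0.
  by rewrite (char_poly_floquet_block eN KKi Bp BQ).
split.
  exact: (Lam_vanish oD r2 hf T0 Dphi phiT hphi hPsi Psi0 E0 dE BE Bp H1 H2 L KiK).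
split.
  move=> t s v w _ _.
  exact: (Lam_twist g oD r2 hf T0 Dphi phiT hphi hPsi Psi0 PoE E0 dE BE ME Bp H1 H2 L KKi KiK PoQ).
split.
  exists (2 * kap); split; first by rewrite mulr_gt0.
  move=> t s v w _ xd Z; have [_ hc] := tube s _ xd.
  exact: (tLam_bounded g t (hkap s) hc).
split; first by move=> q00; exact: L0 (lB q00).
(* Columns are numbered from 0, so [j >= q0 >= 1] avoids the only entry of [L] that may be
   nonzero. *)
by move=> /andP[q01 _] j q0j; apply: Lj; apply: leq_trans q0j.
Qed.
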